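(* Let $\lambda\in(0,1)$ and $\alpha_0=\frac{1-\lambda}{1+\lambda}$. Let $(\omega_n)_{n\ge1}$ be a sequence of positive numbers such that $\omega_n/n^{1/3}\to\infty$ and $\omega_n=o(n)$ as $n\to\infty$. Then the following asymptotic formulas for the $k$-th Fourier coefficient $\widehat{b_\lambda^n}(k)$ of $b_\lambda^n$ hold as $n\to+\infty$ ($k=k(n)$ being integers). (1) If $k\in[\alpha_0n-\omega_n,\alpha_0n+\omega_n]$, then $$\widehat{b_\lambda^n}(k)\sim\frac{(-1)^{n-k}\sqrt2}{n^{1/3}}\,\frac{(1+\lambda)^{1/4}}{(\lambda(1-\lambda))^{1/12}}\,\frac{1}{\sqrt{k/n}\,(\alpha_0^{-1}-k/n)^{1/4}}\,Ai\left(n^{2/3}\gamma_{\alpha_0}^2\right),$$ where $\gamma_{\alpha_0}^2$ is asymptotically given by $$\gamma_{\alpha_0}^2\sim\frac{(\alpha_0-k/n)(1+\lambda)}{(\lambda(1-\lambda))^{1/3}},\qquad k/n\to\alpha_0.$$ (2) If $k\in[\alpha_0n+\omega_n,\alpha_0^{-1}n-\omega_n]$, then $$\widehat{b_\lambda^n}(k)\sim\sqrt{\frac{2}{n\pi}}\,\frac{\cos\left(nh(\varphi_+)-\pi/4\right)}{\sqrt{k/n}\left[(\alpha_0^{-1}-k/n)(k/n-\alpha_0)\right]^{1/4}},$$ where $h(\varphi)=h_{k/n}(\varphi)=\arg\left(e^{-i\varphi k/n}b_\lambda(e^{i\varphi})\right)$ for $\varphi\in[0,\pi]$, and $\varphi_+\in[0,\pi]$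 is defined by $$e^{i\varphi_+}=z_+=\frac{\frac kn(1+\lambda^2)-(1-\lambda^2)}{2\lambda\frac kn}+i\sqrt{1-\left(\frac{\frac kn(1+\lambda^2)-(1-\lambda^2)}{2\lambda\frac kn}\right)^2}.$$ (3) If $k\in[\alpha_0^{-1}n-\omega_n,\alpha_0^{-1}n+\omega_n]$, then $$\widehat{b_\lambda^n}(k)\sim\frac{\sqrt2}{n^{1/3}}\,\frac{(1-\lambda)^{1/4}}{(\lambda(1+\lambda))^{1/12}}\,\frac{1}{\sqrt{k/n}\,(k/n-\alpha_0)^{1/4}}\,Ai\left(n^{2/3}\gamma_{\alpha_0^{-1}}^2\right),$$ where $$\gamma_{\alpha_0^{-1}}^2\sim\frac{(k/n-\alpha_0^{-1})(1-\lambda)}{(\lambda(1+\lambda))^{1/3}},\qquad k/n\to\alpha_0^{-1}.$$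
   Context: For $\lambda\in(0,1)$, $b_\lambda(z)=\frac{z-\lambda}{1-\lambda z}$, and for integers $n\ge1$, $k\ge0$, $\widehat{b_\lambda^n}(k)=\frac{1}{2i\pi}\int_{\partial\mathbb D}b_\lambda(z)^nz^{-k}\frac{dz}{z}$ is the $k$-th Taylor coefficient at $0$ of $b_\lambda^n$. $Ai$ is the Airy function, $Ai(x)=\frac1\pi\int_0^\infty\cos\left(\frac{t^3}{3}+xt\right)dt$ (improper Riemann integral) for real $x$. Definition of $\gamma^2_{\alpha_0}$ and $\gamma^2_{\alpha_0^{-1}}$ (they depend on $a=k/n$). Put $z_\pm=z_\pm(a)=x\pm\sqrt{x^2-1}$ with $x=\frac{a(1+\lambda^2)-(1-\lambda^2)}{2\lambda a}$ (with $\sqrt{x^2-1}=i\sqrt{1-x^2}$ when $|x|<1$), and $\Phi(z)=\log\left(z^{-a}b_\lambda(z)\right)$, understood as $\log b_\lambda(z)-a\log z$, where for $\gamma_{\alpha_0}$ (with $a$ near $\alpha_0$) $\log$ is the branch with cut $[0,\infty)$ and $\log(-1)=i\pi$, and for $\gamma_{\alpha_0^{-1}}$ (with $a$ near $\alpha_0^{-1}$) $\log$ is the principal branch. In both cases $\gamma^3=\frac34\left[\Phi(z_+)-\Phi(z_-)\right]$, and $\gamma^2$ is the real number with $(\gamma^2)^3=(\gamma^3)^2$; it is positive for $a\notin[\alpha_0,\alpha_0^{-1}]$, negative for $a\in(\alpha_0,\alpha_0^{-1})$, and zero for $a\in\{\alpha_0,\alpha_0^{-1}\}$. Meaning of $\sim$: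 for expressions without oscillating sign, $f\sim g$ means $f/g\to1$. For expressions with an oscillating factor it is used in the customary sense in which one writes $Ai(-x)\sim x^{-1/4}\pi^{-1/2}\cos\left(\frac23x^{3/2}-\frac\pi4\right)$ as $x\to+\infty$, that is, up to an error that is $o(1)$ relative to the amplitude: in (2), equality holds with $\cos(nh(\varphi_+)-\pi/4)$ replaced by $\cos(nh(\varphi_+)-\pi/4)+o(1)$; in (1) and (3), writing $x=n^{2/3}\gamma^2$, the ratio of the two sides tends to $1$ when $x\ge0$, and equality holds with $Ai(x)$ replaced by $Ai(x)+o\left((1+|x|)^{-1/4}\right)$ when $x<0$. *)

(* Defs.v *)
(* Stdlib reals + Coquelicot. *)
From Stdlib Require Import Reals Lra Lia Psatz.
From Coquelicot Require Import Coquelicot.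

Local Open Scope R_scope.

(* Principal argument, in (-PI, PI]; meaningless at 0. *)
Definition Carg (z : C) : R :=
  if Rle_dec 0 (Im z) then acos (Re z / Cmod z) else - acos (Re z / Cmod z).

(* e^{i t} *)
Definition cis (t : R) : C := (cos t, sin t).

(* Principal branch of the logarithm. *)
Definition Clog (z : C) : C := (ln (Cmod z), Carg z).

(* Branch of the logarithm with cut [0, +oo) and value i PI at -1. *)
Definition Clog_pos_cut (z : C) : C := (Clog (- z) + Ci * PI)%C.

(* Integral of f(z) dz over the positively oriented unit circle. *)
Definition circle_int (f : C -> C) : C :=
  @RInt C_R_CompleteNormedModule
    (fun t => (f (cis t) * (Ci * cis t))%C) 0 (2 * PI).

Definition blaschke (lambda : R) (z : C) : C :=
  ((z - lambda) / (1 - lambda * z))%C.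

Definition fourier_coef (lambda : R) (n k : nat) : C :=
  (/ (2 * Ci * PI) * circle_int (fun z => blaschke lambda z ^ n * / z ^ k * / z))%C.

Definition Ai (x : R) : R :=
  / PI * RInt_gen (fun t => cos (t ^ 3 / 3 + x * t))
           (at_point 0) (Rbar_locally p_infty).

Definition alpha0 (lambda : R) : R := (1 - lambda) / (1 + lambda).

Definition saddle_x (lambda a : R) : R :=
  (a * (1 + lambda ^ 2) - (1 - lambda ^ 2)) / (2 * lambda * a).

(* Since [sqrt] vanishes on negative reals, this is sqrt y for y >= 0 and
   i sqrt (- y) for y < 0. *)
Definition csqrt (y : R) : C := (sqrt y, sqrt (- y)).

Definition z_plus (lambda a : R) : C :=
  (saddle_x lambda a + csqrt (saddle_x lambda a ^ 2 - 1))%C.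

Definition z_minus (lambda a : R) : C :=
  (saddle_x lambda a - csqrt (saddle_x lambda a ^ 2 - 1))%C.

Definition Phi (log : C -> C) (lambda a : R) (z : C) : C :=
  (log (blaschke lambda z) - a * log z)%C.

Definition gamma3 (log : C -> C) (lambda a : R) : C :=
  (3 / 4 * (Phi log lambda a (z_plus lambda a)
            - Phi log lambda a (z_minus lambda a)))%C.

Definition cbrt (y : R) : R := sign y * Rpower (Rabs y) (1 / 3).

(* The real number g with g^3 = (gamma^3)^2. Taking the real part loses
   nothing: see [gamma2_alpha0_spec] and [gamma2_alpha0_inv_spec]. *)
Definition gamma2 (log : C -> C) (lambda a : R) : R :=
  cbrt (Re (gamma3 log lambda a ^ 2)%C).

Definition gamma2_alpha0 : R -> R -> R := gamma2 Clog_pos_cut.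
Definition gamma2_alpha0_inv : R -> R -> R := gamma2 Clog.

(* The choice of argument is immaterial: h only enters through cos (n h - PI / 4)
   with n an integer. *)
Definition h (lambda a phi : R) : R :=
  Carg (cis (- (phi * a)) * blaschke lambda (cis phi))%C.

(* For a in [alpha0, / alpha0] this is the phi in [0, PI] with
   e^{i phi} = z_plus: see [phi_plus_spec]. *)
Definition phi_plus (lambda a : R) : R := Carg (z_plus lambda a).

(* f ~ A * c for a factor c of oscillating sign and bounded amplitude. *)
Definition equiv_osc (f : nat -> C) (A c : nat -> R) : Prop :=
  exists e : nat -> R,
    is_lim_seq e 0 /\
    eventually (fun n => f n = RtoC (A n * (c n + e n))).

(* f ~ A * Ai x: the quotient tends to 1 along the n with x n >= 0, and along
   the n with x n < 0 the error is small relative to the amplitude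
   (1 + |x|)^{-1/4} of Ai. *)
Definition equiv_Ai (f : nat -> C) (A x : nat -> R) : Prop :=
  filterlim (fun n => (f n / RtoC (A n * Ai (x n)))%C)
    (within (fun n => 0 <= x n) eventually) (locally (RtoC 1)) /\
  exists e : nat -> R,
    is_lim_seq e 0 /\
    eventually (fun n => x n < 0 ->
      f n = RtoC (A n * (Ai (x n) + e n * Rpower (1 + Rabs (x n)) (- (1 / 4))))).

Lemma cbrt_cube (y : R) : cbrt y ^ 3 = y.
Proof.
unfold cbrt.
assert (E : forall u, 0 < u -> Rpower u (1 / 3) ^ 3 = u).
{ intros u Hu. rewrite <- Rpower_pow by apply exp_pos.
  rewrite Rpower_mult. replace (1 / 3 * INR 3) with 1 by (simpl; field).
  now apply Rpower_1. }
destruct (Rtotal_order y 0) as [H | [-> | H]].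
- rewrite sign_eq_m1, Rabs_left by lra.
  rewrite Rpow_mult_distr, E by lra. lra.
- rewrite sign_0. lra.
- rewrite sign_eq_1, Rabs_right by lra. rewrite Rpow_mult_distr, E by lra. lra.
Qed.

Lemma gamma2_cube (log : C -> C) (lambda a : R) :
  Re (gamma3 log lambda a) = 0 \/ Im (gamma3 log lambda a) = 0 ->
  (RtoC (gamma2 log lambda a) ^ 3)%C = (gamma3 log lambda a ^ 2)%C.
Proof.
intros H. rewrite <- RtoC_pow. unfold gamma2. rewrite cbrt_cube.
set (g := gamma3 log lambda a) in *. destruct g as [u v].
unfold Re, Im in *; simpl in *. unfold RtoC, Cmult; simpl.
f_equal; destruct H as [-> | ->]; ring.
Qed.

Lemma saddle_x_minus (lambda a : R) : 0 < lambda < 1 -> 0 < a ->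
  saddle_x lambda a + 1 = (1 + lambda) ^ 2 * (a - alpha0 lambda) / (2 * lambda * a).
Proof. intros Hl Ha. unfold saddle_x, alpha0. field. lra. Qed.

Lemma saddle_x_plus (lambda a : R) : 0 < lambda < 1 -> 0 < a ->
  saddle_x lambda a - 1 = (1 - lambda) ^ 2 * (a - / alpha0 lambda) / (2 * lambda * a).
Proof. intros Hl Ha. unfold saddle_x, alpha0. field. lra. Qed.

Lemma frac_sign (c u d : R) : 0 < c -> 0 < d ->
  (0 <= u -> 0 <= c * u / d) /\ (u <= 0 -> c * u / d <= 0).
Proof.
intros Hc Hd. assert (Hi := Rinv_0_lt_compat d Hd). unfold Rdiv.
assert (0 < c * / d) by now apply Rmult_lt_0_compat.
split; intros Hu; nra.
Qed.

Lemma alpha0_pos (lambda : R) : 0 < lambda < 1 -> 0 < alpha0 lambda.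
Proof. intros Hl. unfold alpha0. apply Rdiv_lt_0_compat; lra. Qed.

Lemma saddle_x_bounds (lambda a : R) : 0 < lambda < 1 -> 0 < a ->
  (a <= alpha0 lambda -> saddle_x lambda a <= -1) /\
  (alpha0 lambda <= a -> -1 <= saddle_x lambda a) /\
  (a <= / alpha0 lambda -> saddle_x lambda a <= 1) /\
  (/ alpha0 lambda <= a -> 1 <= saddle_x lambda a).
Proof.
intros Hl Ha.
assert (Em := saddle_x_minus lambda a Hl Ha).
assert (Ep := saddle_x_plus lambda a Hl Ha).
assert (Hd : 0 < 2 * lambda * a) by nra.
destruct (frac_sign ((1 + lambda) ^ 2) (a - alpha0 lambda) (2 * lambda * a)) as [m1 m2];
  [nra | exact Hd |].
destruct (frac_sign ((1 - lambda) ^ 2) (a - / alpha0 lambda) (2 * lambda * a)) as [p1 p2];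
  [nra | exact Hd |].
repeat split; intros H;
  [assert (T := m2 ltac:(lra)) | assert (T := m1 ltac:(lra))
  |assert (T := p2 ltac:(lra)) | assert (T := p1 ltac:(lra))]; lra.
Qed.

Lemma z_real (lambda a : R) : 1 <= saddle_x lambda a ^ 2 ->
  let x := saddle_x lambda a in
  z_plus lambda a = RtoC (x + sqrt (x ^ 2 - 1)) /\
  z_minus lambda a = RtoC (x - sqrt (x ^ 2 - 1)).
Proof.
intros H x. unfold z_plus, z_minus, csqrt. fold x in H |- *.
rewrite (sqrt_neg_0 (- _)) by lra.
split; unfold RtoC, Cminus, Cplus, Copp; simpl; f_equal; ring.
Qed.

Lemma z_circle (lambda a : R) : saddle_x lambda a ^ 2 <= 1 ->
  let x := saddle_x lambda a in
  z_plus lambda a = (x, sqrt (1 - x ^ 2)) /\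
  z_minus lambda a = (x, - sqrt (1 - x ^ 2)).
Proof.
intros H x. unfold z_plus, z_minus, csqrt. fold x in H |- *.
rewrite (sqrt_neg_0 (x ^ 2 - 1)) by lra.
replace (- (x ^ 2 - 1)) with (1 - x ^ 2) by ring.
split; unfold RtoC, Cminus, Cplus, Copp; simpl; f_equal; ring.
Qed.

Lemma blaschke_RtoC (lambda r : R) : 1 - lambda * r <> 0 ->
  blaschke lambda (RtoC r) = RtoC ((r - lambda) / (1 - lambda * r)).
Proof.
intros H. unfold blaschke.
now rewrite RtoC_div, !RtoC_minus, RtoC_mult.
Qed.

Lemma Carg_pos (r : R) : 0 < r -> Carg (RtoC r) = 0.
Proof.
intros H. unfold Carg. rewrite Cmod_R, Rabs_right by lra.
unfold Re, Im; simpl. destruct (Rle_dec 0 0); [| lra].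
replace (r / r) with 1 by (field; lra). apply acos_1.
Qed.

Lemma Phi_Clog_im (lambda a r : R) : 0 < r -> 0 < (r - lambda) / (1 - lambda * r) ->
  1 - lambda * r <> 0 -> Im (Phi Clog lambda a (RtoC r)) = 0.
Proof.
intros Hr Hb Hd. unfold Phi. rewrite blaschke_RtoC by assumption. unfold Clog.
rewrite !Carg_pos by assumption.
unfold Im, Cminus, Cplus, Copp, Cmult, RtoC; simpl. ring.
Qed.

Lemma Phi_Clog_pos_cut_im (lambda a r : R) : 0 < lambda < 1 -> r < 0 ->
  Im (Phi Clog_pos_cut lambda a (RtoC r)) = PI - a * PI.
Proof.
intros Hl Hr. assert (Hd : 0 < 1 - lambda * r) by nra.
unfold Phi. rewrite blaschke_RtoC by lra.
unfold Clog_pos_cut, Clog. rewrite <- !RtoC_opp, !Carg_pos.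
- unfold Im, Cminus, Cplus, Copp, Cmult, Ci, RtoC; simpl. ring.
- lra.
- replace (- ((r - lambda) / (1 - lambda * r)))
    with ((lambda - r) / (1 - lambda * r)) by (field; lra).
  apply Rdiv_lt_0_compat; lra.
Qed.

Lemma blaschke_Cmod (lambda u v : R) : 0 < lambda < 1 -> u ^ 2 + v ^ 2 = 1 ->
  Cmod (blaschke lambda (u, v)) = 1.
Proof.
intros Hl H. assert (Hu : lambda * u < 1) by nra.
unfold blaschke. rewrite Cmod_div.
- assert (E : Cmod ((u, v) - lambda) = Cmod (1 - lambda * (u, v))).
  { unfold Cmod. f_equal.
    unfold Cminus, Cplus, Copp, Cmult, RtoC; simpl. nra. }
  rewrite E. unfold Rdiv. apply Rinv_r.
  intros Z. apply Cmod_eq_0 in Z. injection Z. lra.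
- intros Z. injection Z. lra.
Qed.

Lemma Phi_re_circle (log : C -> C) (lambda a u v : R) :
  (forall z, Re (log z) = ln (Cmod z)) -> 0 < lambda < 1 -> u ^ 2 + v ^ 2 = 1 ->
  Re (Phi log lambda a (u, v)) = 0.
Proof.
intros Hlog Hl H. unfold Phi, Cminus. rewrite re_plus, re_opp, re_scal_l, !Hlog.
rewrite blaschke_Cmod by assumption.
unfold Cmod; simpl fst; simpl snd. rewrite H, sqrt_1, ln_1. ring.
Qed.

Lemma gamma3_re (log : C -> C) (lambda a : R) :
  Re (gamma3 log lambda a)
  = 3 / 4 * (Re (Phi log lambda a (z_plus lambda a))
             - Re (Phi log lambda a (z_minus lambda a))).
Proof.
unfold gamma3. rewrite <- RtoC_div, re_scal_l by lra.
unfold Cminus. now rewrite re_plus, re_opp.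
Qed.

Lemma gamma3_im (log : C -> C) (lambda a : R) :
  Im (gamma3 log lambda a)
  = 3 / 4 * (Im (Phi log lambda a (z_plus lambda a))
             - Im (Phi log lambda a (z_minus lambda a))).
Proof.
unfold gamma3. rewrite <- RtoC_div, im_scal_l by lra.
unfold Cminus. now rewrite im_plus, im_opp.
Qed.

Lemma gamma3_circle (log : C -> C) (lambda a : R) :
  (forall z, Re (log z) = ln (Cmod z)) -> 0 < lambda < 1 ->
  saddle_x lambda a ^ 2 <= 1 -> Re (gamma3 log lambda a) = 0.
Proof.
intros Hlog Hl H. rewrite gamma3_re. destruct (z_circle lambda a H) as [-> ->].
assert (S := pow2_sqrt (1 - saddle_x lambda a ^ 2) ltac:(lra)).
rewrite !Phi_re_circle; try assumption; lra.
Qed.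

Lemma gamma2_alpha0_spec (lambda a : R) :
  0 < lambda < 1 -> 0 < a < / alpha0 lambda ->
  (RtoC (gamma2_alpha0 lambda a) ^ 3)%C = (gamma3 Clog_pos_cut lambda a ^ 2)%C.
Proof.
intros Hl [Ha Ha']. apply gamma2_cube.
destruct (saddle_x_bounds lambda a Hl Ha) as (B1 & B2 & B3 & _).
destruct (Rle_dec a (alpha0 lambda)) as [H | H].
- right. rewrite gamma3_im. specialize (B1 H).
  destruct (z_real lambda a ltac:(nra)) as [-> ->].
  assert (S := pow2_sqrt (saddle_x lambda a ^ 2 - 1) ltac:(nra)).
  assert (S0 := sqrt_pos (saddle_x lambda a ^ 2 - 1)).
  rewrite !Phi_Clog_pos_cut_im; try assumption; nra.
- left. apply gamma3_circle; try assumption.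
  + intros z. unfold Clog_pos_cut, Clog. rewrite Cmod_opp.
    unfold Re, Cplus, Cmult, Ci, RtoC; simpl. ring.
  + assert (-1 <= saddle_x lambda a) by (apply B2; lra).
    assert (saddle_x lambda a <= 1) by (apply B3; lra). nra.
Qed.

Lemma gamma2_alpha0_inv_spec (lambda a : R) :
  0 < lambda < 1 -> alpha0 lambda < a ->
  (RtoC (gamma2_alpha0_inv lambda a) ^ 3)%C = (gamma3 Clog lambda a ^ 2)%C.
Proof.
intros Hl Ha'. assert (Hp := alpha0_pos lambda Hl).
assert (Ha : 0 < a) by lra. apply gamma2_cube.
destruct (saddle_x_bounds lambda a Hl Ha) as (_ & B2 & B3 & B4).
destruct (Rle_dec (/ alpha0 lambda) a) as [H | H].
- right. rewrite gamma3_im. specialize (B4 H).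
  destruct (z_real lambda a ltac:(nra)) as [-> ->].
  set (x := saddle_x lambda a) in *.
  assert (S := pow2_sqrt (x ^ 2 - 1) ltac:(nra)).
  assert (S0 := sqrt_pos (x ^ 2 - 1)). set (s := sqrt (x ^ 2 - 1)) in *.
  assert (Hx : 2 * lambda * x < 1 + lambda ^ 2).
  { unfold x, saddle_x.
    replace (2 * lambda * ((a * (1 + lambda ^ 2) - (1 - lambda ^ 2)) / (2 * lambda * a)))
      with (1 + lambda ^ 2 - (1 - lambda ^ 2) / a) by (field; lra).
    assert (0 < (1 - lambda ^ 2) / a) by (apply Rdiv_lt_0_compat; nra). lra. }
  assert (Hprod : (x + s) * (x - s) = 1) by nra.
  assert (H1 : 1 <= x + s) by lra.
  assert (H2 : 0 < x - s) by nra.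
  assert (H3 : x - s <= 1) by nra.
  assert (H4 : lambda * (x + s) < 1) by nra.
  assert (H5 : lambda < x - s) by nra.
  assert (H6 : 0 < 1 - lambda * (x - s)) by nra.
  rewrite !Phi_Clog_im; try lra; apply Rdiv_lt_0_compat; lra.
- left. apply gamma3_circle; try assumption.
  + reflexivity.
  + assert (-1 <= saddle_x lambda a) by (apply B2; lra).
    assert (saddle_x lambda a <= 1) by (apply B3; lra). nra.
Qed.

Lemma phi_plus_spec (lambda a : R) :
  0 < lambda < 1 -> alpha0 lambda <= a <= / alpha0 lambda ->
  0 <= phi_plus lambda a <= PI /\ cis (phi_plus lambda a) = z_plus lambda a.
Proof.
intros Hl [H1 H2]. assert (Hp := alpha0_pos lambda Hl).
destruct (saddle_x_bounds lambda a Hl ltac:(lra)) as (_ & B2 & B3 & _).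
specialize (B2 H1). specialize (B3 H2).
unfold phi_plus. destruct (z_circle lambda a ltac:(nra)) as [-> _].
set (x := saddle_x lambda a) in *.
assert (S := pow2_sqrt (1 - x ^ 2) ltac:(nra)).
assert (S0 := sqrt_pos (1 - x ^ 2)).
assert (E : Carg (x, sqrt (1 - x ^ 2)) = acos x).
{ assert (M : Cmod (x, sqrt (1 - x ^ 2)) = 1).
  { unfold Cmod, fst, snd.
    rewrite S. replace (x ^ 2 + (1 - x ^ 2)) with 1 by ring. apply sqrt_1. }
  unfold Carg. rewrite M. unfold Re, Im, fst, snd.
  destruct (Rle_dec 0 (sqrt (1 - x ^ 2))) as [_ | ?]; [| lra].
  now rewrite Rdiv_1_r. }
rewrite E. split; [apply acos_bound |].
unfold cis. rewrite cos_acos, sin_acos by lra.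
do 2 f_equal. unfold Rsqr. ring.
Qed.

(* Main.v *)
Require Import Defs.
From Stdlib Require Import Reals Lra Lia Psatz.
From Coquelicot Require Import Coquelicot.

Local Open Scope R_scope.

(** On the unit circle [b_lambda (cis s) = cis (theta lambda s)], so the
    coefficient is [coef lambda n k], that is [1 / PI] times the integral over
    [0, PI] of the cosine of [n theta s - k s] ([fourier_coef_eq]).  The
    derivative [freq] of [theta] decreases from [1 / alpha0] at [s = 0] to
    [alpha0] at [s = PI].  With [a = k / n] strictly between these values
    the phase has one stationary point, the angle [phi_plus lambda a]; for [a]
    outside there is none, and at the two edges it degenerates.

    Between the edges the formula is that of stationary phase at [p = phi_plus].
    Near the ends of [0, PI] the second derivative of the phase is of order
    [n sin p], and [stationary_phase] is uniform as soon as [n (sin p)^3] is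
    large ([coef_stationary]).  Since [(sin p)^2] is comparable to the distance
    of [a] to the nearest edge, this is what [omega n / n^(1/3) -> oo] provides
    ([middle_range]).

    Near an edge, [z |-> - z] exchanges [lambda] and [- lambda] up to a sign
    ([coef_opp]) and moves the edge [alpha0] to [s = 0].  So both edges are
    treated at once, at [s = 0], with [mu = e lambda] and [e = 1] or [e = -1].
    As only the leading term is claimed, no uniform change of variables is
    needed; the range of [x = n^(2/3) gamma^2] is cut in three instead.
    - For bounded [x], the phase rescaled by [(n b)^(1/3)] is uniformly close to
      [t^3 / 3 + x t] ([coef_bounded_range]).  For the quotient one also needs a
      positive lower bound of [Ai] on bounded subsets of [[0, +oo)]
      ([Ai_lower_bound]).
    - For [x -> -oo], stationary phase applies both to the coefficient and to
      the Airy integral, and the two results agree ([edge_inner]).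
    - For [x -> +oo] both are exponentially small, and the quotient is
      controlled by moving the circle, respectively the line, through the saddle
      point ([circle_shift], [airy_partial_shift]), where [laplace_method] gives
      a relative error.  The exponents agree exactly, because [gamma] is
      defined by the critical value of the phase ([edge_outer]).

    The amplitudes agree because of the local geometry of the saddle.  Let [r] be
    the distance of the saddle point to the edge point, [V] the critical value,
    [D] the distance of [a] to the edge and [H] the curvature of the phase.
    Then [V' = r H], [D' = H] and [H ~ 2 b r], on either side of the edge; hence
    [V ~ 2 b r^3 / 3] and [D ~ b r^2], which determines every constant
    ([saddle_ratios]), including the linearization of [gamma^2]
    ([gamma2_linear]). *)

(** * Oscillatory integrals *)

(** The next three tactics replace the operations and the carrier of the generic
    module structure by those of [R], for [ring] and [lra]. *)
Ltac eqR := match goal with |- @eq _ ?x ?y => cut (@eq R x y); [exact (fun E => E)|] end.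

Ltac plusR := match goal with |- context [@plus _ ?a ?b] => change (@plus _ a b) with (Rplus a b) end.

Ltac scalR := repeat match goal with |- context [@scal _ _ ?a ?b] => change (@scal _ _ a b) with (Rmult a b) end.

(** [field] treats two applications of [f] as distinct atoms even when the
    arguments are equal as field expressions. *)
Ltac absorb f :=
  let E := fresh "E" in
  match goal with |- context [f ?a] => set (E := f a) end;
  repeat match goal with |- context [f ?b] =>
    replace (f b) with E by (unfold E; apply f_equal; field) end;
  clearbody E.

Lemma ex_RInt_cont (f : R -> R) (a b : R) :
  (forall x, continuous f x) -> ex_RInt f a b.
Proof. intros H. apply (ex_RInt_continuous (V := R_CompleteNormedModule)). intros; apply H. Qed.

Lemma ex_RInt_cont_on (f : R -> R) (a b : R) : a <= b ->
  (forall x, a <= x <= b -> continuous f x) -> ex_RInt f a b.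
Proof.
  intros Hab H. apply (ex_RInt_continuous (V := R_CompleteNormedModule)).
  intros x. rewrite Rmin_left, Rmax_right by lra. apply H.
Qed.

Lemma RInt_FTC (f df : R -> R) (a b : R) : a <= b ->
  (forall x, a <= x <= b -> is_derive f x (df x)) ->
  (forall x, a <= x <= b -> continuous df x) ->
  RInt df a b = f b - f a.
Proof.
  intros Hab H1 H2. apply is_RInt_unique. apply (is_RInt_derive f df).
  - intros x. rewrite Rmin_left, Rmax_right by lra. apply H1.
  - intros x. rewrite Rmin_left, Rmax_right by lra. apply H2.
Qed.

Lemma abs_RInt_le_int (f g : R -> R) (a b : R) : a <= b ->
  ex_RInt f a b -> ex_RInt g a b ->
  (forall x, a <= x <= b -> Rabs (f x) <= g x) ->
  Rabs (RInt f a b) <= RInt g a b.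
Proof.
  intros Hab Hf Hg H.
  apply (norm_RInt_le f g a b (RInt f a b) (RInt g a b) Hab H);
    now apply (RInt_correct (V := R_CompleteNormedModule)).
Qed.

Lemma RInt_point_R (f : R -> R) (a : R) : RInt f a a = 0.
Proof. exact (RInt_point (V := R_CompleteNormedModule) a f). Qed.

(** Integrating by parts costs the variation of [u], which for a positive
    decreasing weight is controlled by its initial value. *)
Lemma abs_RInt_decreasing_weight (u du g dg : R -> R) (a b : R) : a <= b ->
  (forall x, a <= x <= b -> is_derive u x (du x)) ->
  (forall x, a <= x <= b -> continuous du x) ->
  (forall x, a <= x <= b -> is_derive g x (dg x)) ->
  (forall x, a <= x <= b -> continuous dg x) ->
  (forall x, a <= x <= b -> du x <= 0) -> 0 <= u b ->
  (forall x, a <= x <= b -> Rabs (g x) <= 1) ->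
  Rabs (RInt (fun x => u x * dg x) a b) <= 2 * u a.
Proof.
  intros Hab Hu Hdu Hg Hdg Hneg Hub Hg1.
  assert (Cu : forall x, a <= x <= b -> continuous u x).
  { intros x Hx. apply (ex_derive_continuous u). eexists; now apply Hu. }
  assert (Cg : forall x, a <= x <= b -> continuous g x).
  { intros x Hx. apply (ex_derive_continuous g). eexists; now apply Hg. }
  assert (E1 : ex_RInt (fun x => u x * dg x) a b).
  { apply ex_RInt_cont_on; [lra|]. intros x Hx. apply (continuous_mult u dg); auto. }
  assert (E2 : ex_RInt (fun x => du x * g x) a b).
  { apply ex_RInt_cont_on; [lra|]. intros x Hx. apply (continuous_mult du g); auto. }
  assert (S : RInt (fun x => du x * g x + u x * dg x) a b = u b * g b - u a * g a).
  { apply (RInt_FTC (fun x => u x * g x)); [lra| |].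
    - intros x Hx. apply (is_derive_mult u g x (du x) (dg x)); auto.
      intros; apply Rmult_comm.
    - intros x Hx. apply (continuous_plus (fun x => du x * g x) (fun x => u x * dg x)).
      + apply (continuous_mult du g); auto.
      + apply (continuous_mult u dg); auto. }
  rewrite (RInt_plus (V := R_CompleteNormedModule)) in S by assumption.
  unfold plus in S; simpl in S.
  assert (B : Rabs (RInt (fun x => du x * g x) a b) <= RInt (fun x => - du x) a b).
  { apply abs_RInt_le_int; auto.
    - apply ex_RInt_cont_on; [lra|]. intros x Hx. apply (continuous_opp du); auto.
    - intros x Hx. rewrite Rabs_mult, (Rabs_left1 (du x)) by auto.
      specialize (Hneg x Hx). specialize (Hg1 x Hx).
      assert (0 <= Rabs (g x)) by apply Rabs_pos. nra. }
  assert (B2 : RInt (fun x => - du x) a b = (- u b) - (- u a)).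
  { apply (RInt_FTC (fun x => - u x)); [lra| |].
    - intros x Hx. apply (is_derive_opp u); auto.
    - intros x Hx. apply (continuous_opp du); auto. }
  assert (Hua : 0 <= u a).
  { assert (0 <= RInt (fun x => - du x) a b).
    { eapply Rle_trans; [|exact B]. apply Rabs_pos. } lra. }
  assert (Ga := Hg1 a ltac:(lra)). assert (Gb := Hg1 b ltac:(lra)).
  apply Rabs_le_between in Ga. apply Rabs_le_between in Gb.
  apply Rabs_le_between in B. apply Rabs_le. nra.
Qed.

(** The first derivative test of van der Corput, for a convex phase: write
    [cos f = (1 / f') (sin f)'] and observe that [1 / f'] decreases. *)
Lemma van_der_corput (f f1 f2 : R -> R) (a b m : R) : a <= b ->
  (forall x, a <= x <= b -> is_derive f x (f1 x)) ->
  (forall x, a <= x <= b -> is_derive f1 x (f2 x)) ->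
  (forall x, a <= x <= b -> continuous f2 x) ->
  (forall x, a <= x <= b -> 0 <= f2 x) ->
  0 < m <= f1 a ->
  Rabs (RInt (fun x => cos (f x)) a b) <= 2 / m.
Proof.
  intros Hab H1 H2 C2 P2 Hm.
  assert (M : forall x, a <= x <= b -> f1 a <= f1 x).
  { intros x Hx.
    assert (E : RInt f2 a x = f1 x - f1 a).
    { apply RInt_FTC; [lra| |]; intros; [apply H2|apply C2]; lra. }
    assert (0 <= RInt f2 a x).
    { apply RInt_ge_0; [lra| |].
      - apply ex_RInt_cont_on; [lra|]. intros; apply C2; lra.
      - intros; apply P2; lra. }
    lra. }
  assert (C1 : forall x, a <= x <= b -> continuous f1 x).
  { intros x Hx. apply (ex_derive_continuous f1). eexists; now apply H2. }
  assert (Cf : forall x, a <= x <= b -> continuous f x).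
  { intros x Hx. apply (ex_derive_continuous f). eexists; now apply H1. }
  assert (Ccos : forall x, a <= x <= b -> continuous (fun x => cos (f x)) x).
  { intros x Hx. apply (continuous_comp f cos); auto. apply continuous_cos. }
  rewrite (RInt_ext _ (fun x => / f1 x * (f1 x * cos (f x)))).
  2:{ intros x. rewrite Rmin_left, Rmax_right by lra. intros Hx.
      assert (T := M x ltac:(lra)). eqR. field. lra. }
  apply Rle_trans with (2 * / f1 a).
  2:{ unfold Rdiv. apply Rmult_le_compat_l; [lra|]. apply Rinv_le_contravar; lra. }
  apply (abs_RInt_decreasing_weight (fun x => / f1 x) (fun x => - f2 x / (f1 x)^2)
           (fun x => sin (f x)) (fun x => f1 x * cos (f x))); try lra.
  - intros x Hx. assert (T := M x Hx).
    apply is_derive_inv; [auto | lra].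
  - intros x Hx. assert (T := M x Hx).
    apply (continuous_mult (fun x => - f2 x) (fun x => / (f1 x)^2)).
    + apply (continuous_opp f2); auto.
    + apply continuous_Rinv_comp.
      * apply (continuous_comp f1 (fun y => y^2)); auto.
        apply (ex_derive_continuous (fun y => y^2)). now auto_derive.
      * apply pow_nonzero. lra.
  - intros x Hx. specialize (H1 x Hx).
    apply (is_derive_comp sin f x (cos (f x)) (f1 x)); auto.
    apply is_derive_sin.
  - intros x Hx. apply (continuous_mult f1 (fun x => cos (f x))); auto.
  - intros x Hx. assert (T := M x Hx). specialize (P2 x Hx).
    assert (0 < / (f1 x)^2) by (apply Rinv_0_lt_compat; nra).
    unfold Rdiv. nra.
  - left. apply Rinv_0_lt_compat. assert (T := M b ltac:(lra)). lra.
  - intros x Hx. apply Rabs_le. apply SIN_bound.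
Qed.

Lemma RInt_reflect (f : R -> R) (a b : R) :
  ex_RInt f a b -> RInt (fun x => f (- x)) (- b) (- a) = RInt f a b.
Proof.
  intros H.
  assert (E : is_RInt (fun x => - 1 * f (- x)) (- a) (- b) (RInt f a b)).
  { assert (T := is_RInt_comp_lin f (-1) 0 (-a) (-b) (RInt f a b)).
    replace (-1 * - a + 0) with a in T by ring.
    replace (-1 * - b + 0) with b in T by ring.
    specialize (T (RInt_correct _ _ _ H)).
    eapply is_RInt_ext; [|exact T]. intros x _. unfold scal; simpl; unfold mult; simpl.
    f_equal. f_equal. ring. }
  apply is_RInt_swap in E.
  apply (is_RInt_scal _ _ _ (-1)) in E.
  apply is_RInt_unique.
  replace (RInt f a b) with (scal (-1) (opp (RInt f a b)))
    by (unfold scal, opp; simpl; unfold mult; simpl; ring).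
  eapply is_RInt_ext; [|exact E]. intros x _. unfold scal; simpl; unfold mult; simpl. ring.
Qed.

(** The same test to the left of the stationary point, by reflection. *)
Lemma van_der_corput_left (f f1 f2 : R -> R) (a b m : R) : a <= b ->
  (forall x, a <= x <= b -> is_derive f x (f1 x)) ->
  (forall x, a <= x <= b -> is_derive f1 x (f2 x)) ->
  (forall x, a <= x <= b -> continuous f2 x) ->
  (forall x, a <= x <= b -> 0 <= f2 x) ->
  0 < m -> f1 b <= - m ->
  Rabs (RInt (fun x => cos (f x)) a b) <= 2 / m.
Proof.
  intros Hab H1 H2 C2 P2 Hm Hb.
  rewrite <- (RInt_reflect (fun x => cos (f x))).
  2:{ apply ex_RInt_cont_on; [lra|]. intros x Hx.
      apply (continuous_comp f cos); [|apply continuous_cos].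
      apply (ex_derive_continuous f). eexists; now apply H1. }
  apply (van_der_corput (fun x => f (- x)) (fun x => - f1 (- x)) (fun x => f2 (- x))); try lra.
  - intros x Hx.
    replace (- f1 (- x)) with (scal (-1) (f1 (- x)))
      by (unfold scal; simpl; unfold mult; simpl; ring).
    apply (is_derive_comp f Ropp x).
    + apply H1. lra.
    + auto_derive; auto.
  - intros x Hx.
    replace (f2 (- x)) with (opp (scal (-1) (f2 (- x))))
      by (unfold scal, opp; simpl; unfold mult; simpl; ring).
    apply (is_derive_opp (fun x => f1 (- x))).
    apply (is_derive_comp f1 Ropp x).
    + apply H2. lra.
    + auto_derive; auto.
  - intros x Hx. apply (continuous_comp Ropp f2).
    + apply (ex_derive_continuous Ropp). now auto_derive.
    + apply C2. lra.
  - intros x Hx. apply P2; lra.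
  - rewrite Ropp_involutive. lra.
Qed.

Lemma abs_sin_le (x : R) : 0 <= x -> Rabs (sin x) <= x.
Proof.
  intros Hx.
  replace (sin x) with (RInt cos 0 x).
  - replace x with ((x - 0) * 1) at 2 by ring.
    apply abs_RInt_le_const; [lra| |].
    + apply ex_RInt_cont. intros; apply continuous_cos.
    + intros; apply Rabs_le, COS_bound.
  - rewrite (RInt_FTC sin); try lra.
    + rewrite sin_0. eqR. ring.
    + intros; apply is_derive_sin.
    + intros; apply continuous_cos.
Qed.

Lemma one_minus_cos_le (x : R) : 0 <= 1 - cos x <= x ^ 2 / 2.
Proof.
  assert (H : forall y, 0 <= y -> 1 - cos y <= y ^ 2 / 2).
  { intros y Hy. replace (cos y) with (cos (2 * (y / 2))) by (f_equal; field).
    rewrite cos_2a_sin. assert (T := abs_sin_le (y / 2) ltac:(lra)).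
    apply Rabs_le_between in T. nra. }
  split; [assert (T := COS_bound x); lra|].
  destruct (Rle_dec 0 x).
  - now apply H.
  - specialize (H (- x) ltac:(lra)). rewrite cos_neg in H.
    replace (x ^ 2) with ((- x) ^ 2) by ring. exact H.
Qed.

Lemma exp_le (x y : R) : x <= y -> exp x <= exp y.
Proof. intros [H| ->]; [left; now apply exp_increasing | right; reflexivity]. Qed.

Lemma le_of_pow_le (n : nat) (x y : R) : 0 <= y -> x ^ S n <= y ^ S n -> x <= y.
Proof.
  intros Hy H. apply Rnot_lt_le. intros Hlt.
  assert (T : y ^ S n < x ^ S n).
  { clear H. induction n as [|n IH]; [simpl; lra|].
    change (y * y ^ S n < x * x ^ S n).
    assert (0 <= y ^ S n) by now apply pow_le. nra. }
  lra.
Qed.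

(** * Gaussian and Fresnel integrals *)

Ltac cont_ad := match goal with |- continuous ?f ?x =>
  apply (ex_derive_continuous (K := R_AbsRing) (V := R_NormedModule) f x); auto_derive end.

Ltac c2d :=
  repeat first
   [ apply continuity_2d_pt_plus | apply continuity_2d_pt_minus
   | apply continuity_2d_pt_mult | apply continuity_2d_pt_opp
   | apply continuity_2d_pt_const | apply continuity_2d_pt_id1
   | apply continuity_2d_pt_id2 ].

Lemma is_derive_RInt_param' (F dF : R -> R -> R) (a b x0 : R) : a <= b ->
  locally x0 (fun x => forall s, is_derive (fun x => F x s) x (dF x s)) ->
  (forall s, a <= s <= b -> continuity_2d_pt dF x0 s) ->
  locally x0 (fun x => forall s, a <= s <= b -> continuous (F x) s) ->
  is_derive (fun x => RInt (F x) a b) x0 (RInt (dF x0) a b).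
Proof.
  intros Hab HD HC Hc.
  replace (RInt (dF x0) a b)
    with (RInt (fun t => Derive (fun u => F u t) x0) a b).
  2:{ apply RInt_ext. intros s _. apply is_derive_unique.
      apply (locally_singleton _ _ HD). }
  apply is_derive_RInt_param.
  - revert HD. apply filter_imp. intros x H t _. eexists; apply H.
  - intros t Ht. rewrite Rmin_left, Rmax_right in Ht by lra.
    apply (continuity_2d_pt_ext_loc dF).
    + destruct HD as [e He]. exists e. intros u v Hu _.
      symmetry. apply is_derive_unique. apply He. exact Hu.
    + now apply HC.
  - revert Hc. apply filter_imp. intros x H. apply ex_RInt_cont_on; auto.
Qed.

Lemma deriv_zero_const (f : R -> R) (a b : R) : a <= b ->
  (forall x, a <= x <= b -> is_derive f x 0) -> f b = f a.
Proof.
  intros Hab H.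
  assert (E := RInt_FTC f (fun _ => 0) a b Hab H ltac:(intros; apply continuous_const)).
  rewrite RInt_const in E. unfold scal in E; simpl in E; unfold mult in E; simpl in E. lra.
Qed.

(** Up to a factor this is, for suitable [phi], the square of
    [RInt (exp (- t^2 / 2)) 0 x] (or of its Fresnel analogue) minus its limit, in
    polar coordinates: [s] is the tangent of the angle. *)
Definition square_int (phi : R -> R) (x : R) : R :=
  RInt (fun s => phi (x ^ 2 * (1 + s ^ 2) / 2) * / (1 + s ^ 2)) 0 1.

(** The polar-coordinates trick without double integrals: this derivative is
    also that of the square of [RInt (exp (- t^2 / 2)) 0 x], and of the real
    and imaginary part of the square of [RInt (exp (i t^2 / 2)) 0 x]. *)
Lemma is_derive_square_int (phi dphi : R -> R) (x : R) :
  (forall u, is_derive phi u (dphi u)) -> (forall u, continuous dphi u) ->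
  is_derive (square_int phi) x (RInt (fun t => dphi ((x ^ 2 + t ^ 2) / 2)) 0 x).
Proof.
  intros Hp Hd.
  replace (RInt (fun t => dphi ((x ^ 2 + t ^ 2) / 2)) 0 x)
    with (RInt (fun s => x * dphi (x ^ 2 * (1 + s ^ 2) / 2)) 0 1).
  2:{ rewrite (RInt_ext _ (fun s => scal x (dphi ((x ^ 2 + (x * s + 0) ^ 2) / 2)))).
      - rewrite (RInt_comp_lin (fun t => dphi ((x ^ 2 + t ^ 2) / 2))).
        + f_equal; ring.
        + apply ex_RInt_cont. intros t.
          apply (continuous_comp (fun t => (x ^ 2 + t ^ 2) / 2) dphi); [cont_ad; auto | apply Hd].
      - intros s _. unfold scal; simpl; unfold mult; simpl. do 2 f_equal. field. }
  apply (is_derive_RInt_param'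
           (fun x s => phi (x ^ 2 * (1 + s ^ 2) / 2) * / (1 + s ^ 2))
           (fun x s => x * dphi (x ^ 2 * (1 + s ^ 2) / 2))); try lra.
  - apply filter_forall. intros y s.
    assert (Hs : 1 + s ^ 2 <> 0) by nra.
    replace (y * dphi (y ^ 2 * (1 + s ^ 2) / 2))
      with ((y * (1 + s ^ 2)) * dphi (y ^ 2 * (1 + s ^ 2) / 2) * / (1 + s ^ 2)) by (field; lra).
    apply (is_derive_scal_l (fun y => phi (y ^ 2 * (1 + s ^ 2) / 2)) y _ (/ (1 + s ^ 2))).
    apply (is_derive_comp phi (fun y => y ^ 2 * (1 + s ^ 2) / 2)).
    + apply Hp.
    + auto_derive; auto. field.
  - intros s _. apply continuity_2d_pt_mult; [apply continuity_2d_pt_id1|].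
    apply (continuity_1d_2d_pt_comp dphi (fun x s => x ^ 2 * (1 + s ^ 2) / 2)).
    + apply continuity_pt_filterlim. apply Hd.
    + simpl. c2d.
  - apply filter_forall. intros y s _.
    apply (continuous_mult (fun s => phi (y ^ 2 * (1 + s ^ 2) / 2)) (fun s => / (1 + s ^ 2))).
    + apply (continuous_comp (fun s => y ^ 2 * (1 + s ^ 2) / 2) phi).
      * cont_ad; auto.
      * apply (ex_derive_continuous phi). eexists; apply Hp.
    + cont_ad. nra.
Qed.

Lemma square_int_0 (phi : R -> R) : square_int phi 0 = phi 0 * (PI / 4).
Proof.
  unfold square_int.
  rewrite (RInt_FTC (fun s => phi 0 * atan s)); [|lra| |].
  - rewrite atan_1, atan_0. ring.
  - intros s _. auto_derive; auto.
    replace (0 ^ 2 * (1 + s ^ 2) / 2) with 0 by field. unfold Rsqr. field. nra.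
  - intros s _. apply (continuous_mult (fun s => phi (0 ^ 2 * (1 + s ^ 2) / 2)) (fun s => / (1 + s ^ 2))).
    + apply (continuous_ext (fun _ => phi 0)).
      * intros t. f_equal. field.
      * apply continuous_const.
    + cont_ad. nra.
Qed.

Lemma is_derive_RInt_0 (f : R -> R) (x : R) :
  (forall t, continuous f t) -> is_derive (fun x => RInt f 0 x) x (f x).
Proof.
  intros H. apply (is_derive_RInt f _ 0 x).
  - apply filter_forall. intros y. apply (RInt_correct (V := R_CompleteNormedModule)).
    apply ex_RInt_cont, H.
  - apply H.
Qed.

Lemma gauss_square (x : R) : 0 <= x ->
  RInt (fun t => exp (- (t ^ 2 / 2))) 0 x ^ 2
  = PI / 2 + 2 * square_int (fun u => - exp (- u)) x.
Proof.
  intros Hx.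
  assert (C : forall t, continuous (fun t => exp (- (t ^ 2 / 2))) t) by (intros; cont_ad; auto).
  set (I := fun x => RInt (fun t => exp (- (t ^ 2 / 2))) 0 x).
  assert (E : I x ^ 2 - 2 * square_int (fun u => - exp (- u)) x
              = I 0 ^ 2 - 2 * square_int (fun u => - exp (- u)) 0).
  { apply (deriv_zero_const (fun x => I x ^ 2 - 2 * square_int (fun u => - exp (- u)) x)); auto.
    intros y _.
    assert (D1 : is_derive I y (exp (- (y ^ 2 / 2)))) by (apply (is_derive_RInt_0 _ y C)).
    assert (D2 := is_derive_square_int (fun u => - exp (- u)) (fun u => exp (- u)) y
       ltac:(intros; auto_derive; auto; ring) ltac:(intros; cont_ad; auto)).
    evar_last.
    { apply (is_derive_minus (fun x => I x ^ 2) (fun x => 2 * square_int (fun u => - exp (- u)) x)).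
      - apply (is_derive_pow I 2); exact D1.
      - apply (is_derive_scal (square_int (fun u => - exp (- u)))). exact D2. }
    assert (E : RInt (fun t => exp (- ((y ^ 2 + t ^ 2) / 2))) 0 y = exp (- (y ^ 2 / 2)) * I y).
    { unfold I. rewrite <- (RInt_scal (V := R_CompleteNormedModule)).
      2:{ now apply ex_RInt_cont. }
      apply RInt_ext. intros t _. unfold scal; simpl; unfold mult; simpl.
      rewrite <- exp_plus. f_equal. field. }
    cbv beta; rewrite E. unfold minus, plus, opp; simpl. eqR. ring. }
  assert (I0 : I 0 = 0) by apply RInt_point_R.
  rewrite square_int_0, I0 in E. rewrite Ropp_0, exp_0 in E. fold (I x). lra.
Qed.

Definition close_at_infty (f : R -> R) (l : R) : Prop :=
  forall e, 0 < e -> exists M, 0 < M /\ forall x, M <= x -> Rabs (f x - l) <= e.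

Lemma inv_square_int_le (a b c : R) : 0 < a <= b -> 0 < c ->
  RInt (fun s => / (c * s ^ 2)) a b <= / (c * a).
Proof.
  intros Hab Hc.
  rewrite (RInt_FTC (fun s => - / (c * s))); try lra.
  - assert (0 < / (c * b)) by (apply Rinv_0_lt_compat; nra). lra.
  - intros s Hs. assert (0 < c * s) by nra. auto_derive; [lra|]. field. lra.
  - intros s Hs. assert (0 < c * s) by nra. cont_ad. nra.
Qed.

Lemma gauss_close :
  close_at_infty (fun x => RInt (fun t => exp (- (t ^ 2 / 2))) 0 x) (sqrt (PI / 2)).
Proof.
  intros e He.
  exists (1 + 4 / e). assert (P4 := PI2_3_2). assert (PP : 3 / 2 < PI / 2) by (unfold PI2 in P4; lra).
  assert (He' : 0 < 4 / e) by (apply Rdiv_lt_0_compat; lra).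
  split; [lra|]. intros x Hx.
  assert (E := gauss_square x ltac:(lra)).
  set (I := RInt (fun t => exp (- (t ^ 2 / 2))) 0 x) in *.
  assert (I0 : 0 <= I).
  { apply RInt_ge_0; [lra| |].
    - apply ex_RInt_cont. intros; cont_ad; auto.
    - intros; left; apply exp_pos. }
  assert (B : Rabs (square_int (fun u => - exp (- u)) x) <= 2 / x ^ 2).
  { unfold square_int. replace (2 / x ^ 2) with ((1 - 0) * (2 / x ^ 2)) by ring.
    apply abs_RInt_le_const; [lra| |].
    - apply ex_RInt_cont. intros s. cont_ad. nra.
    - intros s Hs.
      assert (0 < exp (- (x ^ 2 * (1 + s ^ 2) / 2)) <= 2 / x ^ 2).
      { split; [apply exp_pos|]. rewrite exp_Ropp.
        replace (2 / x ^ 2) with (/ (x ^ 2 / 2)) by (field; nra).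
        apply Rinv_le_contravar; [nra|].
        assert (T := exp_ineq1_le (x ^ 2 * (1 + s ^ 2) / 2)). nra. }
      assert (0 < / (1 + s ^ 2) <= 1).
      { split; [apply Rinv_0_lt_compat; nra|]. rewrite <- Rinv_1.
        apply Rinv_le_contravar; nra. }
      rewrite Rabs_mult, Rabs_Ropp, !Rabs_pos_eq by lra. nra. }
  assert (X : 2 * (2 / x ^ 2) <= e).
  { assert (e * x >= 4).
    { replace 4 with (e * (4 / e)) by (field; lra). nra. }
    unfold Rdiv. replace (2 * (2 * / x ^ 2)) with (4 * / x ^ 2) by ring.
    apply Rmult_le_reg_r with (x ^ 2); [nra|].
    rewrite Rmult_assoc, Rinv_l by nra. nra. }
  assert (S := sqrt_sqrt (PI / 2) ltac:(lra)).
  assert (S1 : 1 <= sqrt (PI / 2)).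
  { rewrite <- sqrt_1 at 1. apply sqrt_le_1; lra. }
  set (c := sqrt (PI / 2)) in *.
  apply Rabs_le_between in B. apply Rabs_le.
  nra.
Qed.

Definition fresnel_cos (x : R) : R := RInt (fun t => cos (t ^ 2 / 2)) 0 x.
Definition fresnel_sin (x : R) : R := RInt (fun t => sin (t ^ 2 / 2)) 0 x.

Lemma continuous_cos_sq : forall t, continuous (fun t => cos (t ^ 2 / 2)) t.
Proof. intros; cont_ad; auto. Qed.
Lemma continuous_sin_sq : forall t, continuous (fun t => sin (t ^ 2 / 2)) t.
Proof. intros; cont_ad; auto. Qed.

Lemma fresnel_rotate (x : R) :
  RInt (fun t => cos ((x ^ 2 + t ^ 2) / 2)) 0 x
    = cos (x ^ 2 / 2) * fresnel_cos x - sin (x ^ 2 / 2) * fresnel_sin x /\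
  RInt (fun t => sin ((x ^ 2 + t ^ 2) / 2)) 0 x
    = sin (x ^ 2 / 2) * fresnel_cos x + cos (x ^ 2 / 2) * fresnel_sin x.
Proof.
  assert (A : forall u v, RInt (fun t => u * cos (t ^ 2 / 2) + v * sin (t ^ 2 / 2)) 0 x
                          = u * fresnel_cos x + v * fresnel_sin x).
  { intros u v. rewrite (RInt_plus (V := R_CompleteNormedModule)).
    - unfold plus; simpl.
      rewrite (RInt_scal (V := R_CompleteNormedModule) (fun t => cos (t ^ 2 / 2))).
      + rewrite (RInt_scal (V := R_CompleteNormedModule) (fun t => sin (t ^ 2 / 2))).
        * reflexivity.
        * apply ex_RInt_cont, continuous_sin_sq.
      + apply ex_RInt_cont, continuous_cos_sq.
    - apply ex_RInt_cont. intros; cont_ad; auto.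
    - apply ex_RInt_cont. intros; cont_ad; auto. }
  split.
  - rewrite (RInt_ext _ (fun t => cos (x ^ 2 / 2) * cos (t ^ 2 / 2)
                                  + - sin (x ^ 2 / 2) * sin (t ^ 2 / 2))).
    + rewrite A. eqR. ring.
    + intros t _. replace ((x ^ 2 + t ^ 2) / 2) with (x ^ 2 / 2 + t ^ 2 / 2) by field.
      rewrite cos_plus. eqR. ring.
  - rewrite (RInt_ext _ (fun t => sin (x ^ 2 / 2) * cos (t ^ 2 / 2)
                                  + cos (x ^ 2 / 2) * sin (t ^ 2 / 2))).
    + rewrite A. eqR. ring.
    + intros t _. replace ((x ^ 2 + t ^ 2) / 2) with (x ^ 2 / 2 + t ^ 2 / 2) by field.
      rewrite sin_plus. eqR. ring.
Qed.

Lemma fresnel_squares (x : R) : 0 <= x ->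
  fresnel_cos x ^ 2 - fresnel_sin x ^ 2 = 2 * square_int sin x /\
  fresnel_cos x * fresnel_sin x = PI / 4 + square_int (fun u => - cos u) x.
Proof.
  intros Hx.
  assert (DX : forall y, is_derive fresnel_cos y (cos (y ^ 2 / 2))) by (intros; apply (is_derive_RInt_0 (fun t => cos (t ^ 2 / 2))); apply continuous_cos_sq).
  assert (DY : forall y, is_derive fresnel_sin y (sin (y ^ 2 / 2))) by (intros; apply (is_derive_RInt_0 (fun t => sin (t ^ 2 / 2))); apply continuous_sin_sq).
  assert (X0 : fresnel_cos 0 = 0) by apply RInt_point_R. assert (Y0 : fresnel_sin 0 = 0) by apply RInt_point_R.
  split.
  - assert (E : fresnel_cos x ^ 2 - fresnel_sin x ^ 2 - 2 * square_int sin x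
                = fresnel_cos 0 ^ 2 - fresnel_sin 0 ^ 2 - 2 * square_int sin 0).
    { apply (deriv_zero_const (fun x => fresnel_cos x ^ 2 - fresnel_sin x ^ 2 - 2 * square_int sin x)); auto.
      intros y _. evar_last.
      { apply (is_derive_minus (fun x => fresnel_cos x ^ 2 - fresnel_sin x ^ 2) (fun x => 2 * square_int sin x)).
        - apply (is_derive_minus (fun x => fresnel_cos x ^ 2) (fun x => fresnel_sin x ^ 2)).
          + apply (is_derive_pow fresnel_cos 2). apply DX.
          + apply (is_derive_pow fresnel_sin 2). apply DY.
        - apply (is_derive_scal (square_int sin)). apply (is_derive_square_int sin cos).
          + intros; apply is_derive_sin.
          + intros; apply continuous_cos. }
      destruct (fresnel_rotate y) as [E _]. rewrite E.
      unfold minus, plus, opp; simpl. eqR. ring. }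
    rewrite square_int_0, X0, Y0, sin_0 in E. lra.
  - assert (E : fresnel_cos x * fresnel_sin x - square_int (fun u => - cos u) x
                = fresnel_cos 0 * fresnel_sin 0 - square_int (fun u => - cos u) 0).
    { apply (deriv_zero_const (fun x => fresnel_cos x * fresnel_sin x - square_int (fun u => - cos u) x)); auto.
      intros y _. evar_last.
      { apply (is_derive_minus (fun x => fresnel_cos x * fresnel_sin x) (square_int (fun u => - cos u))).
        - apply (is_derive_mult fresnel_cos fresnel_sin).
          + apply DX.
          + apply DY.
          + intros; apply Rmult_comm.
        - apply (is_derive_square_int (fun u => - cos u) sin).
          + intros; auto_derive; auto; ring.
          + intros; apply continuous_sin. }
      destruct (fresnel_rotate y) as [_ E]. rewrite E.
      unfold minus, plus, opp, mult; simpl. eqR. ring. }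
    rewrite square_int_0, X0, Y0, cos_0 in E. lra.
Qed.

(** The phase of [phi (x^2 (1 + s^2) / 2)] is stationary at [s = 0] only.  On
    [[0, 1 / x]] the trivial bound is good enough; on [[1 / x, 1]] one integrates
    by parts with the decreasing weight [1 / (x^2 s (1 + s^2))]. *)
Lemma square_int_decay (phi dphi : R -> R) (x : R) : 1 <= x ->
  (forall u, is_derive dphi u (phi u)) -> (forall u, continuous phi u) ->
  (forall u, Rabs (phi u) <= 1) -> (forall u, Rabs (dphi u) <= 1) ->
  Rabs (square_int phi x) <= 3 / x.
Proof.
  intros Hx HD HC B1 B2. unfold square_int.
  assert (Hx' : 0 < / x <= 1).
  { split; [apply Rinv_0_lt_compat; lra|]. rewrite <- Rinv_1. apply Rinv_le_contravar; lra. }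
  assert (C0 : forall s, continuous (fun s => phi (x ^ 2 * (1 + s ^ 2) / 2)) s).
  { intros s. apply (continuous_comp (fun s => x ^ 2 * (1 + s ^ 2) / 2) phi); auto. cont_ad; auto. }
  assert (C : forall s, continuous (fun s => phi (x ^ 2 * (1 + s ^ 2) / 2) * / (1 + s ^ 2)) s).
  { intros s. apply (continuous_mult (fun s => phi (x ^ 2 * (1 + s ^ 2) / 2)) (fun s => / (1 + s ^ 2))); auto.
    cont_ad. nra. }
  rewrite <- (RInt_Chasles (V := R_CompleteNormedModule) _ 0 (/ x) 1) by now apply ex_RInt_cont.
  plusR.
  eapply Rle_trans; [apply Rabs_triang|].
  replace (3 / x) with (1 / x + 2 * / x) by (field; lra).
  apply Rplus_le_compat.
  - replace (1 / x) with ((/ x - 0) * 1) by (field; lra).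
    apply abs_RInt_le_const; [lra| now apply ex_RInt_cont|].
    intros s Hs. rewrite Rabs_mult, (Rabs_pos_eq (/ _)).
    2:{ left. apply Rinv_0_lt_compat. nra. }
    assert (0 < / (1 + s ^ 2) <= 1).
    { split; [apply Rinv_0_lt_compat; nra|]. rewrite <- Rinv_1. apply Rinv_le_contravar; nra. }
    specialize (B1 (x ^ 2 * (1 + s ^ 2) / 2)).
    assert (P := Rabs_pos (phi (x ^ 2 * (1 + s ^ 2) / 2))). simpl in *. nra.
  - set (u := fun s => / (x ^ 2 * s * (1 + s ^ 2))).
    rewrite (RInt_ext _ (fun s => u s * (x ^ 2 * s * phi (x ^ 2 * (1 + s ^ 2) / 2)))).
    2:{ intros s. rewrite Rmin_left, Rmax_right by lra. intros Hs. unfold u. eqR.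
        field. repeat split; nra. }
    assert (Hpos : forall s, / x <= s <= 1 -> 0 < x ^ 2 * s * (1 + s ^ 2)).
    { intros s Hs. apply Rmult_lt_0_compat; [apply Rmult_lt_0_compat|]; nra. }
    apply Rle_trans with (2 * u (/ x)).
    2:{ apply Rmult_le_compat_l; [lra|]. unfold u.
        apply Rinv_le_contravar; [lra|].
        replace (x ^ 2 * / x * (1 + (/ x) ^ 2)) with (x + / x) by (field; lra). lra. }
    apply (abs_RInt_decreasing_weight u
             (fun s => - (x ^ 2 * (1 + 3 * s ^ 2)) / (x ^ 2 * s * (1 + s ^ 2)) ^ 2)
             (fun s => dphi (x ^ 2 * (1 + s ^ 2) / 2))).
    + lra.
    + intros s Hs. specialize (Hpos s Hs). unfold u. auto_derive.
      * simpl in Hpos. lra.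
      * field. nra.
    + intros s Hs. specialize (Hpos s Hs). cont_ad. simpl in Hpos. nra.
    + intros s Hs.
      apply (is_derive_comp dphi (fun s => x ^ 2 * (1 + s ^ 2) / 2) s); auto.
      auto_derive; auto. field.
    + intros s Hs. apply (continuous_mult (fun s => x ^ 2 * s)); auto. cont_ad; auto.
    + intros s Hs. specialize (Hpos s Hs). unfold Rdiv.
      assert (0 < / (x ^ 2 * s * (1 + s ^ 2)) ^ 2) by (apply Rinv_0_lt_compat; nra).
      assert (0 <= x ^ 2 * (1 + 3 * s ^ 2)) by nra. nra.
    + unfold u. left. apply Rinv_0_lt_compat. apply Hpos. lra.
    + intros s Hs. apply B2.
Qed.

(** [sin (t^2 / 2)] exceeds the derivative of [(1 - cos (t^2 / 2)) / t], which
    vanishes at 0. *)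
Lemma fresnel_sin_nonneg (x : R) : 0 < x -> 0 <= fresnel_sin x.
Proof.
  intros Hx. apply Rnot_lt_le. intros Hneg.
  set (d := Rmin (Rmin x 1) (- fresnel_sin x / 2)).
  assert (Hd : 0 < d <= x /\ d <= 1 /\ d <= - fresnel_sin x / 2).
  { assert (T1 := Rmin_l (Rmin x 1) (- fresnel_sin x / 2)). assert (T2 := Rmin_r (Rmin x 1) (- fresnel_sin x / 2)).
    assert (T3 := Rmin_l x 1). assert (T4 := Rmin_r x 1). fold d in T1, T2.
    assert (0 < d) by (unfold d; repeat apply Rmin_glb_lt; lra). lra. }
  assert (E : fresnel_sin x = RInt (fun t => sin (t ^ 2 / 2)) 0 d + RInt (fun t => sin (t ^ 2 / 2)) d x).
  { symmetry. apply (RInt_Chasles (V := R_CompleteNormedModule)); apply ex_RInt_cont, continuous_sin_sq. }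
  assert (B : Rabs (RInt (fun t => sin (t ^ 2 / 2)) 0 d) <= (d - 0) * 1).
  { apply abs_RInt_le_const; [lra|apply ex_RInt_cont, continuous_sin_sq|].
    intros; apply Rabs_le, SIN_bound. }
  assert (C : (1 - cos (x ^ 2 / 2)) / x - (1 - cos (d ^ 2 / 2)) / d
              <= RInt (fun t => sin (t ^ 2 / 2)) d x).
  { rewrite <- (RInt_FTC (fun t => (1 - cos (t ^ 2 / 2)) / t)
      (fun t => sin (t ^ 2 / 2) - (1 - cos (t ^ 2 / 2)) / t ^ 2)); try lra.
    - apply RInt_le; try lra.
      + apply ex_RInt_cont_on; [lra|]. intros t Ht. cont_ad. nra.
      + apply ex_RInt_cont, continuous_sin_sq.
      + intros t Ht. assert (0 <= (1 - cos (t ^ 2 / 2)) / t ^ 2); [|lra].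
        apply Rmult_le_pos; [|left; apply Rinv_0_lt_compat; nra].
        assert (T := COS_bound (t ^ 2 / 2)). lra.
    - intros t Ht. auto_derive; [lra|]. change (t * (t * 1) * / 2) with (t ^ 2 / 2). field. lra.
    - intros t Ht. cont_ad. nra. }
  assert (C1 : 0 <= (1 - cos (x ^ 2 / 2)) / x).
  { apply Rmult_le_pos; [|left; apply Rinv_0_lt_compat; lra].
    assert (T := COS_bound (x ^ 2 / 2)). lra. }
  assert (C2 : (1 - cos (d ^ 2 / 2)) / d <= d / 8).
  { apply Rle_trans with (((d ^ 2 / 2) ^ 2 / 2) / d).
    - apply Rmult_le_compat_r; [left; apply Rinv_0_lt_compat; lra|].
      apply one_minus_cos_le.
    - replace ((d ^ 2 / 2) ^ 2 / 2 / d) with (d * (d * d) / 8) by (field; lra). nra. }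
  apply Rabs_le_between in B. lra.
Qed.

(** In the limit [fresnel_squares] gives [C^2 = S^2] and [C S = PI / 4], which
    determines [(C, S)] up to a common sign; [S >= 0] selects the sign. *)
Lemma fresnel_close :
  close_at_infty fresnel_cos (sqrt PI / 2) /\ close_at_infty fresnel_sin (sqrt PI / 2).
Proof.
  assert (PP := PI2_3_2). unfold PI2 in PP.
  assert (Main : forall x, 100 <= x ->
    Rabs (fresnel_cos x - sqrt PI / 2) <= 50 / x /\ Rabs (fresnel_sin x - sqrt PI / 2) <= 50 / x).
  { intros x Hx. destruct (fresnel_squares x ltac:(lra)) as [E1 E2].
    assert (D1 := square_int_decay sin (fun u => - cos u) x ltac:(lra)
      ltac:(intros; auto_derive; auto; ring) ltac:(intros; apply continuous_sin)
      ltac:(intros; apply Rabs_le, SIN_bound)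
      ltac:(intros; cbv beta; rewrite Rabs_Ropp; apply Rabs_le, COS_bound)).
    assert (D2 := square_int_decay (fun u => - cos u) (fun u => - sin u) x ltac:(lra)
      ltac:(intros; auto_derive; auto; ring) ltac:(intros; cont_ad; auto)
      ltac:(intros; cbv beta; rewrite Rabs_Ropp; apply Rabs_le, COS_bound)
      ltac:(intros; cbv beta; rewrite Rabs_Ropp; apply Rabs_le, SIN_bound)).
    assert (Y0 := fresnel_sin_nonneg x ltac:(lra)).
    assert (Hd : 0 < / x <= / 100).
    { split; [apply Rinv_0_lt_compat; lra|apply Rinv_le_contravar; lra]. }
    unfold Rdiv in D1, D2 |- *. set (d := / x) in *.
    apply Rabs_le_between in D1. apply Rabs_le_between in D2.
    assert (S := sqrt_sqrt PI ltac:(lra)).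
    assert (S1 : 1 <= sqrt PI).
    { rewrite <- sqrt_1 at 1. apply sqrt_le_1; lra. }
    set (c := sqrt PI) in *. set (A := fresnel_cos x) in *. set (B := fresnel_sin x) in *.
    set (g1 := square_int sin x) in *. set (g2 := square_int (fun u => - cos u) x) in *.
    assert (HA : 0 < A) by nra.
    assert (HB : 0 < B) by nra.
    assert (Hd1 : - (6 * d) <= A - B <= 6 * d).
    { assert ((A - B) * (A + B) = 2 * g1) by nra. split; nra. }
    assert (F1 : (A - c * / 2) * (A + c * / 2) = g2 + A * (A - B)) by nra.
    assert (F2 : (B - c * / 2) * (B + c * / 2) = g2 - B * (A - B)) by nra.
    assert (G1 : - (21 * d) <= g2 + A * (A - B) <= 21 * d) by (split; nra).
    assert (G2 : - (21 * d) <= g2 - B * (A - B) <= 21 * d) by (split; nra).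
    assert (Fin : forall X g, 0 < X -> (X - c * / 2) * (X + c * / 2) = g -> - (21 * d) <= g <= 21 * d ->
      Rabs (X - c * / 2) <= 50 * d).
    { clear - S1 Hd. intros X g HX E Hg. apply Rabs_le. split; nra. }
    split; [now apply (Fin A _ HA F1)|now apply (Fin B _ HB F2)]. }
  assert (Lim : forall e, 0 < e -> exists M, 0 < M /\ forall x, M <= x -> 100 <= x /\ 50 / x <= e).
  { intros e He. assert (0 < 50 / e) by (apply Rdiv_lt_0_compat; lra).
    exists (100 + 50 / e). split; [lra|]. intros x Hx. split; [lra|].
    apply Rmult_le_reg_r with x; [lra|]. unfold Rdiv. rewrite Rmult_assoc, Rinv_l by lra.
    replace (50 * 1) with (e * (50 / e)) by (field; lra). nra. }
  split; intros e He; destruct (Lim e He) as (M & M0 & HM); exists M; split; auto;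
    intros x Hx; destruct (HM x Hx); destruct (Main x ltac:(lra)); lra.
Qed.

(** * Laplace's method and stationary phase, with explicit uniformity *)

Lemma deriv_le_le (f df g dg : R -> R) (a b : R) : a <= b ->
  (forall x, a <= x <= b -> is_derive f x (df x)) ->
  (forall x, a <= x <= b -> is_derive g x (dg x)) ->
  (forall x, a <= x <= b -> df x <= dg x) ->
  f b - f a <= g b - g a.
Proof.
  intros Hab Hf Hg H.
  destruct (Req_dec a b) as [->|Hne]; [lra|].
  assert (D : forall x, a <= x <= b -> is_derive (fun x => g x - f x) x (dg x - df x)).
  { intros x Hx. apply (is_derive_minus g f); auto. }
  destruct (MVT_gen (fun x => g x - f x) a b (fun x => dg x - df x)) as (c & Hc & E).
  - intros x. rewrite Rmin_left, Rmax_right by lra. intros Hx. apply D. lra.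
  - intros x. rewrite Rmin_left, Rmax_right by lra. intros Hx.
    apply continuity_pt_filterlim.
    apply (ex_derive_continuous (fun x => g x - f x)). eexists. now apply D.
  - rewrite Rmin_left, Rmax_right in Hc by lra. specialize (H c Hc). nra.
Qed.

Lemma abs_exp_minus_one (x : R) : Rabs x <= 1 / 2 -> Rabs (exp x - 1) <= 2 * Rabs x.
Proof.
  intros H. assert (A := exp_ineq1_le x). assert (B := exp_ineq1_le (- x)).
  assert (E : exp x * exp (- x) = 1) by (rewrite <- exp_plus, Rplus_opp_r; apply exp_0).
  revert H. unfold Rabs. destruct (Rcase_abs x), (Rcase_abs (exp x - 1)); nra.
Qed.

Lemma abs_cos_diff (x y : R) : Rabs (cos x - cos y) <= Rabs (x - y).
Proof.
  destruct (MVT_gen cos y x (fun x => - sin x)) as (c & _ & E).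
  - intros z _. apply is_derive_cos.
  - intros z _. apply continuity_pt_filterlim, continuous_cos.
  - rewrite E, Rabs_mult.
    assert (Rabs (- sin c) <= 1) by (rewrite Rabs_Ropp; apply Rabs_le, SIN_bound).
    assert (P := Rabs_pos (x - y)). nra.
Qed.

Lemma RInt_scale (f : R -> R) (q a b : R) : 0 < q -> (forall x, continuous f x) ->
  RInt (fun s => f (q * s)) a b = RInt f (q * a) (q * b) / q.
Proof.
  intros Hq Hf.
  assert (E := RInt_comp_lin f q 0 a b (ex_RInt_cont _ _ _ Hf)).
  rewrite !Rplus_0_r in E. rewrite <- E.
  rewrite (RInt_scal (V := R_CompleteNormedModule)).
  - rewrite (RInt_ext (fun s => f (q * s + 0)) (fun s => f (q * s))).
    + change (scal q (RInt (fun s => f (q * s)) a b)) with (q * RInt (fun s => f (q * s)) a b).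
      generalize (RInt (fun s => f (q * s)) a b : R). intros J. eqR. field. lra.
    + intros s _. f_equal. ring.
  - apply ex_RInt_cont. intros s. apply (continuous_comp (fun s => q * s + 0) f); auto.
    cont_ad; auto.
Qed.

Lemma sqrt_props (H : R) : 0 < H -> 0 < sqrt H /\ sqrt H * sqrt H = H.
Proof. intros; split; [now apply sqrt_lt_R0 | apply sqrt_sqrt; lra]. Qed.

(** Only the range [s * sqrt H <= U] matters, and there the integrand is
    Gaussian up to [eta]; the rest is bounded with [exp (- x) <= 1 / x].  The
    error is relative to the main term, uniformly in [H]. *)
Lemma laplace_method (e c : R) : 0 < e -> 0 < c -> exists U eta, 0 < U /\ 0 < eta /\
  forall (H B : R) (f g : R -> R), 0 < H -> U <= B * sqrt H ->
  (forall s, 0 <= s <= B -> continuous f s) ->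
  (forall s, 0 <= s <= B -> continuous g s) ->
  (forall s, 0 <= s <= B -> s * sqrt H <= U ->
     Rabs (g s - H * s ^ 2 / 2) <= eta /\ Rabs (f s) <= eta) ->
  (forall s, 0 <= s <= B -> c * H * s ^ 2 <= g s) ->
  Rabs (RInt (fun s => exp (- g s) * cos (f s)) 0 B - sqrt (PI / 2) / sqrt H)
    <= e / sqrt H.
Proof.
  intros He Hc. destruct (gauss_close (e / 3) ltac:(lra)) as (M & HM & HG).
  assert (Hce : 0 < 3 / (c * e)) by (apply Rdiv_lt_0_compat; nra).
  set (U := M + 3 / (c * e)).
  assert (HU : 0 < U) by (unfold U; lra).
  set (eta := Rmin (1 / 2) (e / (9 * U))).
  assert (Heta : 0 < eta /\ eta <= 1 / 2 /\ eta * (9 * U) <= e).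
  { assert (0 < e / (9 * U)) by (apply Rdiv_lt_0_compat; lra).
    unfold eta. repeat split; [apply Rmin_glb_lt; lra|apply Rmin_l|].
    apply Rle_trans with (e / (9 * U) * (9 * U)).
    - apply Rmult_le_compat_r; [lra|apply Rmin_r].
    - right. field. lra. }
  exists U, eta. split; [exact HU|]. split; [lra|].
  intros H B f g HH HB Cf Cg Hnear Hfar.
  destruct (sqrt_props H HH) as [Hq Hqq]. set (q := sqrt H) in *.
  set (r := U / q).
  assert (Hr : 0 < r) by (apply Rdiv_lt_0_compat; lra).
  assert (Hrq : r * q = U) by (unfold r; field; lra).
  assert (HrB : r <= B) by nra.
  set (F := fun s => exp (- g s) * cos (f s)).
  assert (CF : forall s, 0 <= s <= B -> continuous F s).
  { intros s Hs. apply (continuous_mult (fun s => exp (- g s)) (fun s => cos (f s))).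
    - apply (continuous_comp (fun s => - g s) exp); [|apply continuous_exp].
      apply (continuous_opp g); auto.
    - apply (continuous_comp f cos); [auto|apply continuous_cos]. }
  assert (CG : forall s, continuous (fun s => exp (- (H * s ^ 2 / 2))) s)
    by (intros; cont_ad; auto).
  rewrite <- (RInt_Chasles (V := R_CompleteNormedModule) F 0 r B);
    [|apply ex_RInt_cont_on; [lra|]; intros; apply CF; lra
     |apply ex_RInt_cont_on; [lra|]; intros; apply CF; lra].
  plusR.
  assert (I1 : Rabs (RInt F 0 r - RInt (fun s => exp (- (H * s ^ 2 / 2))) 0 r) <= (r - 0) * (3 * eta)).
  { change (RInt F 0 r - RInt (fun s => exp (- (H * s ^ 2 / 2))) 0 r)
      with (minus (RInt F 0 r) (RInt (fun s => exp (- (H * s ^ 2 / 2))) 0 r)).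
    rewrite <- (RInt_minus (V := R_CompleteNormedModule)).
    2:{ apply ex_RInt_cont_on; [lra|]; intros; apply CF; lra. }
    2:{ now apply ex_RInt_cont. }
    apply abs_RInt_le_const; [lra| |].
    - apply (ex_RInt_minus (V := R_CompleteNormedModule)); [|now apply ex_RInt_cont].
      apply ex_RInt_cont_on; [lra|]; intros; apply CF; lra.
    - intros s Hs. assert (Hs' : s * q <= U) by nra.
      destruct (Hnear s ltac:(lra) Hs') as [N1 N2].
      unfold F, minus, plus, opp; simpl.
      set (d := g s - H * s ^ 2 / 2) in *.
      replace (- g s) with (- (H * s ^ 2 / 2) + - d) by (unfold d; ring).
      rewrite exp_plus.
      change (H * (s * (s * 1)) / 2) with (H * s ^ 2 / 2).
      set (G := exp (- (H * s ^ 2 / 2))).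
      assert (HG1 : 0 < G <= 1).
      { unfold G; split; [apply exp_pos|]. rewrite <- exp_0. apply exp_le. nra. }
      assert (X1 := abs_exp_minus_one (- d) ltac:(rewrite Rabs_Ropp; lra)).
      rewrite Rabs_Ropp in X1.
      assert (X2 := one_minus_cos_le (f s)).
      assert (X3 : f s ^ 2 <= eta * eta).
      { rewrite <- (pow2_abs (f s)). assert (P := Rabs_pos (f s)). nra. }
      assert (X4 := COS_bound (f s)). apply Rabs_le_between in X1.
      replace (G * exp (- d) * cos (f s) + - G)
        with (G * ((exp (- d) - 1) * cos (f s) - (1 - cos (f s)))) by ring.
      rewrite Rabs_mult, (Rabs_pos_eq G) by lra.
      assert (Rabs ((exp (- d) - 1) * cos (f s) - (1 - cos (f s))) <= 3 * eta).
      { apply Rabs_le. split; nra. }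
      assert (P := Rabs_pos ((exp (- d) - 1) * cos (f s) - (1 - cos (f s)))). nra. }
  assert (I2 : Rabs (RInt F r B) <= / (c * H * r)).
  { eapply Rle_trans; [apply (abs_RInt_le_int F (fun s => / (c * H * s ^ 2)))|];
      [lra| | | |].
    - apply ex_RInt_cont_on; [lra|]; intros; apply CF; lra.
    - apply ex_RInt_cont_on; [lra|]. intros s Hs. cont_ad.
      assert (0 < c * H) by nra. assert (0 < s * s) by nra. simpl; nra.
    - intros s Hs. unfold F. rewrite Rabs_mult, (Rabs_pos_eq (exp _)) by (left; apply exp_pos).
      assert (X : Rabs (cos (f s)) <= 1) by apply Rabs_le, COS_bound.
      assert (cH : 0 < c * H * s ^ 2).
      { apply Rmult_lt_0_compat; [nra|]. apply pow_lt. lra. }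
      assert (E : exp (- g s) <= / (c * H * s ^ 2)).
      { rewrite exp_Ropp. apply Rinv_le_contravar; auto.
        assert (T := exp_ineq1_le (g s)). specialize (Hfar s ltac:(lra)). lra. }
      assert (P := exp_pos (- g s)). assert (P2 := Rabs_pos (cos (f s))). nra.
    - apply inv_square_int_le; [lra|nra]. }
  assert (I3 : RInt (fun s => exp (- (H * s ^ 2 / 2))) 0 r
               = RInt (fun t => exp (- (t ^ 2 / 2))) 0 U / q).
  { rewrite (RInt_ext _ (fun s => exp (- ((q * s) ^ 2 / 2)))).
    - rewrite (RInt_scale (fun t => exp (- (t ^ 2 / 2)))); auto.
      + f_equal. f_equal; [ring|]. rewrite <- Hrq. ring.
      + intros; cont_ad; auto.
    - intros s _. f_equal. rewrite <- Hqq. field. }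
  rewrite I3 in I1. specialize (HG U ltac:(unfold U; lra)).
  set (J := RInt (fun t => exp (- (t ^ 2 / 2))) 0 U) in *.
  assert (I4 : / (c * H * r) <= (e / 3) / q).
  { replace (/ (c * H * r)) with (/ (c * U) * / q).
    2:{ rewrite <- Hrq, <- Hqq. field. repeat split; nra. }
    apply Rmult_le_compat_r; [left; now apply Rinv_0_lt_compat|].
    replace (e / 3) with (/ (c * (3 / (c * e)))) by (field; lra).
    apply Rinv_le_contravar; [nra|]. unfold U. nra. }
  assert (I5 : (r - 0) * (3 * eta) <= (e / 3) / q).
  { replace (r - 0) with (U * / q) by (unfold r; field; lra).
    assert (0 < / q) by now apply Rinv_0_lt_compat. unfold Rdiv. nra. }
  assert (I6 : Rabs (J / q - sqrt (PI / 2) / q) <= (e / 3) / q).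
  { replace (J / q - sqrt (PI / 2) / q) with ((J - sqrt (PI / 2)) * / q) by (field; lra).
    rewrite Rabs_mult, (Rabs_pos_eq (/ q)) by (left; now apply Rinv_0_lt_compat).
    apply Rmult_le_compat_r; [left; now apply Rinv_0_lt_compat|exact HG]. }
  replace (e / q) with ((e / 3) / q + (e / 3) / q + (e / 3) / q) by (field; lra).
  replace (RInt F 0 r + RInt F r B - sqrt (PI / 2) / q)
    with ((RInt F 0 r - J / q) + (J / q - sqrt (PI / 2) / q) + RInt F r B) by ring.
  eapply Rle_trans; [apply Rabs_triang|].
  apply Rplus_le_compat; [|lra].
  eapply Rle_trans; [apply Rabs_triang|]. lra.
Qed.

Lemma RInt_sym_quadratic (H th r : R) : 0 < H -> 0 <= r ->
  RInt (fun s => cos (th + H * s ^ 2 / 2)) (- r) r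
  = 2 * (cos th * fresnel_cos (r * sqrt H) - sin th * fresnel_sin (r * sqrt H)) / sqrt H.
Proof.
  intros HH Hr. destruct (sqrt_props H HH) as [Hq Hqq]. set (q := sqrt H) in *.
  assert (C : forall s, continuous (fun s => cos (th + H * s ^ 2 / 2)) s) by (intros; cont_ad; auto).
  rewrite <- (RInt_Chasles (V := R_CompleteNormedModule) _ (- r) 0 r) by now apply ex_RInt_cont.
  plusR.
  replace (RInt (fun s => cos (th + H * s ^ 2 / 2)) (- r) 0)
    with (RInt (fun s => cos (th + H * s ^ 2 / 2)) 0 r).
  2:{ rewrite <- (RInt_reflect (fun s => cos (th + H * s ^ 2 / 2))) by now apply ex_RInt_cont.
      rewrite Ropp_0. apply RInt_ext. intros s _. do 2 f_equal. eqR. field. }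
  rewrite (RInt_ext _ (fun s => (fun t => cos th * cos (t ^ 2 / 2) + - sin th * sin (t ^ 2 / 2)) (q * s))).
  2:{ intros s _. rewrite cos_plus. replace (H * s ^ 2 / 2) with ((q * s) ^ 2 / 2).
      - eqR. ring.
      - rewrite <- Hqq. field. }
  rewrite (RInt_scale (fun t => cos th * cos (t ^ 2 / 2) + - sin th * sin (t ^ 2 / 2))); auto.
  2:{ intros; cont_ad; auto. }
  rewrite Rmult_0_r, (Rmult_comm q r).
  rewrite (RInt_plus (V := R_CompleteNormedModule));
    [|apply ex_RInt_cont; intros; cont_ad; auto|apply ex_RInt_cont; intros; cont_ad; auto].
  plusR.
  rewrite (RInt_scal (V := R_CompleteNormedModule) (fun t => cos (t ^ 2 / 2)))
    by apply ex_RInt_cont, continuous_cos_sq.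
  rewrite (RInt_scal (V := R_CompleteNormedModule) (fun t => sin (t ^ 2 / 2)))
    by apply ex_RInt_cont, continuous_sin_sq.
  scalR.
  change (RInt (fun t => cos (t ^ 2 / 2)) 0 (r * q)) with (fresnel_cos (r * q)).
  change (RInt (fun t => sin (t ^ 2 / 2)) 0 (r * q)) with (fresnel_sin (r * q)).
  eqR. field. lra.
Qed.

(** Within [U / sqrt H] of [p] the integrand is compared with the Fresnel
    integrand; beyond, on both sides, the van der Corput test applies, since for a
    convex phase the derivative only grows in absolute value away from [p]. *)
Lemma stationary_phase_local (e : R) : 0 < e -> exists U eta, 0 < U /\ 0 < eta /\
  forall (H A B p : R) (f f1 f2 : R -> R), 0 < H ->
  U <= (p - A) * sqrt H -> U <= (B - p) * sqrt H ->
  (forall x, A <= x <= B -> is_derive f x (f1 x)) ->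
  (forall x, A <= x <= B -> is_derive f1 x (f2 x)) ->
  (forall x, A <= x <= B -> continuous f2 x) ->
  (forall x, A <= x <= B -> 0 <= f2 x) ->
  (forall s, A <= s <= B -> Rabs (s - p) * sqrt H <= U ->
     Rabs (f s - f p - H * (s - p) ^ 2 / 2) <= eta) ->
  U * sqrt H / 2 <= f1 (p + U / sqrt H) ->
  f1 (p - U / sqrt H) <= - (U * sqrt H / 2) ->
  Rabs (RInt (fun s => cos (f s)) A B - sqrt (2 * PI) / sqrt H * cos (f p + PI / 4))
    <= e / sqrt H.
Proof.
  intros He. destruct fresnel_close as [FC FS].
  destruct (FC (e / 12) ltac:(lra)) as (M1 & HM1 & HC).
  destruct (FS (e / 12) ltac:(lra)) as (M2 & HM2 & HS).
  assert (Hce : 0 < 24 / e) by (apply Rdiv_lt_0_compat; lra).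
  set (U := M1 + M2 + 24 / e).
  assert (HU : 0 < U) by (unfold U; lra).
  set (eta := e / (6 * U)).
  assert (Heta : 0 < eta /\ eta * (6 * U) = e).
  { unfold eta. split; [apply Rdiv_lt_0_compat; lra|field; lra]. }
  exists U, eta. split; [exact HU|]. split; [lra|].
  intros H A B p f f1 f2 HH HA HB D1 D2 C2 P2 Hnear R1 L1.
  destruct (sqrt_props H HH) as [Hq Hqq]. set (q := sqrt H) in *.
  set (r := U / q) in *.
  assert (Hr : 0 < r) by (apply Rdiv_lt_0_compat; lra).
  assert (Hrq : r * q = U) by (unfold r; field; lra).
  assert (HrB : r <= B - p) by nra.
  assert (HrA : r <= p - A) by nra.
  assert (Hqi : 0 < / q) by now apply Rinv_0_lt_compat.
  set (F := fun s => cos (f s)).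
  assert (CF : forall s, A <= s <= B -> continuous F s).
  { intros s Hs. apply (continuous_comp f cos); [|apply continuous_cos].
    apply (ex_derive_continuous f). eexists; now apply D1. }
  assert (EF : forall a b, A <= a -> a <= b -> b <= B -> ex_RInt F a b).
  { intros a b ? ? ?. apply ex_RInt_cont_on; [lra|]. intros; apply CF; lra. }
  rewrite <- (RInt_Chasles (V := R_CompleteNormedModule) F A (p - r) B) by (apply EF; lra).
  rewrite <- (RInt_Chasles (V := R_CompleteNormedModule) F (p - r) (p + r) B) by (apply EF; lra).
  plusR. plusR.
  assert (Q : 2 / (U * q / 2) <= (e / 6) * / q).
  { replace (2 / (U * q / 2)) with (4 / U * / q) by (field; lra).
    apply Rmult_le_compat_r; [lra|].
    apply Rmult_le_reg_r with U; [lra|]. unfold Rdiv at 1. rewrite Rmult_assoc, Rinv_l by lra.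
    assert (e * (24 / e) = 24) by (field; lra). unfold U. nra. }
  assert (T1 : Rabs (RInt F (p + r) B) <= 2 / (U * q / 2)).
  { apply (van_der_corput f f1 f2); try lra; try (intros; (apply D1 || apply D2 || apply C2 || apply P2); lra).
    split; [nra|exact R1]. }
  assert (T2 : Rabs (RInt F A (p - r)) <= 2 / (U * q / 2)).
  { apply (van_der_corput_left f f1 f2); try lra; try (intros; (apply D1 || apply D2 || apply C2 || apply P2); lra).
    nra. }
  set (G := fun s => cos (f p + H * (s - p) ^ 2 / 2)).
  assert (CG : forall s, continuous G s) by (intros; unfold G; cont_ad; auto).
  assert (T3 : Rabs (RInt F (p - r) (p + r) - RInt G (p - r) (p + r)) <= (p + r - (p - r)) * eta).
  { change (RInt F (p - r) (p + r) - RInt G (p - r) (p + r))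
      with (minus (RInt F (p - r) (p + r)) (RInt G (p - r) (p + r))).
    rewrite <- (RInt_minus (V := R_CompleteNormedModule)); [|apply EF; lra|now apply ex_RInt_cont].
    apply abs_RInt_le_const; [lra| |].
    - apply (ex_RInt_minus (V := R_CompleteNormedModule)); [apply EF; lra|now apply ex_RInt_cont].
    - intros s Hs. eapply Rle_trans; [apply abs_cos_diff|].
      replace (f s - (f p + H * (s - p) ^ 2 / 2)) with (f s - f p - H * (s - p) ^ 2 / 2) by ring.
      apply Hnear; [lra|]. assert (Rabs (s - p) <= r) by (apply Rabs_le; lra). nra. }
  assert (T4 : RInt G (p - r) (p + r)
     = 2 * (cos (f p) * fresnel_cos U - sin (f p) * fresnel_sin U) / q).
  { rewrite <- Hrq. unfold q. rewrite <- RInt_sym_quadratic by lra.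
    assert (E := RInt_comp_lin G 1 p (- r) r (ex_RInt_cont _ _ _ CG)).
    replace (1 * - r + p) with (p - r) in E by ring.
    replace (1 * r + p) with (p + r) in E by ring.
    rewrite <- E. apply RInt_ext. intros s _.
    unfold scal; simpl; unfold mult; simpl. unfold G. rewrite Rmult_1_l.
    f_equal. f_equal. eqR. field. }
  rewrite T4 in T3.
  specialize (HC U ltac:(unfold U; lra)). specialize (HS U ltac:(unfold U; lra)).
  assert (T5 : sqrt (2 * PI) / q * cos (f p + PI / 4)
     = 2 * (cos (f p) * (sqrt PI / 2) - sin (f p) * (sqrt PI / 2)) / q).
  { rewrite cos_plus, cos_PI4, sin_PI4. rewrite sqrt_mult by (assert (T := PI_RGT_0); lra).
    assert (0 < sqrt 2) by (apply sqrt_lt_R0; lra). field. lra. }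
  assert (T6 : Rabs (2 * (cos (f p) * fresnel_cos U - sin (f p) * fresnel_sin U) / q
      - sqrt (2 * PI) / q * cos (f p + PI / 4)) <= (e / 3) * / q).
  { rewrite T5.
    replace (_ - _) with
      (2 * (cos (f p) * (fresnel_cos U - sqrt PI / 2) - sin (f p) * (fresnel_sin U - sqrt PI / 2)) * / q)
      by (field; lra).
    rewrite Rabs_mult, (Rabs_pos_eq (/ q)) by lra.
    apply Rmult_le_compat_r; [lra|].
    assert (Cb := COS_bound (f p)). assert (Sb := SIN_bound (f p)).
    apply Rabs_le_between in HC. apply Rabs_le_between in HS. apply Rabs_le. split; nra. }
  assert (T7 : (p + r - (p - r)) * eta = (e / 3) * / q).
  { replace (p + r - (p - r)) with (2 * (U * / q)) by (unfold r; field; lra).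
    replace e with (eta * (6 * U)) by lra. field. lra. }
  rewrite T7 in T3.
  set (J := 2 * (cos (f p) * fresnel_cos U - sin (f p) * fresnel_sin U) / q) in *.
  set (Z := sqrt (2 * PI) / q * cos (f p + PI / 4)) in *.
  replace (RInt F A (p - r) + (RInt F (p - r) (p + r) + RInt F (p + r) B) - Z)
    with (RInt F A (p - r) + RInt F (p + r) B + ((RInt F (p - r) (p + r) - J) + (J - Z))) by ring.
  replace (e / q) with ((e / 6 + e / 6) * / q + ((e / 3) * / q + (e / 3) * / q)) by (field; lra).
  eapply Rle_trans; [apply Rabs_triang|]. apply Rplus_le_compat.
  - eapply Rle_trans; [apply Rabs_triang|]. lra.
  - eapply Rle_trans; [apply Rabs_triang|]. lra.
Qed.

Lemma taylor_right (f f1 f2 : R -> R) (H L b t : R) : 0 <= t <= b ->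
  (forall x, 0 <= x <= b -> is_derive f x (f1 x)) ->
  (forall x, 0 <= x <= b -> is_derive f1 x (f2 x)) ->
  f1 0 = 0 -> (forall x, 0 <= x <= b -> Rabs (f2 x - H) <= L * x) ->
  Rabs (f1 t - H * t) <= L * t ^ 2 / 2 /\
  Rabs (f t - f 0 - H * t ^ 2 / 2) <= L * t ^ 3 / 6.
Proof.
  intros Ht D1 D2 Z B.
  assert (S1 : forall t, 0 <= t <= b -> Rabs (f1 t - H * t) <= L * t ^ 2 / 2).
  { intros u Hu. apply Rabs_le. split.
    - assert (T := deriv_le_le (fun t => H * t - L * t ^ 2 / 2) (fun t => H - L * t) f1 f2 0 u).
      cbv beta in T. rewrite Z in T.
      enough (H * u - L * u ^ 2 / 2 - (H * 0 - L * 0 ^ 2 / 2) <= f1 u - 0) by lra.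
      apply T; [lra| |intros; apply D2; lra|].
      + intros x _. auto_derive; auto. field.
      + intros x Hx. specialize (B x ltac:(lra)). apply Rabs_le_between in B. lra.
    - assert (T := deriv_le_le f1 f2 (fun t => H * t + L * t ^ 2 / 2) (fun t => H + L * t) 0 u).
      cbv beta in T. rewrite Z in T.
      enough (f1 u - 0 <= H * u + L * u ^ 2 / 2 - (H * 0 + L * 0 ^ 2 / 2)) by lra.
      apply T; [lra|intros; apply D2; lra| |].
      + intros x _. auto_derive; auto. field.
      + intros x Hx. specialize (B x ltac:(lra)). apply Rabs_le_between in B. lra. }
  split; [now apply S1|]. apply Rabs_le. split.
  - assert (T := deriv_le_le (fun t => H * t ^ 2 / 2 - L * t ^ 3 / 6) (fun t => H * t - L * t ^ 2 / 2) f f1 0 t).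
    cbv beta in T.
    enough (H * t ^ 2 / 2 - L * t ^ 3 / 6 - (H * 0 ^ 2 / 2 - L * 0 ^ 3 / 6) <= f t - f 0) by lra.
    apply T; [lra| |intros; apply D1; lra|].
    + intros x _. auto_derive; auto. field.
    + intros x Hx. specialize (S1 x ltac:(lra)). apply Rabs_le_between in S1. lra.
  - assert (T := deriv_le_le f f1 (fun t => H * t ^ 2 / 2 + L * t ^ 3 / 6) (fun t => H * t + L * t ^ 2 / 2) 0 t).
    cbv beta in T.
    enough (f t - f 0 <= H * t ^ 2 / 2 + L * t ^ 3 / 6 - (H * 0 ^ 2 / 2 + L * 0 ^ 3 / 6)) by lra.
    apply T; [lra|intros; apply D1; lra| |].
    + intros x _. auto_derive; auto. field.
    + intros x Hx. specialize (S1 x ltac:(lra)). apply Rabs_le_between in S1. lra.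
Qed.

(** [L ^ 2 / H ^ 3] and [1 / (H d ^ 2)], with [d] the distance of [p] to the end
    points, are the scale-invariant quantities that have to be small. *)
Lemma stationary_phase (e : R) : 0 < e -> exists K, 0 < K /\
  forall (H L A B p : R) (f f1 f2 : R -> R), 0 < H -> A <= p <= B ->
  (forall x, A <= x <= B -> is_derive f x (f1 x)) ->
  (forall x, A <= x <= B -> is_derive f1 x (f2 x)) ->
  (forall x, A <= x <= B -> continuous f2 x) ->
  (forall x, A <= x <= B -> 0 <= f2 x) ->
  f1 p = 0 -> 0 <= L ->
  (forall x, A <= x <= B -> Rabs (f2 x - H) <= L * Rabs (x - p)) ->
  K * L ^ 2 <= H ^ 3 -> K <= H * (p - A) ^ 2 -> K <= H * (B - p) ^ 2 ->
  Rabs (RInt (fun s => cos (f s)) A B - sqrt (2 * PI) / sqrt H * cos (f p + PI / 4))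
    <= e / sqrt H.
Proof.
  intros He. destruct (stationary_phase_local e He) as (U & eta & HU & Heta & Main).
  exists (1 + U ^ 2 + U ^ 6 / eta ^ 2).
  assert (U2 : 0 < U ^ 2) by (apply pow_lt; lra).
  assert (U6 : 0 < U ^ 6 / eta ^ 2) by (apply Rdiv_lt_0_compat; apply pow_lt; lra).
  set (K := 1 + U ^ 2 + U ^ 6 / eta ^ 2).
  split; [unfold K; lra|].
  intros H L A B p f f1 f2 HH Hp D1 D2 C2 P2 Z HL Lip K1 K2 K3.
  destruct (sqrt_props H HH) as [Hq Hqq].
  assert (Hq3 : forall y, 0 <= y -> y ^ 2 * L ^ 2 <= H ^ 3 -> y * L <= sqrt H ^ 3).
  { intros y Hy E. assert (E2 : (y * L) ^ 2 <= (sqrt H ^ 3) ^ 2).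
    { replace ((sqrt H ^ 3) ^ 2) with ((sqrt H * sqrt H) ^ 3) by ring. rewrite Hqq. nra. }
    apply (le_of_pow_le 1); [|exact E2]. apply pow_le; lra. }
  assert (HdA : U <= (p - A) * sqrt H).
  { apply (le_of_pow_le 1); [nra|].
    replace (((p - A) * sqrt H) ^ 2) with ((sqrt H * sqrt H) * (p - A) ^ 2) by ring.
    rewrite Hqq. unfold K in K2. lra. }
  assert (HdB : U <= (B - p) * sqrt H).
  { apply (le_of_pow_le 1); [nra|].
    replace (((B - p) * sqrt H) ^ 2) with ((sqrt H * sqrt H) * (B - p) ^ 2) by ring.
    rewrite Hqq. unfold K in K3. lra. }
  assert (HLU : U * L <= sqrt H ^ 3).
  { apply Hq3; [lra|]. unfold K in K1. nra. }
  assert (HLU3 : U ^ 3 * L <= eta * sqrt H ^ 3).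
  { assert (U ^ 3 / eta * L <= sqrt H ^ 3).
    { apply Hq3.
      - left. apply Rdiv_lt_0_compat; [apply pow_lt|]; lra.
      - replace ((U ^ 3 / eta) ^ 2) with (U ^ 6 / eta ^ 2) by (field; lra).
        unfold K in K1. nra. }
    replace (U ^ 3 * L) with (eta * (U ^ 3 / eta * L)) by (field; lra). nra. }
  set (q := sqrt H) in *.
  assert (TR : forall t, 0 <= t <= B - p ->
    Rabs (f1 (p + t) - H * t) <= L * t ^ 2 / 2 /\
    Rabs (f (p + t) - f p - H * t ^ 2 / 2) <= L * t ^ 3 / 6).
  { intros t Ht.
    assert (T := taylor_right (fun t => f (p + t)) (fun t => f1 (p + t)) (fun t => f2 (p + t)) H L (B - p) t Ht).
    cbv beta in T. rewrite Rplus_0_r in T. apply T; auto.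
    - intros x Hx. evar_last; [apply (is_derive_comp f (fun t => p + t)); [apply D1; lra|auto_derive; auto]|].
      unfold scal; simpl; unfold mult; simpl; ring.
    - intros x Hx. evar_last; [apply (is_derive_comp f1 (fun t => p + t)); [apply D2; lra|auto_derive; auto]|].
      unfold scal; simpl; unfold mult; simpl; ring.
    - intros x Hx. specialize (Lip (p + x) ltac:(lra)).
      replace (p + x - p) with x in Lip by ring. rewrite (Rabs_pos_eq x) in Lip by lra. exact Lip. }
  assert (TL : forall t, 0 <= t <= p - A ->
    Rabs (- f1 (p - t) - H * t) <= L * t ^ 2 / 2 /\
    Rabs (f (p - t) - f p - H * t ^ 2 / 2) <= L * t ^ 3 / 6).
  { intros t Ht.
    assert (T := taylor_right (fun t => f (p - t)) (fun t => - f1 (p - t)) (fun t => f2 (p - t)) H L (p - A) t Ht).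
    cbv beta in T. rewrite Rminus_0_r in T. apply T; auto.
    - intros x Hx. evar_last; [apply (is_derive_comp f (fun t => p - t)); [apply D1; lra|auto_derive; auto]|].
      unfold scal; simpl; unfold mult; simpl; ring.
    - intros x Hx. evar_last; [apply (is_derive_opp (fun t => f1 (p - t)));
        apply (is_derive_comp f1 (fun t => p - t)); [apply D2; lra|auto_derive; auto]|].
      unfold scal, opp; simpl; unfold mult; simpl; ring.
    - rewrite Z. ring.
    - intros x Hx. specialize (Lip (p - x) ltac:(lra)).
      replace (p - x - p) with (- x) in Lip by ring. rewrite Rabs_Ropp, (Rabs_pos_eq x) in Lip by lra. exact Lip. }
  assert (Hrq : U / q * q = U) by (field; lra). set (r := U / q) in *.
  assert (Hlin : L * r ^ 2 / 2 <= H * r - U * q / 2).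
  { rewrite <- Hqq, <- Hrq. rewrite <- Hrq in HLU.
    assert (r * L <= q ^ 2) by nra. nra. }
  apply (Main H A B p f f1 f2); auto.
  - intros s Hs Hsq.
    assert (X : L * Rabs (s - p) ^ 3 / 6 <= eta).
    { assert (P := Rabs_pos (s - p)). set (t := Rabs (s - p)) in *.
      assert (L * (t * q) ^ 3 <= eta * q ^ 3).
      { apply Rle_trans with (L * U ^ 3); [|lra]. apply Rmult_le_compat_l; [lra|].
        apply pow_incr. split; [nra|exact Hsq]. }
      assert (0 < q ^ 3) by (apply pow_lt; lra).
      replace ((t * q) ^ 3) with (t ^ 3 * q ^ 3) in H0 by ring.
      assert (L * t ^ 3 <= eta) by nra.
      assert (0 <= L * t ^ 3) by (apply Rmult_le_pos; [lra|now apply pow_le]). lra. }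
    destruct (Rle_dec p s).
    + destruct (TR (s - p) ltac:(lra)) as [_ T]. replace (p + (s - p)) with s in T by ring.
      rewrite (Rabs_pos_eq (s - p)) in X by lra. lra.
    + destruct (TL (p - s) ltac:(lra)) as [_ T]. replace (p - (p - s)) with s in T by ring.
      rewrite (Rabs_left1 (s - p)) in X by lra.
      replace (- (s - p)) with (p - s) in X by ring.
      replace ((s - p) ^ 2) with ((p - s) ^ 2) by ring. lra.
  - fold q. fold r. destruct (TR r) as [T _]; [nra|]. apply Rabs_le_between in T. lra.
  - fold q. fold r. destruct (TL r) as [T _]; [nra|]. apply Rabs_le_between in T. lra.
Qed.

(** * The Airy function *)

Definition airy_phase (x t : R) : R := t ^ 3 / 3 + x * t.

Definition airy_partial (x T : R) : R := RInt (fun t => cos (airy_phase x t)) 0 T.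

Lemma is_derive_airy_phase (x t : R) : is_derive (airy_phase x) t (t ^ 2 + x).
Proof. unfold airy_phase. auto_derive; auto. field. Qed.

Lemma is_derive_airy_phase1 (x t : R) : is_derive (fun t => t ^ 2 + x) t (2 * t).
Proof. auto_derive; auto. ring. Qed.

Lemma continuous_airy (x t : R) : continuous (fun t => cos (airy_phase x t)) t.
Proof. unfold airy_phase. cont_ad. auto. Qed.

Lemma airy_partial_tail (x m T T' : R) : 0 <= T <= T' -> 0 < m <= T ^ 2 + x ->
  Rabs (airy_partial x T' - airy_partial x T) <= 2 / m.
Proof.
  intros HT Hm. unfold airy_partial.
  rewrite <- (RInt_Chasles (V := R_CompleteNormedModule) (fun t => cos (airy_phase x t)) 0 T T')
    by apply ex_RInt_cont, continuous_airy.
  plusR.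
  match goal with |- Rabs (?u + ?v - ?u) <= _ => replace (u + v - u) with v end.
  2:{ eqR. rewrite Rplus_comm. unfold Rminus. rewrite Rplus_assoc, Rplus_opp_r. now rewrite Rplus_0_r. }
  apply (van_der_corput (airy_phase x) (fun t => t ^ 2 + x) (fun t => 2 * t)); try lra.
  - intros; apply is_derive_airy_phase.
  - intros; apply is_derive_airy_phase1.
  - intros; cont_ad; auto.
  - intros; lra.
Qed.

Lemma airy_partial_lim (x : R) : exists l, filterlim (airy_partial x) (Rbar_locally p_infty) (locally l).
Proof.
  apply (filterlim_locally_cauchy (U := R_CompleteSpace)).
  intros [e He]. set (m := 2 / (e / 2)).
  assert (Hm : 0 < m) by (apply Rdiv_lt_0_compat; lra).
  set (T := 1 + m + Rabs x).
  assert (HT : 0 < T) by (unfold T; assert (P := Rabs_pos x); lra).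
  assert (HT2 : 0 < m <= T ^ 2 + x).
  { split; auto. assert (P := Rabs_pos x). assert (Q := Rle_abs (- x)).
    rewrite Rabs_Ropp in Q. unfold T. nra. }
  assert (B : forall u, T < u -> Rabs (airy_partial x u - airy_partial x T) <= e / 2).
  { intros u Hu. replace (e / 2) with (2 / m) by (unfold m; field; lra).
    apply airy_partial_tail; lra. }
  exists (fun u => T + 1 < u). split; [now exists (T + 1)|].
  assert (B2 : forall u, T + 1 < u -> Rabs (airy_partial x u - airy_partial x (T + 1)) < e / 2).
  { intros u Hu. apply Rle_lt_trans with (2 / (m + 1)).
    - apply airy_partial_tail; [lra|]. nra.
    - replace (e / 2) with (2 / m) by (unfold m; field; lra).
      apply Rmult_lt_compat_l; [lra|]. apply Rinv_lt_contravar; nra. }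
  intros u v Hu Hv.
  change (Rabs (airy_partial x v - airy_partial x u) < e).
  replace (airy_partial x v - airy_partial x u)
    with ((airy_partial x v - airy_partial x (T + 1)) - (airy_partial x u - airy_partial x (T + 1))) by ring.
  eapply Rle_lt_trans; [apply Rabs_triang|]. rewrite Rabs_Ropp.
  specialize (B2 u Hu) as Bu. specialize (B2 v Hv). lra.
Qed.

Lemma Ai_lim (x : R) : filterlim (airy_partial x) (Rbar_locally p_infty) (locally (PI * Ai x)).
Proof.
  destruct (airy_partial_lim x) as [l Hl].
  assert (E : Ai x = / PI * l).
  { unfold Ai. f_equal. apply is_RInt_gen_unique. intros P HP.
    destruct (Hl P HP) as [M HM].
    exists (fun a => a = 0) (fun b => M < b).
    - reflexivity.
    - now exists M.
    - intros a b -> Hb. exists (airy_partial x b). split; [|now apply HM].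
      apply (RInt_correct (V := R_CompleteNormedModule)), ex_RInt_cont. apply continuous_airy. }
  rewrite E. replace (PI * (/ PI * l)) with (l : R) by (rewrite <- Rmult_assoc, Rinv_r, Rmult_1_l by apply PI_neq0; reflexivity). exact Hl.
Qed.

Lemma Ai_lim_eps (x e : R) : 0 < e -> exists M, forall T, M <= T ->
  Rabs (airy_partial x T - PI * Ai x) <= e.
Proof.
  intros He. destruct (Ai_lim x (fun y => Rabs (y - PI * Ai x) < e)) as [M HM].
  - now exists (mkposreal e He).
  - exists (M + 1). intros T HT. left. apply HM. lra.
Qed.

Lemma Ai_tail (x m T : R) : 0 <= T -> 0 < m <= T ^ 2 + x ->
  Rabs (PI * Ai x - airy_partial x T) <= 2 / m.
Proof.
  intros HT Hm. apply le_epsilon. intros e He.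
  destruct (Ai_lim_eps x e He) as [M HM].
  set (T' := Rmax M T). assert (A := Rmax_l M T). assert (B := Rmax_r M T). fold T' in A, B.
  specialize (HM T' A).
  assert (C := airy_partial_tail x m T T' ltac:(lra) Hm).
  replace (PI * Ai x - airy_partial x T)
    with ((airy_partial x T' - airy_partial x T) - (airy_partial x T' - PI * Ai x)) by ring.
  eapply Rle_trans; [apply Rabs_triang|]. rewrite Rabs_Ropp. lra.
Qed.

(** The phase [t^3 / 3 - y^2 t] has its stationary point at [t = y], with second
    derivative [2 y].  The integral is cut at a [T] that depends on [e], beyond
    which van der Corput's test bounds the rest. *)
Lemma Ai_neg_asymptotic (e : R) : 0 < e -> exists Y, 1 <= Y /\ forall y, Y <= y ->
  Rabs (Ai (- y ^ 2) - / (sqrt PI * sqrt y) * cos (2 / 3 * y ^ 3 - PI / 4)) <= e / sqrt y.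
Proof.
  intros He. destruct (stationary_phase e He) as (K & HK & Main).
  assert (PP := PI2_3_2). unfold PI2 in PP.
  exists (1 + K). split; [lra|]. intros y Hy.
  destruct (sqrt_props y ltac:(lra)) as [Hq Hqq]. set (q := sqrt y) in *.
  set (T := 2 * y + 2 * q / e).
  assert (Hqe : 0 < 2 * q / e) by (apply Rdiv_lt_0_compat; lra).
  assert (HT : 2 * y <= T) by (unfold T; lra).
  assert (A := Ai_tail (- y ^ 2) T T ltac:(lra) ltac:(split; nra)).
  assert (A2 : 2 / T <= e / q).
  { apply Rmult_le_reg_r with T; [lra|]. unfold Rdiv at 1. rewrite Rmult_assoc, Rinv_l by lra.
    apply Rle_trans with (e / q * (2 * q / e)).
    - right. field. lra.
    - apply Rmult_le_compat_l; [|unfold T; lra]. apply Rlt_le, Rdiv_lt_0_compat; lra. }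
  assert (y3 : y <= y ^ 3) by (simpl; nra).
  specialize (Main (2 * y) 2 0 T y (airy_phase (- y ^ 2)) (fun t => t ^ 2 + - y ^ 2) (fun t => 2 * t)).
  assert (B : Rabs (RInt (fun s => cos (airy_phase (- y ^ 2) s)) 0 T
     - sqrt (2 * PI) / sqrt (2 * y) * cos (airy_phase (- y ^ 2) y + PI / 4)) <= e / sqrt (2 * y)).
  { apply Main; try lra.
    - intros; apply is_derive_airy_phase.
    - intros; apply is_derive_airy_phase1.
    - intros; cont_ad; auto.
    - intros; lra.
    - intros x Hx. replace (2 * x - 2 * y) with (2 * (x - y)) by ring.
      rewrite Rabs_mult, (Rabs_pos_eq 2) by lra. lra.
    - assert (Q : y * y <= (T - y) * (T - y)) by nra.
      assert (Q2 : 2 * y * (y * y) <= 2 * y * ((T - y) * (T - y)))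
        by (apply Rmult_le_compat_l; lra).
      simpl in y3 |- *. lra. }
  replace (airy_phase (- y ^ 2) y + PI / 4) with (- (2 / 3 * y ^ 3 - PI / 4)) in B
    by (unfold airy_phase; field).
  rewrite cos_neg in B. fold (airy_partial (- y ^ 2) T) in B.
  rewrite !sqrt_mult in B by lra. fold q in B.
  assert (S2 : 1 <= sqrt 2) by (rewrite <- sqrt_1 at 1; apply sqrt_le_1; lra).
  assert (SP : 0 < sqrt PI) by (apply sqrt_lt_R0; lra).
  assert (SPP := sqrt_sqrt PI ltac:(lra)).
  set (cc := cos (2 / 3 * y ^ 3 - PI / 4)) in *.
  replace (sqrt 2 * sqrt PI / (sqrt 2 * q) * cc) with (PI * (/ (sqrt PI * q) * cc)) in B.
  2:{ set (sp := sqrt PI) in *. rewrite <- SPP. field. repeat split; lra. }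
  assert (B2 : e / (sqrt 2 * q) <= e / q).
  { apply Rmult_le_compat_l; [lra|]. apply Rinv_le_contravar; nra. }
  apply Rmult_le_reg_l with PI; [lra|].
  rewrite <- (Rabs_pos_eq PI) at 1 by lra. rewrite <- Rabs_mult.
  replace (PI * (Ai (- y ^ 2) - / (sqrt PI * q) * cc))
    with ((PI * Ai (- y ^ 2) - airy_partial (- y ^ 2) T)
          + (airy_partial (- y ^ 2) T - PI * (/ (sqrt PI * q) * cc))) by ring.
  eapply Rle_trans; [apply Rabs_triang|].
  assert (0 < e / q) by (apply Rdiv_lt_0_compat; lra). nra.
Qed.

(** Cauchy's theorem in real terms: when [u_rho = v_s] (for an analytic
    function of [rho + i s], [u] and [v] are its real and imaginary part), the
    integral of [u] over a vertical segment changes with [rho] by boundary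
    terms only. *)
Lemma is_derive_contour (u v w : R -> R -> R) (rho T : R) : 0 <= T ->
  locally rho (fun rho => forall s, is_derive (fun rho => u rho s) rho (w rho s)) ->
  locally rho (fun rho => forall s, 0 <= s <= T -> continuous (u rho) s) ->
  (forall s, continuity_2d_pt w rho s) ->
  (forall s, is_derive (v rho) s (w rho s)) ->
  is_derive (fun rho => RInt (u rho) 0 T) rho (v rho T - v rho 0).
Proof.
  intros HT Hu Cu Cw Hv.
  rewrite <- (RInt_FTC (v rho) (w rho) 0 T HT).
  - apply is_derive_RInt_param'; auto.
  - intros; apply Hv.
  - intros s _. specialize (Cw s).
    apply continuity_pt_filterlim. intros eps Heps.
    destruct (Cw (mkposreal eps Heps)) as [d Hd]. exists d. split; [apply cond_pos|].
    intros x [_ Hx]. apply Hd; [|exact Hx]. rewrite Rminus_diag. rewrite Rabs_R0. apply cond_pos.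
Qed.

Section AiryShift.

Variable x : R.

(* Real and imaginary part of i (z ^ 3 / 3 + x z) at z = s + i eta. *)
Let Re_ (eta s : R) := - (s ^ 2 * eta) + eta ^ 3 / 3 - x * eta.
Let Im_ (eta s : R) := s ^ 3 / 3 - s * eta ^ 2 + x * s.
Let u (eta s : R) := exp (Re_ eta s) * cos (Im_ eta s).
Let v (eta s : R) := - (exp (Re_ eta s) * sin (Im_ eta s)).
Let w (eta s : R) := exp (Re_ eta s) *
  ((- s ^ 2 + eta ^ 2 - x) * cos (Im_ eta s) + 2 * s * eta * sin (Im_ eta s)).

(** At [s = 0] the integrand is real, so only the end [T] contributes. *)
Lemma airy_contour (eta T : R) : 0 <= T ->
  is_derive (fun eta => RInt (u eta) 0 T) eta (v eta T).
Proof.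
  intros HT. replace (v eta T) with (v eta T - v eta 0).
  2:{ unfold v, Im_. replace (0 ^ 3 / 3 - 0 * eta ^ 2 + x * 0) with 0 by field.
      rewrite sin_0. ring. }
  apply (is_derive_contour u v w); auto.
  - apply filter_forall. intros y s. unfold u, w, Re_, Im_. auto_derive; auto.
    absorb exp. absorb cos. absorb sin. field.
  - apply filter_forall. intros y s _. unfold u, Re_, Im_. cont_ad. auto.
  - intros s. unfold w. apply continuity_2d_pt_mult.
    + apply (continuity_1d_2d_pt_comp exp).
      * apply continuity_pt_filterlim, continuous_exp.
      * unfold Re_. simpl. unfold Rdiv. c2d.
    + apply continuity_2d_pt_plus; apply continuity_2d_pt_mult.
      * simpl. c2d.
      * apply (continuity_1d_2d_pt_comp cos).
        -- apply continuity_pt_filterlim, continuous_cos.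
        -- unfold Im_. simpl. unfold Rdiv. c2d.
      * simpl. c2d.
      * apply (continuity_1d_2d_pt_comp sin).
        -- apply continuity_pt_filterlim, continuous_sin.
        -- unfold Im_. simpl. unfold Rdiv. c2d.
  - intros s. unfold v, w, Re_, Im_. auto_derive; auto.
    absorb exp. absorb cos. absorb sin. field.
Qed.

(** The path of integration is moved from the real line to the horizontal line
    through the saddle point [i y], where the exponent is [- 2 / 3 y^3 - y s^2] up
    to the oscillation [s^3 / 3].  The boundary term at [T] is at most
    [exp (y^3 / 3 - T^2 eta)] at height [eta], and is integrated in [eta]. *)
Lemma airy_partial_shift (y T : R) : 0 <= y -> x = y ^ 2 -> 0 < T ->
  Rabs (exp (- (2 / 3 * y ^ 3)) * RInt (fun s => exp (- (y * s ^ 2)) * cos (s ^ 3 / 3)) 0 T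
        - airy_partial x T) <= exp (y ^ 3 / 3) / T ^ 2.
Proof.
  intros Hy Hx HT.
  assert (E0 : RInt (u 0) 0 T = airy_partial x T).
  { apply RInt_ext. intros s _. unfold u, Re_, Im_, airy_phase.
    replace (- (s ^ 2 * 0) + 0 ^ 3 / 3 - x * 0) with 0 by field. rewrite exp_0, Rmult_1_l.
    f_equal. eqR. ring. }
  assert (E1 : RInt (u y) 0 T = exp (- (2 / 3 * y ^ 3))
     * RInt (fun s => exp (- (y * s ^ 2)) * cos (s ^ 3 / 3)) 0 T).
  { rewrite <- (RInt_scal (V := R_CompleteNormedModule) (fun s => exp (- (y * s ^ 2)) * cos (s ^ 3 / 3))).
    2:{ apply ex_RInt_cont. intros; cont_ad; auto. }
    apply RInt_ext. intros s _. unfold u, Re_, Im_. scalR.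
    rewrite <- Rmult_assoc, <- exp_plus. rewrite Hx. f_equal; f_equal; eqR; field. }
  rewrite <- E0, <- E1.
  assert (D := fun eta => airy_contour eta T ltac:(lra)).
  assert (Bd : forall eta, 0 <= eta <= y -> Rabs (v eta T) <= exp (y ^ 3 / 3) * exp (- (T ^ 2 * eta))).
  { intros eta He. unfold v. rewrite Rabs_Ropp, Rabs_mult, Rabs_pos_eq by (left; apply exp_pos).
    assert (X : Rabs (sin (Im_ eta T)) <= 1) by apply Rabs_le, SIN_bound.
    assert (X2 : exp (Re_ eta T) <= exp (y ^ 3 / 3) * exp (- (T ^ 2 * eta))).
    { rewrite <- exp_plus. apply exp_le. unfold Re_.
      assert (eta ^ 3 <= y ^ 3) by now apply pow_incr.
      assert (0 <= x * eta) by (rewrite Hx; nra). lra. }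
    assert (P := exp_pos (Re_ eta T)). assert (P2 := Rabs_pos (sin (Im_ eta T))). nra. }
  set (k := exp (y ^ 3 / 3)) in *. assert (Hk : 0 < k) by apply exp_pos.
  assert (HT2 : 0 < T ^ 2) by nra.
  assert (DG : forall c eta, is_derive (fun eta => c * (k * exp (- (T ^ 2 * eta)) / T ^ 2)) eta
                 (- c * (k * exp (- (T ^ 2 * eta))))).
  { intros c eta. auto_derive; auto. absorb exp. field. lra. }
  assert (U1 := deriv_le_le (fun eta => RInt (u eta) 0 T) (fun eta => v eta T)
    (fun eta => -1 * (k * exp (- (T ^ 2 * eta)) / T ^ 2)) (fun eta => - -1 * (k * exp (- (T ^ 2 * eta))))
    0 y Hy (fun z _ => D z) (fun z _ => DG (-1) z)
    ltac:(intros z Hz; specialize (Bd z Hz); apply Rabs_le_between in Bd; lra)).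
  assert (U2 := deriv_le_le
    (fun eta => 1 * (k * exp (- (T ^ 2 * eta)) / T ^ 2)) (fun eta => - 1 * (k * exp (- (T ^ 2 * eta))))
    (fun eta => RInt (u eta) 0 T) (fun eta => v eta T)
    0 y Hy (fun z _ => DG 1 z) (fun z _ => D z)
    ltac:(intros z Hz; specialize (Bd z Hz); apply Rabs_le_between in Bd; lra)).
  cbv beta in U1, U2.
  replace (- (T ^ 2 * 0)) with 0 in U1, U2 by ring. rewrite exp_0 in U1, U2.
  assert (0 < k * exp (- (T ^ 2 * y)) / T ^ 2).
  { apply Rdiv_lt_0_compat; auto. apply Rmult_lt_0_compat; auto. apply exp_pos. }
  replace (k * 1 / T ^ 2) with (k / T ^ 2) in U1, U2 by (field; lra).
  apply Rabs_le. lra.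
Qed.

End AiryShift.

Lemma Ai_shifted (y e : R) : 0 <= y -> 0 < e -> exists M, 0 < M /\ forall T, M <= T ->
  Rabs (PI * Ai (y ^ 2) * exp (2 / 3 * y ^ 3)
        - RInt (fun s => exp (- (y * s ^ 2)) * cos (s ^ 3 / 3)) 0 T) <= e.
Proof.
  intros Hy He. set (k := exp (2 / 3 * y ^ 3)). set (l := exp (y ^ 3 / 3)).
  assert (Hk : 0 < k) by apply exp_pos. assert (Hl : 0 < l) by apply exp_pos.
  assert (He1 : 0 < e / (2 * k)) by (apply Rdiv_lt_0_compat; lra).
  destruct (Ai_lim_eps (y ^ 2) (e / (2 * k)) He1) as [M HM].
  assert (Hle : 0 < l / (e / (2 * k))) by (apply Rdiv_lt_0_compat; lra).
  exists (1 + Rabs M + l / (e / (2 * k))).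
  assert (PM := Rabs_pos M). assert (QM := Rle_abs M).
  split; [lra|]. intros T HT.
  assert (A := airy_partial_shift (y ^ 2) y T Hy eq_refl ltac:(lra)).
  specialize (HM T ltac:(lra)). fold l in A.
  rewrite exp_Ropp in A. fold k in A.
  set (J := RInt (fun s => exp (- (y * s ^ 2)) * cos (s ^ 3 / 3)) 0 T) in *.
  assert (A2 : l / T ^ 2 <= e / (2 * k)).
  { apply Rmult_le_reg_r with (T ^ 2); [nra|]. unfold Rdiv at 1.
    rewrite Rmult_assoc, Rinv_l by nra.
    apply Rle_trans with (e / (2 * k) * (l / (e / (2 * k)))).
    - right. field. repeat split; lra.
    - apply Rmult_le_compat_l; [lra|]. nra. }
  replace (PI * Ai (y ^ 2) * k - J)
    with (- (k * ((/ k * J - airy_partial (y ^ 2) T) + (airy_partial (y ^ 2) T - PI * Ai (y ^ 2)))))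
    by (field; lra).
  rewrite Rabs_Ropp, Rabs_mult, (Rabs_pos_eq k) by lra.
  replace e with (k * (e / (2 * k) + e / (2 * k))) by (field; lra).
  apply Rmult_le_compat_l; [lra|]. eapply Rle_trans; [apply Rabs_triang|]. lra.
Qed.

(** After the shift, Laplace's method with [H = 2 y] applies: where
    [s sqrt y] is bounded, [s^3 / 3] is small. *)
Lemma Ai_pos_asymptotic (e : R) : 0 < e -> exists Y, 1 <= Y /\ forall y, Y <= y ->
  Rabs (Ai (y ^ 2) * exp (2 / 3 * y ^ 3) * (2 * sqrt PI * sqrt y) - 1) <= e.
Proof.
  intros He. destruct (laplace_method (e / 4) (1 / 2) ltac:(lra) ltac:(lra))
    as (U & eta & HU & Heta & Main).
  assert (PP := PI2_3_2). unfold PI2 in PP.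
  assert (HUe : 0 < U ^ 3 / eta) by (apply Rdiv_lt_0_compat; [apply pow_lt|]; lra).
  exists (1 + U ^ 3 / eta). split; [lra|]. intros y Hy.
  destruct (sqrt_props y ltac:(lra)) as [Hq Hqq].
  destruct (sqrt_props (2 * y) ltac:(lra)) as [Hp Hpp].
  assert (Hp1 : 1 <= sqrt (2 * y)) by (rewrite <- sqrt_1 at 1; apply sqrt_le_1; lra).
  assert (He4 : 0 < e / 4 / sqrt (2 * y)) by (apply Rdiv_lt_0_compat; lra).
  destruct (Ai_shifted y (e / 4 / sqrt (2 * y)) ltac:(lra) He4) as (M & HM & HA).
  set (T := M + U). specialize (HA T ltac:(unfold T; lra)).
  specialize (Main (2 * y) T (fun s => s ^ 3 / 3) (fun s => y * s ^ 2)).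
  assert (B := Main ltac:(lra) ltac:(unfold T; nra) ltac:(intros; cont_ad; auto)
                    ltac:(intros; cont_ad; auto)).
  cbv beta in B. clear Main.
  assert (B1 : forall s, 0 <= s <= T -> s * sqrt (2 * y) <= U ->
     Rabs (y * s ^ 2 - 2 * y * s ^ 2 / 2) <= eta /\ Rabs (s ^ 3 / 3) <= eta).
  { intros s Hs Hs2. split.
    - replace (y * s ^ 2 - 2 * y * s ^ 2 / 2) with 0 by field. rewrite Rabs_R0. lra.
    - assert (S3 : 0 <= s ^ 3) by (apply pow_le; lra).
      rewrite Rabs_pos_eq by lra.
      assert (X : (s * sqrt (2 * y)) ^ 3 <= U ^ 3) by (apply pow_incr; split; nra).
      replace ((s * sqrt (2 * y)) ^ 3) with (s ^ 3 * (2 * y) * sqrt (2 * y)) in X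
        by (rewrite <- Hpp at 1; ring).
      assert (X2 : U ^ 3 = eta * (U ^ 3 / eta)) by (field; lra).
      assert (X3 : eta * (U ^ 3 / eta) <= eta * y) by (apply Rmult_le_compat_l; lra).
      assert (X4 : 0 <= s ^ 3 * (2 * y)) by (apply Rmult_le_pos; lra).
      assert (X5 : s ^ 3 * (2 * y) * 1 <= s ^ 3 * (2 * y) * sqrt (2 * y))
        by (apply Rmult_le_compat_l; lra).
      apply Rmult_le_reg_r with (2 * y); lra. }
  specialize (B B1 ltac:(intros; lra)). clear B1.
  set (J := RInt (fun s => exp (- (y * s ^ 2)) * cos (s ^ 3 / 3)) 0 T) in *.
  assert (SP : 1 <= sqrt PI) by (rewrite <- sqrt_1 at 1; apply sqrt_le_1; lra).
  assert (SPP := sqrt_sqrt PI ltac:(lra)).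
  assert (S2 : 0 < sqrt 2) by (apply sqrt_lt_R0; lra).
  assert (S22 := sqrt_sqrt 2 ltac:(lra)).
  assert (E : sqrt (PI / 2) / sqrt (2 * y) = sqrt PI / (2 * sqrt y)).
  { rewrite sqrt_mult, sqrt_div by lra. rewrite <- S22 at 3. field. lra. }
  rewrite E in B.
  assert (C : Rabs (PI * Ai (y ^ 2) * exp (2 / 3 * y ^ 3) - sqrt PI / (2 * sqrt y)) <= e / 2 / sqrt (2 * y)).
  { replace (PI * Ai (y ^ 2) * exp (2 / 3 * y ^ 3) - sqrt PI / (2 * sqrt y))
      with ((PI * Ai (y ^ 2) * exp (2 / 3 * y ^ 3) - J) + (J - sqrt PI / (2 * sqrt y))) by ring.
    replace (e / 2 / sqrt (2 * y)) with (e / 4 / sqrt (2 * y) + e / 4 / sqrt (2 * y)) by (field; lra).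
    eapply Rle_trans; [apply Rabs_triang|]. lra. }
  replace (Ai (y ^ 2) * exp (2 / 3 * y ^ 3) * (2 * sqrt PI * sqrt y) - 1)
    with ((2 * sqrt y / sqrt PI) * (PI * Ai (y ^ 2) * exp (2 / 3 * y ^ 3) - sqrt PI / (2 * sqrt y))).
  2:{ set (sp := sqrt PI) in *. rewrite <- SPP. field. lra. }
  assert (Hc : 0 < 2 * sqrt y / sqrt PI) by (apply Rdiv_lt_0_compat; lra).
  rewrite Rabs_mult, (Rabs_pos_eq (2 * sqrt y / sqrt PI)) by lra.
  eapply Rle_trans; [apply Rmult_le_compat_l; [lra|exact C]|].
  assert (Hpq : sqrt y <= sqrt (2 * y)) by (apply sqrt_le_1; lra).
  replace (2 * sqrt y / sqrt PI * (e / 2 / sqrt (2 * y))) with (e * (sqrt y / (sqrt PI * sqrt (2 * y))))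
    by (field; lra).
  assert (sqrt y / (sqrt PI * sqrt (2 * y)) <= 1).
  { apply Rmult_le_reg_r with (sqrt PI * sqrt (2 * y)); [nra|]. unfold Rdiv.
    rewrite Rmult_assoc, Rinv_l by nra. nra. }
  nra.
Qed.

(** Integrating by parts twice turns the integral of [exp (- y u^2) cos (u^3 / 3)]
    into that of [1 - cos (u^3 / 3)] against a positive weight, which is bounded
    below on [[1, 2]]. *)
Lemma airy_shifted_lower (y : R) : 0 <= y -> exists M, forall T, M <= T ->
  (1 - cos (1 / 3)) * exp (- (4 * y)) / 16
  <= RInt (fun s => exp (- (y * s ^ 2)) * cos (s ^ 3 / 3)) 0 T.
Proof.
  intros Hy. set (k := (1 - cos (1 / 3)) * exp (- (4 * y))).
  assert (PP := PI2_3_2). unfold PI2 in PP.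
  assert (Hk0 : 0 < 1 - cos (1 / 3)).
  { assert (cos (1 / 3) < cos 0) by (apply cos_decreasing_1; lra). rewrite cos_0 in H. lra. }
  assert (Hk : 0 < k) by (apply Rmult_lt_0_compat; [exact Hk0|apply exp_pos]).
  set (F := fun s => exp (- (y * s ^ 2)) * cos (s ^ 3 / 3)).
  assert (CF : forall s, continuous F s) by (intros; unfold F; cont_ad; auto).
  set (m := fun u => 2 * (y / u ^ 3 + 1 / u ^ 5) * exp (- (y * u ^ 2))).
  set (N := fun u => exp (- (y * u ^ 2)) * (10 / u ^ 6 + 10 * y / u ^ 4 + 4 * y ^ 2 / u ^ 2)).
  set (W := fun u => sin (u ^ 3 / 3) * exp (- (y * u ^ 2)) / u ^ 2 + (1 - cos (u ^ 3 / 3)) * m u).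
  set (G := fun u => (1 - cos (u ^ 3 / 3)) * N u).
  assert (DW : forall u, 0 < u -> is_derive W u (F u - G u)).
  { intros u Hu. unfold W, F, G, m, N. auto_derive.
    - repeat split; auto; try lra; apply Rgt_not_eq; repeat apply Rmult_lt_0_compat; lra.
    - absorb exp. absorb cos. absorb sin. field. lra. }
  assert (CG : forall u, 0 < u -> continuous G u).
  { intros u Hu. unfold G, N. cont_ad.
    repeat split; auto; try lra; apply Rgt_not_eq; repeat apply Rmult_lt_0_compat; lra. }
  assert (PG : forall u, 0 < u -> 0 <= G u).
  { intros u Hu. unfold G, N. assert (T := COS_bound (u ^ 3 / 3)).
    apply Rmult_le_pos; [lra|]. apply Rmult_le_pos; [left; apply exp_pos|].
    assert (0 < u ^ 6) by (apply pow_lt; lra). assert (0 < u ^ 4) by (apply pow_lt; lra).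
    assert (0 < u ^ 2) by (apply pow_lt; lra).
    assert (0 < 10 / u ^ 6) by (apply Rdiv_lt_0_compat; lra).
    assert (0 <= 10 * y / u ^ 4) by (apply Rmult_le_pos; [lra|left; apply Rinv_0_lt_compat; lra]).
    assert (0 <= 4 * y ^ 2 / u ^ 2) by (apply Rmult_le_pos; [nra|left; apply Rinv_0_lt_compat; lra]).
    lra. }
  assert (GL : forall u, 1 <= u <= 2 -> k / 8 <= G u).
  { intros u Hu. unfold G, N, k.
    assert (A : 1 - cos (1 / 3) <= 1 - cos (u ^ 3 / 3)).
    { assert (1 <= u ^ 3 <= 8).
      { assert (1 <= u * u <= 4) by nra. simpl. nra. }
      assert (cos (u ^ 3 / 3) <= cos (1 / 3)) by (apply cos_decr_1; lra). lra. }
    assert (U2 : u ^ 2 <= 4) by nra.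
    assert (A2 : exp (- (4 * y)) <= exp (- (y * u ^ 2))) by (apply exp_le; nra).
    assert (A3 : 1 / 8 <= 10 / u ^ 6 + 10 * y / u ^ 4 + 4 * y ^ 2 / u ^ 2).
    { assert (1 <= u ^ 6 <= 64).
      { split; [apply pow_R1_Rle; lra|]. replace 64 with (2 ^ 6) by ring. apply pow_incr; lra. }
      assert (0 < u ^ 4) by (apply pow_lt; lra). assert (0 < u ^ 2) by (apply pow_lt; lra).
      assert (/ 64 <= / u ^ 6) by (apply Rinv_le_contravar; lra).
      assert (0 <= 10 * y / u ^ 4) by (apply Rmult_le_pos; [lra|left; apply Rinv_0_lt_compat; lra]).
      assert (0 <= 4 * y ^ 2 / u ^ 2) by (apply Rmult_le_pos; [nra|left; apply Rinv_0_lt_compat; lra]).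
      unfold Rdiv in *. lra. }
    assert (P := exp_pos (- (4 * y))).
    set (a := 1 - cos (1 / 3)) in *. set (a' := 1 - cos (u ^ 3 / 3)) in *.
    set (b := exp (- (4 * y))) in *. set (b' := exp (- (y * u ^ 2))) in *.
    set (c' := 10 / u ^ 6 + 10 * y / u ^ 4 + 4 * y ^ 2 / u ^ 2) in *.
    assert (a * (b * (1 / 8)) <= a' * (b' * c')) by (apply Rmult_le_compat; nra).
    lra. }
  (* The cut-off d at 0 and the end point T each cost at most k / 32. *)
  set (d := Rmin (1 / 2) (k / (64 * (2 + y)))).
  assert (Hd : 0 < d /\ d <= 1 / 2 /\ d * (2 + y) <= k / 64).
  { assert (0 < k / (64 * (2 + y))) by (apply Rdiv_lt_0_compat; lra).
    unfold d. repeat split; [apply Rmin_glb_lt; lra|apply Rmin_l|].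
    apply Rle_trans with (k / (64 * (2 + y)) * (2 + y)).
    - apply Rmult_le_compat_r; [lra|apply Rmin_r].
    - right. field. lra. }
  assert (Wd : W d <= d * (1 + y)).
  { unfold W, m.
    assert (E1 : 0 < exp (- (y * d ^ 2)) <= 1).
    { split; [apply exp_pos|]. rewrite <- exp_0. apply exp_le. nra. }
    set (E := exp (- (y * d ^ 2))) in *.
    assert (D3 : 0 < d ^ 3) by (apply pow_lt; lra).
    assert (S1 := abs_sin_le (d ^ 3 / 3) ltac:(lra)). apply Rabs_le_between in S1.
    assert (S2 := one_minus_cos_le (d ^ 3 / 3)).
    set (sn := sin (d ^ 3 / 3)) in *. set (cs := 1 - cos (d ^ 3 / 3)) in *.
    assert (D2 : 0 < d ^ 2) by (apply pow_lt; lra). assert (D5 : 0 < d ^ 5) by (apply pow_lt; lra).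
    assert (T1 : sn * E / d ^ 2 <= d / 3).
    { apply Rmult_le_reg_r with (d ^ 2); [lra|]. unfold Rdiv at 1. rewrite Rmult_assoc, Rinv_l by lra.
      replace (d / 3 * d ^ 2) with (d ^ 3 / 3) by field. nra. }
    assert (T2 : 2 * (y / d ^ 3 + 1 / d ^ 5) * E <= 2 * (y * d ^ 2 + 1) / d ^ 5).
    { replace (2 * (y / d ^ 3 + 1 / d ^ 5)) with (2 * (y * d ^ 2 + 1) / d ^ 5) by (field; lra).
      assert (0 <= 2 * (y * d ^ 2 + 1) / d ^ 5).
      { apply Rmult_le_pos; [nra|left; now apply Rinv_0_lt_compat]. } nra. }
    assert (T3 : 0 <= 2 * (y * d ^ 2 + 1) / d ^ 5).
    { apply Rmult_le_pos; [nra|left; now apply Rinv_0_lt_compat]. }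
    assert (T4 : cs * (2 * (y / d ^ 3 + 1 / d ^ 5) * E) <= (d ^ 3 / 3) ^ 2 / 2 * (2 * (y * d ^ 2 + 1) / d ^ 5)).
    { eapply Rle_trans; [apply Rmult_le_compat_l; [lra|exact T2]|]. apply Rmult_le_compat_r; lra. }
    replace ((d ^ 3 / 3) ^ 2 / 2 * (2 * (y * d ^ 2 + 1) / d ^ 5)) with (d * (y * d ^ 2 + 1) / 9) in T4 by (field; lra).
    assert (D21 : d ^ 2 <= 1) by (clear - Hd; nra).
    assert (Y2 : y * d ^ 2 <= y * 1) by (apply Rmult_le_compat_l; lra).
    assert (Y3 : d * (y * d ^ 2 + 1) <= d * (y + 1)) by (apply Rmult_le_compat_l; lra).
    assert (0 <= d * y) by (apply Rmult_le_pos; lra). lra. }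
  exists (2 + 64 / k). intros T HT.
  assert (Hki : 0 < 64 / k) by (apply Rdiv_lt_0_compat; lra).
  assert (WT : - (k / 64) <= W T).
  { unfold W, m.
    assert (E1 : 0 < exp (- (y * T ^ 2)) <= 1).
    { split; [apply exp_pos|]. rewrite <- exp_0. apply exp_le. nra. }
    set (E := exp (- (y * T ^ 2))) in *.
    assert (S1 := SIN_bound (T ^ 3 / 3)). assert (S2 := COS_bound (T ^ 3 / 3)).
    assert (T2 : 0 < T ^ 2) by nra.
    assert (T1 : - (k / 64) <= sin (T ^ 3 / 3) * E / T ^ 2).
    { apply Rmult_le_reg_r with (T ^ 2); [lra|]. unfold Rdiv at 2. rewrite Rmult_assoc, Rinv_l by lra.
      assert (X : k / 64 * (64 / k) = 1) by (field; lra).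
      assert (1 <= k / 64 * T ^ 2) by nra. nra. }
    assert (T4 : 0 <= (1 - cos (T ^ 3 / 3)) * (2 * (y / T ^ 3 + 1 / T ^ 5) * E)).
    { apply Rmult_le_pos; [lra|]. apply Rmult_le_pos; [|lra].
      assert (0 < / T ^ 3) by (apply Rinv_0_lt_compat, pow_lt; lra).
      assert (0 < / T ^ 5) by (apply Rinv_0_lt_compat, pow_lt; lra). unfold Rdiv. nra. }
    lra. }
  fold F. rewrite <- (RInt_Chasles (V := R_CompleteNormedModule) F 0 d T) by now apply ex_RInt_cont.
  plusR.
  assert (I0 : Rabs (RInt F 0 d) <= (d - 0) * 1).
  { apply abs_RInt_le_const; [lra|now apply ex_RInt_cont|]. intros s Hs. unfold F.
    rewrite Rabs_mult, (Rabs_pos_eq (exp _)) by (left; apply exp_pos).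
    assert (exp (- (y * s ^ 2)) <= 1) by (rewrite <- exp_0; apply exp_le; nra).
    assert (Rabs (cos (s ^ 3 / 3)) <= 1) by apply Rabs_le, COS_bound.
    assert (P2 := Rabs_pos (cos (s ^ 3 / 3))). nra. }
  assert (EG : forall a b, 0 < a -> a <= b -> ex_RInt G a b).
  { intros a b Ha Hab. apply ex_RInt_cont_on; [lra|]. intros; apply CG; lra. }
  assert (I1 : RInt F d T = W T - W d + RInt G d T).
  { assert (X : RInt (fun u => F u - G u) d T = W T - W d).
    { apply RInt_FTC; [lra|intros; apply DW; lra|].
      intros u Hu. apply (continuous_minus F G); [apply CF|apply CG; lra]. }
    assert (X2 := RInt_minus (V := R_CompleteNormedModule) F G d T
      (ex_RInt_cont _ _ _ CF) (EG d T ltac:(lra) ltac:(lra))).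
    change (RInt (fun u => F u - G u) d T = RInt F d T - RInt G d T) in X2.
    lra. }
  assert (I2 : k / 8 <= RInt G d T).
  { rewrite <- (RInt_Chasles (V := R_CompleteNormedModule) G d 1 T) by (apply EG; lra).
    rewrite <- (RInt_Chasles (V := R_CompleteNormedModule) G 1 2 T) by (apply EG; lra).
    plusR. plusR.
    assert (0 <= RInt G d 1) by (apply RInt_ge_0; [lra|apply EG; lra|intros; apply PG; lra]).
    assert (0 <= RInt G 2 T) by (apply RInt_ge_0; [lra|apply EG; lra|intros; apply PG; lra]).
    assert (RInt (fun _ => k / 8) 1 2 <= RInt G 1 2).
    { apply RInt_le; [lra|apply ex_RInt_cont; intros; apply continuous_const|apply EG; lra|].
      intros u Hu. apply GL. lra. }
    rewrite RInt_const in H1. revert H1. scalR. lra. }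
  apply Rabs_le_between in I0. fold k. rewrite I1. nra.
Qed.

(** What matters is that the bound is positive and decreasing in [y]; hence [Ai]
    is bounded away from 0 on bounded subsets of [[0, +oo)]. *)
Lemma Ai_lower_bound (y : R) : 0 <= y ->
  (1 - cos (1 / 3)) * exp (- (4 * y)) / (16 * PI) * exp (- (2 / 3 * y ^ 3)) <= Ai (y ^ 2).
Proof.
  intros Hy. destruct (airy_shifted_lower y Hy) as [M HM].
  assert (PP := PI_RGT_0).
  set (k := (1 - cos (1 / 3)) * exp (- (4 * y))) in *.
  assert (H : k / 16 <= PI * Ai (y ^ 2) * exp (2 / 3 * y ^ 3)).
  { apply le_epsilon. intros e He. destruct (Ai_shifted y e Hy He) as (M' & _ & HM').
    specialize (HM (Rmax M M') (Rmax_l _ _)). specialize (HM' (Rmax M M') (Rmax_r _ _)).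
    apply Rabs_le_between in HM'. lra. }
  rewrite exp_Ropp. assert (E := exp_pos (2 / 3 * y ^ 3)).
  set (E' := exp (2 / 3 * y ^ 3)) in *.
  apply Rmult_le_reg_r with (PI * E'); [nra|].
  replace (k / (16 * PI) * / E' * (PI * E')) with (k / 16) by (field; lra). lra.
Qed.

Lemma Ai_pos (y : R) : 0 <= y -> 0 < Ai (y ^ 2).
Proof.
  intros Hy. eapply Rlt_le_trans; [|now apply Ai_lower_bound].
  assert (PP := PI2_3_2). unfold PI2 in PP.
  assert (cos (1 / 3) < cos 0) by (apply cos_decreasing_1; lra). rewrite cos_0 in H.
  apply Rmult_lt_0_compat; [|apply exp_pos]. apply Rdiv_lt_0_compat; [|lra].
  apply Rmult_lt_0_compat; [lra|apply exp_pos].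
Qed.

Lemma Ai_bounded_below (Y : R) : 0 <= Y ->
  exists m, 0 < m /\ forall y, 0 <= y <= Y -> m <= Ai (y ^ 2).
Proof.
  intros HY. exists ((1 - cos (1 / 3)) * exp (- (4 * Y)) / (16 * PI) * exp (- (2 / 3 * Y ^ 3))).
  assert (PP := PI2_3_2). unfold PI2 in PP.
  assert (cos (1 / 3) < cos 0) by (apply cos_decreasing_1; lra). rewrite cos_0 in H.
  split.
  - apply Rmult_lt_0_compat; [|apply exp_pos]. apply Rdiv_lt_0_compat; [|lra].
    apply Rmult_lt_0_compat; [lra|apply exp_pos].
  - intros y Hy. eapply Rle_trans; [|apply Ai_lower_bound; lra].
    assert (A : exp (- (4 * Y)) <= exp (- (4 * y))) by (apply exp_le; lra).
    assert (B : exp (- (2 / 3 * Y ^ 3)) <= exp (- (2 / 3 * y ^ 3))).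
    { apply exp_le. assert (y ^ 3 <= Y ^ 3) by now apply pow_incr. lra. }
    assert (PA := exp_pos (- (4 * Y))). assert (PB := exp_pos (- (2 / 3 * Y ^ 3))).
    apply Rmult_le_compat; try lra.
    + apply Rlt_le, Rdiv_lt_0_compat; [|lra]. nra.
    + apply Rmult_le_compat_r; [left; apply Rinv_0_lt_compat; lra|]. nra.
Qed.

(** A relative error of the amplitude is an admissible error for negative
    arguments only because [Ai] itself is of the order of the weight there. *)
Lemma Ai_neg_bound : exists C, 0 < C /\ forall y, 0 <= y -> Rabs (Ai (- y ^ 2)) * sqrt (1 + y) <= C.
Proof.
  assert (PP := PI2_3_2). unfold PI2 in PP.
  destruct (Ai_neg_asymptotic 1 ltac:(lra)) as (Y & HY & Main).
  exists ((Y + 3) * (Y + 3) + 4). split; [nra|]. intros y Hy.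
  destruct (Rle_dec Y y) as [H|H].
  - specialize (Main y H).
    destruct (sqrt_props y ltac:(lra)) as [Hq Hqq].
    assert (SP : 1 <= sqrt PI) by (rewrite <- sqrt_1 at 1; apply sqrt_le_1; lra).
    assert (S : sqrt (1 + y) <= 2 * sqrt y).
    { apply (le_of_pow_le 1); [lra|]. replace ((2 * sqrt y) ^ 2) with (4 * (sqrt y * sqrt y)) by ring.
      rewrite Hqq, pow2_sqrt by lra. lra. }
    assert (Cb := COS_bound (2 / 3 * y ^ 3 - PI / 4)).
    set (cc := cos (2 / 3 * y ^ 3 - PI / 4)) in *.
    assert (Bd : Rabs (Ai (- y ^ 2)) <= 2 / sqrt y).
    { assert (X : Rabs (/ (sqrt PI * sqrt y) * cc) <= / sqrt y).
      { rewrite Rabs_mult, Rabs_pos_eq by (left; apply Rinv_0_lt_compat; nra).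
        assert (Rabs cc <= 1) by now apply Rabs_le.
        assert (/ (sqrt PI * sqrt y) <= / sqrt y) by (apply Rinv_le_contravar; nra).
        assert (0 < / (sqrt PI * sqrt y)) by (apply Rinv_0_lt_compat; nra). nra. }
      apply Rabs_le_between in X. apply Rabs_le_between in Main.
      unfold Rdiv in Main |- *. apply Rabs_le. lra. }
    apply Rle_trans with (2 / sqrt y * (2 * sqrt y)).
    + apply Rmult_le_compat; auto; [apply Rabs_pos|apply sqrt_pos].
    + replace (2 / sqrt y * (2 * sqrt y)) with 4 by (field; lra). nra.
  - assert (A := Ai_tail (- y ^ 2) 1 (Y + 1) ltac:(lra) ltac:(split; nra)).
    assert (B : Rabs (airy_partial (- y ^ 2) (Y + 1)) <= (Y + 1 - 0) * 1).
    { apply abs_RInt_le_const; [lra|apply ex_RInt_cont, continuous_airy|].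
      intros; apply Rabs_le, COS_bound. }
    assert (C : Rabs (Ai (- y ^ 2)) <= Y + 3).
    { apply Rabs_le_between in A. apply Rabs_le_between in B. apply Rabs_le. split; nra. }
    assert (D : sqrt (1 + y) <= Y + 3).
    { apply (le_of_pow_le 1); [lra|]. rewrite pow2_sqrt by lra. nra. }
    apply Rle_trans with ((Y + 3) * (Y + 3)); [|lra].
    apply Rmult_le_compat; auto; [apply Rabs_pos|apply sqrt_pos].
Qed.

(** * The Blaschke factor on circles around the origin *)

(** The square of the modulus of [1 - q e^(i s)]. *)
Definition den (q s : R) : R := 1 - 2 * q * cos s + q ^ 2.

(** The argument of [1 - q e^(- i s)].  For [|q| < 1] the real part is positive,
    so [atan] gives it without a choice of branch. *)
Definition argq (q s : R) : R := atan (q * sin s / (1 - q * cos s)).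

Lemma abs_mul_cos_lt (q s : R) : -1 < q < 1 -> 0 < 1 - q * cos s.
Proof. intros Hq. assert (T := COS_bound s). destruct (Rle_dec 0 q); nra. Qed.

Lemma den_sum (q s : R) : den q s = (1 - q * cos s) ^ 2 + (q * sin s) ^ 2.
Proof.
  unfold den. assert (T := sin2_cos2 s). unfold Rsqr in T.
  replace ((1 - q * cos s) ^ 2 + (q * sin s) ^ 2)
    with (1 - 2 * q * cos s + q ^ 2 * (sin s * sin s + cos s * cos s)) by ring.
  rewrite T. ring.
Qed.

Lemma den_pos (q s : R) : -1 < q < 1 -> 0 < den q s.
Proof.
  intros Hq. rewrite den_sum. assert (T := abs_mul_cos_lt q s Hq). nra.
Qed.

Lemma den_0 (q : R) : den q 0 = (1 - q) ^ 2.
Proof. unfold den. rewrite cos_0. ring. Qed.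

Lemma is_derive_argq (q s : R) : -1 < q < 1 ->
  is_derive (argq q) s ((q * cos s - q ^ 2) / den q s).
Proof.
  intros Hq. assert (A := abs_mul_cos_lt q s Hq). assert (B := den_pos q s Hq).
  assert (N : q * cos s - q ^ 2 = q * cos s * (1 - q * cos s) - q * sin s * (q * sin s)).
  { assert (T := sin2_cos2 s). unfold Rsqr in T.
    replace (q ^ 2) with (q ^ 2 * (sin s * sin s + cos s * cos s)) by (rewrite T; ring). ring. }
  rewrite N. unfold argq. auto_derive; [lra|]. rewrite den_sum in *. unfold Rsqr.
  field. split; nra.
Qed.

Lemma is_derive_argq_radius (mu c s rho : R) : -1 < mu * exp (c * rho) < 1 ->
  is_derive (fun rho => argq (mu * exp (c * rho)) s) rho
    (c * (mu * exp (c * rho)) * sin s / den (mu * exp (c * rho)) s).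
Proof.
  intros Hq. assert (A := abs_mul_cos_lt _ s Hq). assert (B := den_pos _ s Hq).
  unfold argq. auto_derive; [lra|]. rewrite den_sum in *. unfold Rsqr.
  field. split; nra.
Qed.

(** The next two functions are the real and the imaginary part of
    [log (b_mu z / z^a)] at [z = exp (rho + i s)].  They come from
    [b_mu z = z (1 - mu / z) / (1 - mu z)]: as long as [mu / z] and [mu z] lie in
    the unit disc, both factors have a logarithm, and the branch is smooth in
    [(rho, s)]. *)
Definition logmod (mu a rho s : R) : R :=
  (1 - a) * rho + ln (den (mu * exp (-1 * rho)) s) / 2 - ln (den (mu * exp (1 * rho)) s) / 2.

Definition argument (mu a rho s : R) : R :=
  (1 - a) * s + argq (mu * exp (-1 * rho)) s + argq (mu * exp (1 * rho)) s.

(** Real and imaginary part of [z d/dz log (b_mu z / z^a)]. *)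
Definition dlog_re (mu a rho s : R) : R :=
  (1 - a) + ((mu * exp (-1 * rho)) * cos s - (mu * exp (-1 * rho)) ^ 2) / den (mu * exp (-1 * rho)) s
          + ((mu * exp (1 * rho)) * cos s - (mu * exp (1 * rho)) ^ 2) / den (mu * exp (1 * rho)) s.

Definition dlog_im (mu rho s : R) : R :=
  - (mu * exp (-1 * rho) * sin s / den (mu * exp (-1 * rho)) s)
  + mu * exp (1 * rho) * sin s / den (mu * exp (1 * rho)) s.

Definition radii_ok (mu rho : R) : Prop :=
  -1 < mu * exp (-1 * rho) < 1 /\ -1 < mu * exp (1 * rho) < 1.

Lemma is_derive_logmod_radius (mu a rho s : R) : radii_ok mu rho ->
  is_derive (fun rho => logmod mu a rho s) rho (dlog_re mu a rho s).
Proof.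
  intros [H1 H2]. assert (B1 := den_pos _ s H1). assert (B2 := den_pos _ s H2).
  unfold logmod, dlog_re, den in *. auto_derive; [repeat split; lra|]. field. lra.
Qed.

Lemma is_derive_argument_radius (mu a rho s : R) : radii_ok mu rho ->
  is_derive (fun rho => argument mu a rho s) rho (dlog_im mu rho s).
Proof.
  intros [H1 H2]. unfold argument, dlog_im.
  evar_last.
  { apply (is_derive_plus (fun rho => (1 - a) * s + argq (mu * exp (-1 * rho)) s)).
    - apply (is_derive_plus (fun rho => (1 - a) * s)).
      + apply is_derive_const.
      + apply (is_derive_argq_radius mu (-1)); exact H1.
    - apply (is_derive_argq_radius mu 1); exact H2. }
  assert (B1 := den_pos _ s H1). assert (B2 := den_pos _ s H2).
  unfold plus, zero; simpl. eqR. field. lra.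
Qed.

Lemma is_derive_logmod (mu a rho s : R) : radii_ok mu rho ->
  is_derive (logmod mu a rho) s (- dlog_im mu rho s).
Proof.
  intros [H1 H2]. assert (B1 := den_pos _ s H1). assert (B2 := den_pos _ s H2).
  unfold logmod, dlog_im, den in *. auto_derive; [repeat split; lra|]. field. lra.
Qed.

Lemma is_derive_argument (mu a rho s : R) : radii_ok mu rho ->
  is_derive (argument mu a rho) s (dlog_re mu a rho s).
Proof.
  intros [H1 H2]. unfold argument, dlog_re.
  apply (is_derive_plus (fun s => (1 - a) * s + argq (mu * exp (-1 * rho)) s)
           (fun s => argq (mu * exp (1 * rho)) s)).
  - apply (is_derive_plus (fun s => (1 - a) * s)).
    + auto_derive; auto; ring.
    + now apply is_derive_argq.
  - now apply is_derive_argq.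
Qed.

Lemma continuity_2d_den (mu c rho s : R) : continuity_2d_pt (fun rho s => den (mu * exp (c * rho)) s) rho s.
Proof.
  unfold den. simpl.
  repeat first
   [ apply continuity_2d_pt_plus | apply continuity_2d_pt_minus | apply continuity_2d_pt_opp
   | apply (continuity_1d_2d_pt_comp exp); [apply continuity_pt_filterlim, continuous_exp|]
   | apply (continuity_1d_2d_pt_comp cos (fun _ s => s)); [apply continuity_pt_filterlim, continuous_cos|]
   | apply continuity_2d_pt_mult
   | apply continuity_2d_pt_const | apply continuity_2d_pt_id1
   | apply continuity_2d_pt_id2 ].
Qed.

Ltac c2de :=
  repeat first
   [ apply continuity_2d_pt_plus | apply continuity_2d_pt_minus | apply continuity_2d_pt_opp
   | apply continuity_2d_den
   | apply (continuity_1d_2d_pt_comp exp); [apply continuity_pt_filterlim, continuous_exp|]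
   | apply (continuity_1d_2d_pt_comp cos (fun _ s => s)); [apply continuity_pt_filterlim, continuous_cos|]
   | apply (continuity_1d_2d_pt_comp sin (fun _ s => s)); [apply continuity_pt_filterlim, continuous_sin|]
   | apply continuity_2d_pt_mult
   | apply continuity_2d_pt_const | apply continuity_2d_pt_id1
   | apply continuity_2d_pt_id2 ].

Lemma continuity_2d_dlog_re (mu a rho s : R) : radii_ok mu rho ->
  continuity_2d_pt (dlog_re mu a) rho s.
Proof.
  intros [H1 H2]. assert (B1 := den_pos _ s H1). assert (B2 := den_pos _ s H2).
  unfold dlog_re, Rdiv. simpl.
  apply continuity_2d_pt_plus; [apply continuity_2d_pt_plus; [apply continuity_2d_pt_const|]|];
    (apply continuity_2d_pt_mult; [c2de|apply continuity_2d_pt_inv; [apply continuity_2d_den|lra]]).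
Qed.

Lemma continuity_2d_dlog_im (mu rho s : R) : radii_ok mu rho ->
  continuity_2d_pt (dlog_im mu) rho s.
Proof.
  intros [H1 H2]. assert (B1 := den_pos _ s H1). assert (B2 := den_pos _ s H2).
  unfold dlog_im, Rdiv. simpl.
  apply continuity_2d_pt_plus; [apply continuity_2d_pt_opp|];
    (apply continuity_2d_pt_mult; [c2de|apply continuity_2d_pt_inv; [apply continuity_2d_den|lra]]).
Qed.

Lemma continuity_2d_logmod (mu a rho s : R) : radii_ok mu rho ->
  continuity_2d_pt (logmod mu a) rho s.
Proof.
  intros [H1 H2]. assert (B1 := den_pos _ s H1). assert (B2 := den_pos _ s H2).
  unfold logmod, Rdiv.
  apply continuity_2d_pt_minus; [apply continuity_2d_pt_plus; [c2de|]|].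
  - apply continuity_2d_pt_mult; [|apply continuity_2d_pt_const].
    apply (continuity_1d_2d_pt_comp ln); [|apply continuity_2d_den].
    apply continuity_pt_filterlim, (ex_derive_continuous ln). auto_derive. exact B1.
  - apply continuity_2d_pt_mult; [|apply continuity_2d_pt_const].
    apply (continuity_1d_2d_pt_comp ln); [|apply continuity_2d_den].
    apply continuity_pt_filterlim, (ex_derive_continuous ln). auto_derive. exact B2.
Qed.

Lemma continuity_2d_argq (mu c rho s : R) : -1 < mu * exp (c * rho) < 1 ->
  continuity_2d_pt (fun rho s => argq (mu * exp (c * rho)) s) rho s.
Proof.
  intros H. assert (A := abs_mul_cos_lt _ s H). unfold argq, Rdiv.
  apply (continuity_1d_2d_pt_comp atan
    (fun rho s => mu * exp (c * rho) * sin s * / (1 - mu * exp (c * rho) * cos s))).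
  - apply continuity_pt_filterlim, (ex_derive_continuous atan). auto_derive. auto.
  - apply continuity_2d_pt_mult; [c2de|]. apply continuity_2d_pt_inv; [c2de|lra].
Qed.

Lemma continuity_2d_argument (mu a rho s : R) : radii_ok mu rho ->
  continuity_2d_pt (argument mu a) rho s.
Proof.
  intros [H1 H2]. unfold argument.
  apply continuity_2d_pt_plus; [apply continuity_2d_pt_plus; [c2de|]|];
    now apply continuity_2d_argq.
Qed.

(** [1 / PI] instead of [1 / (2 PI)] since the integrand over the lower half
    circle is the complex conjugate of that over the upper half. *)
Definition coef (mu : R) (n k : nat) : R :=
  / PI * RInt (fun s => cos (INR n * (s + 2 * argq mu s) - INR k * s)) 0 PI.

Definition circle_integrand (mu a n rho s : R) : R :=
  exp (n * logmod mu a rho s) * cos (n * argument mu a rho s).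

Lemma locally_radii_ok (mu rho : R) : radii_ok mu rho -> locally rho (radii_ok mu).
Proof.
  intros [[A B] [C D]].
  assert (X : forall c l, mu * exp (c * rho) < l -> locally rho (fun rho => mu * exp (c * rho) < l)).
  { intros c l H.
    assert (Cc : continuous (fun rho => mu * exp (c * rho)) rho) by (cont_ad; auto).
    apply (Cc (fun y => y < l)). now apply open_lt. }
  assert (Y : forall c l, l < mu * exp (c * rho) -> locally rho (fun rho => l < mu * exp (c * rho))).
  { intros c l H.
    assert (Cc : continuous (fun rho => mu * exp (c * rho)) rho) by (cont_ad; auto).
    apply (Cc (fun y => l < y)). now apply open_gt. }
  unfold radii_ok. repeat apply filter_and; auto.
Qed.

Lemma argument_PI (mu a rho : R) : argument mu a rho PI = (1 - a) * PI.
Proof.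
  unfold argument, argq. rewrite sin_PI.
  rewrite !Rmult_0_r. unfold Rdiv. rewrite !Rmult_0_l, atan_0. ring.
Qed.

Lemma argument_at_0 (mu a rho : R) : argument mu a rho 0 = 0.
Proof.
  unfold argument, argq. rewrite sin_0.
  rewrite !Rmult_0_r. unfold Rdiv. rewrite !Rmult_0_l, atan_0. ring.
Qed.

Lemma sin_int_PI (n k : nat) : sin ((INR n - INR k) * PI) = 0.
Proof.
  apply sin_eq_0_1. exists (Z.of_nat n - Z.of_nat k)%Z.
  rewrite minus_IZR, <- !INR_IZR_INZ. ring.
Qed.

(** By Cauchy's theorem the integral over the circle of radius [exp rho] does
    not depend on [rho]; the boundary terms at [s = 0] and [s = PI] vanish
    because the integrand is real there ([n - k] being an integer at [s = PI]).
    The hypothesis says that neither the pole [1 / mu] nor the zero [mu] of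
    [b_mu] is crossed. *)
Lemma circle_shift (mu : R) (n k : nat) (rho : R) : (0 < n)%nat -> -1 < mu < 1 ->
  (forall t, 0 <= t <= 1 -> radii_ok mu (t * rho)) ->
  coef mu n k = / PI * RInt (circle_integrand mu (INR k / INR n) (INR n) rho) 0 PI.
Proof.
  intros Hn Hmu Hok. set (a := INR k / INR n). set (N := INR n).
  assert (HN : 0 < N) by (apply lt_0_INR; lia).
  assert (PP := PI_RGT_0).
  unfold coef. f_equal.
  set (v := fun rho s => exp (N * logmod mu a rho s) * sin (N * argument mu a rho s)).
  set (w := fun rho s => N * exp (N * logmod mu a rho s)
     * (dlog_re mu a rho s * cos (N * argument mu a rho s)
        - dlog_im mu rho s * sin (N * argument mu a rho s))).
  assert (D : forall r, radii_ok mu r ->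
     is_derive (fun rho => RInt (circle_integrand mu a N rho) 0 PI) r 0).
  { intros r Hr.
    assert (Z : v r PI - v r 0 = 0).
    { unfold v. rewrite argument_PI, argument_at_0.
        replace (N * ((1 - a) * PI)) with ((INR n - INR k) * PI)
          by (unfold N, a; field; unfold N in HN; lra).
        rewrite sin_int_PI, !Rmult_0_r, sin_0. ring. }
    refine (eq_ind _ (is_derive _ r) _ _ Z).
    apply (is_derive_contour (circle_integrand mu a N) v w); [lra| | | |].
    - apply (filter_imp (radii_ok mu)); [|now apply locally_radii_ok].
      intros y Hy s. unfold circle_integrand, w. evar_last.
      { apply (is_derive_mult (fun rho => exp (N * logmod mu a rho s)) (fun rho => cos (N * argument mu a rho s))).
        - apply (is_derive_comp exp (fun rho => N * logmod mu a rho s)).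
          + apply is_derive_exp.
          + apply (is_derive_scal (fun rho => logmod mu a rho s)), is_derive_logmod_radius, Hy.
        - apply (is_derive_comp cos (fun rho => N * argument mu a rho s)).
          + apply is_derive_cos.
          + apply (is_derive_scal (fun rho => argument mu a rho s)), is_derive_argument_radius, Hy.
        - intros; apply Rmult_comm. }
      unfold plus, scal, mult; simpl. unfold mult; simpl. eqR. ring.
    - apply (filter_imp (radii_ok mu)); [|now apply locally_radii_ok].
      intros y Hy s _. unfold circle_integrand.
      apply (continuous_mult (fun s => exp (N * logmod mu a y s)) (fun s => cos (N * argument mu a y s))).
      + apply (continuous_comp (fun s => N * logmod mu a y s) exp); [|apply continuous_exp].
        apply (ex_derive_continuous (fun s => N * logmod mu a y s)).
        eexists. apply (is_derive_scal (logmod mu a y)), is_derive_logmod, Hy.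
      + apply (continuous_comp (fun s => N * argument mu a y s) cos); [|apply continuous_cos].
        apply (ex_derive_continuous (fun s => N * argument mu a y s)).
        eexists. apply (is_derive_scal (argument mu a y)), is_derive_argument, Hy.
    - intros s. unfold w.
      assert (CR := continuity_2d_logmod mu a r s Hr). assert (CA := continuity_2d_argument mu a r s Hr).
      assert (CA' : continuity_2d_pt (fun rho s => N * argument mu a rho s) r s)
        by (apply continuity_2d_pt_mult; [apply continuity_2d_pt_const|exact CA]).
      apply continuity_2d_pt_mult; [apply continuity_2d_pt_mult; [apply continuity_2d_pt_const|]|].
      + apply (continuity_1d_2d_pt_comp exp (fun rho s => N * logmod mu a rho s));
          [apply continuity_pt_filterlim, continuous_exp|].
        apply continuity_2d_pt_mult; [apply continuity_2d_pt_const|exact CR].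
      + apply continuity_2d_pt_minus; apply continuity_2d_pt_mult.
        * now apply continuity_2d_dlog_re.
        * apply (continuity_1d_2d_pt_comp cos (fun rho s => N * argument mu a rho s)); auto.
          apply continuity_pt_filterlim, continuous_cos.
        * now apply continuity_2d_dlog_im.
        * apply (continuity_1d_2d_pt_comp sin (fun rho s => N * argument mu a rho s)); auto.
          apply continuity_pt_filterlim, continuous_sin.
    - intros s. unfold v, w. evar_last.
      { apply (is_derive_mult (fun s => exp (N * logmod mu a r s)) (fun s => sin (N * argument mu a r s))).
        - apply (is_derive_comp exp (fun s => N * logmod mu a r s)).
          + apply is_derive_exp.
          + apply (is_derive_scal (logmod mu a r)), is_derive_logmod, Hr.
        - apply (is_derive_comp sin (fun s => N * argument mu a r s)).
          + apply is_derive_sin.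
          + apply (is_derive_scal (argument mu a r)), is_derive_argument, Hr.
        - intros; apply Rmult_comm. }
      unfold plus, scal, mult; simpl. unfold mult; simpl. eqR. ring. }
  assert (E := deriv_zero_const (fun t => RInt (circle_integrand mu a N (t * rho)) 0 PI) 0 1 ltac:(lra)).
  cbv beta in E. rewrite Rmult_1_l, Rmult_0_l in E. rewrite E.
  - apply RInt_ext. intros s _. unfold circle_integrand, logmod, argument.
    rewrite !Rmult_0_r, exp_0, !Rmult_1_r.
    replace (N * (0 + ln (den mu s) / 2 - ln (den mu s) / 2)) with 0 by ring.
    rewrite exp_0, Rmult_1_l. f_equal. unfold a, N. eqR. field. unfold N in HN; lra.
  - intros t Ht. evar_last.
    { apply (is_derive_comp (fun rho => RInt (circle_integrand mu a N rho) 0 PI) (fun t => t * rho)).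
      - apply D. now apply Hok.
      - auto_derive; auto. }
    scalR. eqR. ring.
Qed.

(** * Saddle points *)

(** [e] is the sign of [mu]: [e = 1] stands for the upper edge [1 / alpha0], with
    [mu = lambda], and [e = -1] for the lower edge, with [mu = - lambda]. *)
Definition edge_sign (mu e : R) : Prop := e = 1 /\ 0 < mu < 1 \/ e = -1 /\ -1 < mu < 0.

Lemma edge_sign_facts (mu e : R) : edge_sign mu e -> -1 < mu < 1 /\ e * e = 1 /\ 0 < e * mu.
Proof. intros [[-> H]|[-> H]]; repeat split; lra. Qed.

(** The value at [s = 0] of the derivative of [theta]: [1 / alpha0] for
    [mu = lambda] and [alpha0] for [mu = - lambda]. *)
Definition edge (mu : R) : R := (1 + mu) / (1 - mu).

(** The coefficient [b] in [H ~ 2 b r]: for [a] at the edge, the phase is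
    [n b s^3 / 3] to leading order. *)
Definition edge_curv (mu e : R) : R := e * mu * (1 + mu) / (1 - mu) ^ 3.

Lemma edge_curv_pos (mu e : R) : edge_sign mu e -> 0 < edge_curv mu e.
Proof.
  intros H. destruct (edge_sign_facts mu e H) as (H1 & _ & H2). unfold edge_curv.
  apply Rdiv_lt_0_compat; [|apply pow_lt; lra]. apply Rmult_lt_0_compat; lra.
Qed.

(** The geometry of the two stationary points [exp (+- i s)] on the circle.  The
    phase for [a = freq mu s] has at [s] the critical value [height], up to sign;
    so [height] is a Legendre transform of [theta], which is why its derivative
    is [s] times the curvature [curv]. *)
Definition theta (mu s : R) : R := s + 2 * argq mu s.
Definition freq (mu s : R) : R := (1 - mu ^ 2) / den mu s.
Definition curv (mu e s : R) : R := e * (1 - mu ^ 2) * (2 * mu * sin s) / den mu s ^ 2.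
Definition height (mu e s : R) : R := e * (theta mu s - freq mu s * s).
Definition gap (mu e s : R) : R := e * (edge mu - freq mu s).

(** The same quantities for two real saddle points [exp (+- r)], that is for [a]
    on the other side of the edge: formally [s] becomes [- i r]. *)
Definition denh (mu r : R) : R := 1 - mu * (exp r + exp (- r)) + mu ^ 2.
Definition freqh (mu r : R) : R := (1 - mu ^ 2) / denh mu r.
Definition curvh (mu e r : R) : R := e * (1 - mu ^ 2) * (mu * (exp r - exp (- r))) / denh mu r ^ 2.
Definition heighth (mu e r : R) : R := - e * logmod mu (freqh mu r) r 0.
Definition gaph (mu e r : R) : R := e * (freqh mu r - edge mu).

Lemma is_derive_theta (mu s : R) : -1 < mu < 1 -> is_derive (theta mu) s (freq mu s).
Proof.
  intros H. assert (B := den_pos mu s H). unfold theta, freq. evar_last.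
  { apply (is_derive_plus (fun s => s) (fun s => 2 * argq mu s)).
    - apply is_derive_id.
    - apply (is_derive_scal (argq mu)). now apply is_derive_argq. }
  unfold plus, one; simpl. eqR. unfold den in *. field. lra.
Qed.

Lemma is_derive_freq (mu e s : R) : edge_sign mu e -> is_derive (freq mu) s (- e * curv mu e s).
Proof.
  intros H. destruct (edge_sign_facts mu e H) as (H1 & H2 & _). assert (B := den_pos mu s H1).
  unfold freq, curv.
  replace (- e * (e * (1 - mu ^ 2) * (2 * mu * sin s) / den mu s ^ 2))
    with (- (e * e) * (1 - mu ^ 2) * (2 * mu * sin s) / den mu s ^ 2) by (field; lra).
  rewrite H2. unfold den in *. auto_derive; [lra|]. field. lra.
Qed.

Lemma is_derive_gap (mu e s : R) : edge_sign mu e -> is_derive (gap mu e) s (curv mu e s).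
Proof.
  intros H. destruct (edge_sign_facts mu e H) as (H1 & H2 & _). unfold gap. evar_last.
  { apply (is_derive_scal (fun s => edge mu - freq mu s)).
    apply (is_derive_minus (fun _ => edge mu) (freq mu)); [apply is_derive_const|].
    now apply (is_derive_freq mu e). }
  unfold minus, plus, opp, zero; simpl. eqR.
  replace (e * (0 + - (- e * curv mu e s))) with ((e * e) * curv mu e s) by ring. rewrite H2. ring.
Qed.

Lemma is_derive_height (mu e s : R) : edge_sign mu e ->
  is_derive (height mu e) s (s * curv mu e s).
Proof.
  intros H. destruct (edge_sign_facts mu e H) as (H1 & H2 & _). unfold height. evar_last.
  { apply (is_derive_scal (fun s => theta mu s - freq mu s * s)).
    apply (is_derive_minus (theta mu) (fun s => freq mu s * s)).
    - now apply is_derive_theta.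
    - apply (is_derive_mult (freq mu) (fun s => s)).
      + now apply (is_derive_freq mu e).
      + apply is_derive_id.
      + intros; apply Rmult_comm. }
  unfold minus, plus, opp, mult, one; simpl. eqR.
  replace (e * (freq mu s + - (- e * curv mu e s * s + freq mu s * 1)))
    with ((e * e) * (s * curv mu e s)) by ring. rewrite H2. ring.
Qed.

Definition dcurv (mu e s : R) : R :=
  e * (1 - mu ^ 2) * (2 * mu) * (cos s / den mu s ^ 2 - 4 * mu * sin s ^ 2 / den mu s ^ 3).

Lemma is_derive_curv (mu e s : R) : -1 < mu < 1 -> is_derive (curv mu e) s (dcurv mu e s).
Proof.
  intros H. assert (B := den_pos mu s H). unfold curv, dcurv, den in *.
  auto_derive.
  - apply Rgt_not_eq. simpl in B. nra.
  - field. lra.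
Qed.

Lemma freq_0 (mu : R) : -1 < mu < 1 -> freq mu 0 = edge mu.
Proof. intros H. unfold freq, edge. rewrite den_0. field. lra. Qed.

Lemma gap_0 (mu e : R) : -1 < mu < 1 -> gap mu e 0 = 0.
Proof. intros H. unfold gap. rewrite freq_0 by exact H. ring. Qed.

Lemma theta_0 (mu : R) : theta mu 0 = 0.
Proof. unfold theta, argq. rewrite sin_0, Rmult_0_r. unfold Rdiv. rewrite Rmult_0_l, atan_0. ring. Qed.

Lemma height_0 (mu e : R) : height mu e 0 = 0.
Proof. unfold height. rewrite theta_0. ring. Qed.

Lemma curv_0 (mu e : R) : curv mu e 0 = 0.
Proof. unfold curv. rewrite sin_0. unfold Rdiv. ring. Qed.

Lemma dcurv_0 (mu e : R) : -1 < mu < 1 -> dcurv mu e 0 = 2 * edge_curv mu e.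
Proof. intros H. unfold dcurv, edge_curv. rewrite den_0, sin_0, cos_0. field. lra. Qed.

Lemma denh_factor (mu r : R) : denh mu r = (1 - mu * exp (-1 * r)) * (1 - mu * exp (1 * r)).
Proof.
  unfold denh. replace (-1 * r) with (- r) by ring. rewrite Rmult_1_l, exp_Ropp.
  field. apply Rgt_not_eq, exp_pos.
Qed.

Lemma denh_pos (mu r : R) : radii_ok mu r -> 0 < denh mu r.
Proof. intros [H1 H2]. rewrite denh_factor. apply Rmult_lt_0_compat; lra. Qed.

Lemma is_derive_freqh (mu e r : R) : edge_sign mu e -> radii_ok mu r ->
  is_derive (freqh mu) r (e * curvh mu e r).
Proof.
  intros H Hr. destruct (edge_sign_facts mu e H) as (H1 & H2 & _).
  assert (B := denh_pos mu r Hr). unfold freqh, curvh.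
  replace (e * (e * (1 - mu ^ 2) * (mu * (exp r - exp (- r))) / denh mu r ^ 2))
    with ((e * e) * (1 - mu ^ 2) * (mu * (exp r - exp (- r))) / denh mu r ^ 2) by (field; lra).
  rewrite H2. unfold denh in *. auto_derive; [lra|]. field. lra.
Qed.

Lemma is_derive_gaph (mu e r : R) : edge_sign mu e -> radii_ok mu r ->
  is_derive (gaph mu e) r (curvh mu e r).
Proof.
  intros H Hr. destruct (edge_sign_facts mu e H) as (H1 & H2 & _). unfold gaph. evar_last.
  { apply (is_derive_scal (fun s => freqh mu s - edge mu)).
    apply (is_derive_minus (freqh mu) (fun _ => edge mu)); [|apply is_derive_const].
    now apply (is_derive_freqh mu e). }
  unfold minus, plus, opp, zero; simpl. eqR.
  replace (e * (e * curvh mu e r + - 0)) with ((e * e) * curvh mu e r) by ring. rewrite H2. ring.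
Qed.

(** [freqh] is the value of [a] for which [exp rho] is a saddle point. *)
Lemma dlog_re_0 (mu a r : R) : radii_ok mu r -> dlog_re mu a r 0 = freqh mu r - a.
Proof.
  intros Hr. assert (B := denh_pos mu r Hr). destruct Hr as [H1 H2].
  unfold dlog_re, freqh. rewrite !den_0, cos_0.
  rewrite denh_factor in *. set (p := mu * exp (-1 * r)) in *. set (q := mu * exp (1 * r)) in *.
  replace (mu ^ 2) with (p * q).
  2:{ unfold p, q. replace (mu * exp (-1 * r) * (mu * exp (1 * r))) with (mu ^ 2 * (exp (-1 * r) * exp (1 * r))) by ring.
      rewrite <- exp_plus. replace (-1 * r + 1 * r) with 0 by ring. rewrite exp_0. ring. }
  field. split; lra.
Qed.

Lemma logmod_split (mu a r : R) : logmod mu a r 0 = (1 - a) * r + logmod mu 1 r 0.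
Proof. unfold logmod. ring. Qed.

Lemma is_derive_heighth (mu e r : R) : edge_sign mu e -> radii_ok mu r ->
  is_derive (heighth mu e) r (r * curvh mu e r).
Proof.
  intros H Hr. destruct (edge_sign_facts mu e H) as (H1 & H2 & _). unfold heighth.
  apply (is_derive_ext (fun r => - e * ((1 - freqh mu r) * r + logmod mu 1 r 0))).
  { intros t. now rewrite <- logmod_split. }
  evar_last.
  { apply (is_derive_scal (fun r => (1 - freqh mu r) * r + logmod mu 1 r 0)).
    apply (is_derive_plus (fun r => (1 - freqh mu r) * r) (fun r => logmod mu 1 r 0)).
    - apply (is_derive_mult (fun r => 1 - freqh mu r) (fun r => r)).
      + apply (is_derive_minus (fun _ => 1) (freqh mu)); [apply is_derive_const|].
        now apply (is_derive_freqh mu e).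
      + apply is_derive_id.
      + intros; apply Rmult_comm.
    - now apply is_derive_logmod_radius. }
  rewrite dlog_re_0 by exact Hr.
  unfold minus, plus, opp, zero, mult, one; simpl. eqR.
  replace (- e * ((0 + - (e * curvh mu e r)) * r + (1 - freqh mu r) * 1 + (freqh mu r - 1)))
    with ((e * e) * (r * curvh mu e r)) by ring. rewrite H2. ring.
Qed.

Lemma denh_0 (mu : R) : denh mu 0 = (1 - mu) ^ 2.
Proof. unfold denh. rewrite Ropp_0, exp_0. ring. Qed.

Lemma gaph_0 (mu e : R) : -1 < mu < 1 -> gaph mu e 0 = 0.
Proof. intros H. unfold gaph, freqh, edge. rewrite denh_0. field. lra. Qed.

Lemma heighth_0 (mu e : R) : heighth mu e 0 = 0.
Proof. unfold heighth, logmod. rewrite !Rmult_0_r. ring. Qed.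

Lemma curvh_0 (mu e : R) : curvh mu e 0 = 0.
Proof. unfold curvh. rewrite Ropp_0. unfold Rdiv. ring. Qed.

Lemma is_derive_curvh_0 (mu e : R) : -1 < mu < 1 -> is_derive (curvh mu e) 0 (2 * edge_curv mu e).
Proof.
  intros H. unfold curvh, denh, edge_curv. auto_derive.
  - rewrite Ropp_0, exp_0. replace (1 + - (mu * (1 + 1)) + mu * (mu * 1)) with ((1 - mu) * (1 - mu)) by ring. apply Rgt_not_eq. repeat apply Rmult_lt_0_compat; lra.
  - rewrite Ropp_0, exp_0. field. split; [lra|nra].
Qed.

(** The conclusions on [V] and [D] follow from that on [H] by integration. *)
Lemma saddle_expansion (H V D : R -> R) (b R0 : R) : 0 < R0 -> 
  (forall r, 0 <= r < R0 -> is_derive V r (r * H r)) ->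
  (forall r, 0 <= r < R0 -> is_derive D r (H r)) ->
  V 0 = 0 -> D 0 = 0 -> H 0 = 0 -> is_derive H 0 (2 * b) ->
  forall eta, 0 < eta -> exists r0, 0 < r0 <= R0 /\ forall r, 0 < r < r0 ->
    Rabs (H r - 2 * b * r) <= eta * r /\
    Rabs (V r - 2 / 3 * b * r ^ 3) <= eta * r ^ 3 / 3 /\
    Rabs (D r - b * r ^ 2) <= eta * r ^ 2 / 2.
Proof.
  intros HR DV DD V0 D0 H0 DH eta Heta.
  apply is_derive_Reals in DH. destruct (DH eta Heta) as [d Hd].
  exists (Rmin d R0). split.
  { split; [apply Rmin_glb_lt; [apply cond_pos|lra]|apply Rmin_r]. }
  assert (B : forall r, 0 <= r < Rmin d R0 -> Rabs (H r - 2 * b * r) <= eta * r).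
  { intros r [[Hr| <-] Hr2].
    - specialize (Hd r ltac:(lra)).
      assert (T := Rmin_l d R0). rewrite (Rabs_pos_eq r) in Hd by lra. specialize (Hd ltac:(lra)).
      rewrite Rplus_0_l, H0, Rminus_0_r in Hd.
      replace (H r - 2 * b * r) with ((H r / r - 2 * b) * r) by (field; lra).
      rewrite Rabs_mult, (Rabs_pos_eq r) by lra. apply Rmult_le_compat_r; lra.
    - rewrite H0. replace (0 - 2 * b * 0) with 0 by ring. rewrite Rabs_R0. lra. }
  intros r Hr. assert (T := Rmin_r d R0).
  assert (B' : forall x, 0 <= x <= r -> - (eta * x) <= H x - 2 * b * x <= eta * x).
  { intros x Hx. apply Rabs_le_between, B. lra. }
  split; [apply B; lra|].
  assert (Poly : forall c x, is_derive (fun r => c * r ^ 3 / 3) x (c * x ^ 2)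
                  /\ is_derive (fun r => c * r ^ 2 / 2) x (c * x)).
  { intros c x. split; auto_derive; auto; field. }
  split; apply Rabs_le.
  - assert (A1 := deriv_le_le V (fun x => x * H x) (fun r => (2 * b + eta) * r ^ 3 / 3)
      (fun x => (2 * b + eta) * x ^ 2) 0 r ltac:(lra) ltac:(intros; apply DV; lra)
      ltac:(intros; apply Poly) ltac:(intros x Hx; specialize (B' x Hx); nra)).
    assert (A2 := deriv_le_le (fun r => (2 * b - eta) * r ^ 3 / 3) (fun x => (2 * b - eta) * x ^ 2)
      V (fun x => x * H x) 0 r ltac:(lra) ltac:(intros; apply Poly) ltac:(intros; apply DV; lra)
      ltac:(intros x Hx; specialize (B' x Hx); nra)).
    cbv beta in A1, A2. rewrite V0 in A1, A2. split; lra.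
  - assert (A1 := deriv_le_le D H (fun r => (2 * b + eta) * r ^ 2 / 2)
      (fun x => (2 * b + eta) * x) 0 r ltac:(lra) ltac:(intros; apply DD; lra)
      ltac:(intros; apply Poly) ltac:(intros x Hx; specialize (B' x Hx); nra)).
    assert (A2 := deriv_le_le (fun r => (2 * b - eta) * r ^ 2 / 2) (fun x => (2 * b - eta) * x)
      D H 0 r ltac:(lra) ltac:(intros; apply Poly) ltac:(intros; apply DD; lra)
      ltac:(intros x Hx; specialize (B' x Hx); nra)).
    cbv beta in A1, A2. rewrite D0 in A1, A2. split; lra.
Qed.

(** With the expansions [H ~ 2 b r], [V ~ 2 b r^3 / 3], [D ~ b r^2], the two
    quotients below tend to 1: the first one compares the amplitudes of the
    Laplace or stationary phase formula and of the Airy asymptotics, the second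
    one compares [gamma ^ 2] with its linearization. *)
Lemma saddle_ratios (H V D : R -> R) (b R0 : R) : 0 < R0 -> 0 < b ->
  (forall r, 0 <= r < R0 -> is_derive V r (r * H r)) ->
  (forall r, 0 <= r < R0 -> is_derive D r (H r)) ->
  V 0 = 0 -> D 0 = 0 -> H 0 = 0 -> is_derive H 0 (2 * b) ->
  forall eta, 0 < eta -> exists r0, 0 < r0 <= R0 /\ forall r, 0 < r < r0 ->
    0 < H r /\ 0 < V r /\ 0 < D r /\ H r <= 3 * b * r /\
    Rabs (12 * b ^ 2 * V r / H r ^ 3 - 1) <= eta /\
    Rabs (4 / 9 * D r ^ 3 / (b * V r ^ 2) - 1) <= eta.
Proof.
  intros HR Hb DV DD V0 D0 H0 DH eta Heta.
  set (t := Rmin (1 / 4) (eta / 16)).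
  assert (Ht : 0 < t /\ t <= 1 / 4 /\ 16 * t <= eta).
  { unfold t. assert (A := Rmin_l (1 / 4) (eta / 16)). assert (B := Rmin_r (1 / 4) (eta / 16)).
    repeat split; try lra. apply Rmin_glb_lt; lra. }
  destruct (saddle_expansion H V D b R0 HR DV DD V0 D0 H0 DH (2 * b * t) ltac:(nra)) as (r0 & Hr0 & B).
  exists r0. split; [exact Hr0|]. intros r Hr. destruct (B r Hr) as (B1 & B2 & B3).
  assert (r3 : 0 < r ^ 3) by (apply pow_lt; lra).
  set (hh := H r / (2 * b * r) - 1). set (vv := V r / (2 / 3 * b * r ^ 3) - 1).
  set (dd := D r / (b * r ^ 2) - 1).
  assert (EH : H r = 2 * b * r * (1 + hh)) by (unfold hh; field; lra).
  assert (EV : V r = 2 / 3 * b * r ^ 3 * (1 + vv)) by (unfold vv; field; lra).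
  assert (ED : D r = b * r ^ 2 * (1 + dd)) by (unfold dd; field; lra).
  assert (Bh : - t <= hh <= t).
  { rewrite EH in B1. replace (2 * b * r * (1 + hh) - 2 * b * r) with ((2 * b * r) * hh) in B1 by ring.
    apply Rabs_le_between in B1. assert (0 < 2 * b * r) by nra. split; nra. }
  assert (Bv : - t <= vv <= t).
  { rewrite EV in B2. replace (2 / 3 * b * r ^ 3 * (1 + vv) - 2 / 3 * b * r ^ 3) with ((2 / 3 * b * r ^ 3) * vv) in B2 by ring.
    apply Rabs_le_between in B2. assert (0 < 2 / 3 * b * r ^ 3) by nra. split; nra. }
  assert (Bd : - t <= dd <= t).
  { rewrite ED in B3. replace (b * r ^ 2 * (1 + dd) - b * r ^ 2) with ((b * r ^ 2) * dd) in B3 by ring.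
    apply Rabs_le_between in B3. assert (0 < b * r ^ 2) by nra. split; nra. }
  clear B B1 B2 B3.
  assert (PH : 0 < H r) by (rewrite EH; apply Rmult_lt_0_compat; [nra|lra]).
  assert (PV : 0 < V r) by (rewrite EV; apply Rmult_lt_0_compat; [nra|lra]).
  assert (PD : 0 < D r) by (rewrite ED; apply Rmult_lt_0_compat; [nra|lra]).
  repeat split; auto.
  - rewrite EH. assert (0 < b * r) by nra. nra.
  - rewrite EH, EV.
    replace (12 * b ^ 2 * (2 / 3 * b * r ^ 3 * (1 + vv)) / (2 * b * r * (1 + hh)) ^ 3 - 1)
      with (((1 + vv) - (1 + hh) ^ 3) / (1 + hh) ^ 3) by (field; lra).
    assert (C : 27 / 64 <= (1 + hh) ^ 3).
    { replace (27 / 64) with ((3 / 4) ^ 3) by field. apply pow_incr. lra. }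
    unfold Rdiv. rewrite Rabs_mult, Rabs_inv, (Rabs_pos_eq ((1 + hh) ^ 3)) by lra.
    apply Rmult_le_reg_r with ((1 + hh) ^ 3); [lra|]. rewrite Rmult_assoc, Rinv_l by lra.
    apply Rle_trans with (5 * t); [|nra]. rewrite Rmult_1_r. apply Rabs_le.
    assert (h2 : 0 <= hh ^ 2 <= t / 4) by nra.
    assert (h3 : - (t / 16) <= hh ^ 3 <= t / 16) by (simpl in *; nra).
    replace ((1 + hh) ^ 3) with (1 + 3 * hh + 3 * hh ^ 2 + hh ^ 3) by ring. lra.
  - rewrite ED, EV.
    replace (4 / 9 * (b * r ^ 2 * (1 + dd)) ^ 3 / (b * (2 / 3 * b * r ^ 3 * (1 + vv)) ^ 2) - 1)
      with (((1 + dd) ^ 3 - (1 + vv) ^ 2) / (1 + vv) ^ 2) by (field; lra).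
    assert (C : 9 / 16 <= (1 + vv) ^ 2).
    { replace (9 / 16) with ((3 / 4) ^ 2) by field. apply pow_incr. lra. }
    unfold Rdiv. rewrite Rabs_mult, Rabs_inv, (Rabs_pos_eq ((1 + vv) ^ 2)) by lra.
    apply Rmult_le_reg_r with ((1 + vv) ^ 2); [lra|]. rewrite Rmult_assoc, Rinv_l by lra.
    apply Rle_trans with (7 * t); [|nra]. rewrite Rmult_1_r. apply Rabs_le.
    assert (h2 : 0 <= dd ^ 2 <= t / 4) by nra.
    assert (h3 : - (t / 16) <= dd ^ 3 <= t / 16) by (simpl in *; nra).
    assert (v2 : 0 <= vv ^ 2 <= t / 4) by nra.
    replace ((1 + dd) ^ 3) with (1 + 3 * dd + 3 * dd ^ 2 + dd ^ 3) by ring.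
    replace ((1 + vv) ^ 2) with (1 + 2 * vv + vv ^ 2) by ring. lra.
Qed.

Lemma edge_ratios (mu e : R) : edge_sign mu e ->
  forall eta, 0 < eta -> exists r0, 0 < r0 /\ forall r, 0 < r < r0 ->
    0 < curv mu e r /\ 0 < height mu e r /\ 0 < gap mu e r /\
    curv mu e r <= 3 * edge_curv mu e * r /\
    Rabs (12 * edge_curv mu e ^ 2 * height mu e r / curv mu e r ^ 3 - 1) <= eta /\
    Rabs (4 / 9 * gap mu e r ^ 3 / (edge_curv mu e * height mu e r ^ 2) - 1) <= eta.
Proof.
  intros H eta Heta. destruct (edge_sign_facts mu e H) as (H1 & H2 & _).
  destruct (saddle_ratios (curv mu e) (height mu e) (gap mu e) (edge_curv mu e) 1 ltac:(lra)
    (edge_curv_pos mu e H) ltac:(intros; now apply is_derive_height)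
    ltac:(intros; now apply is_derive_gap) (height_0 mu e) (gap_0 mu e H1) (curv_0 mu e)
    ltac:(rewrite <- dcurv_0 by exact H1; now apply is_derive_curv) eta Heta) as (r0 & Hr0 & M).
  exists r0. split; [lra|exact M].
Qed.

(** Later bounds are uniform in [r] because both quantities stay away from 1. *)
Lemma radii_range (mu : R) : -1 < mu < 1 -> exists R0, 0 < R0 /\
  forall r, Rabs r <= R0 -> Rabs (mu * exp (-1 * r)) <= (1 + Rabs mu) / 2
                         /\ Rabs (mu * exp (1 * r)) <= (1 + Rabs mu) / 2.
Proof.
  intros H. assert (Hm : Rabs mu < 1) by (apply Rabs_def1; lra).
  assert (Pm := Rabs_pos mu).
  set (q := (1 + Rabs mu) / 2).
  destruct (Req_dec mu 0) as [->|Hne].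
  { exists 1. split; [lra|]. intros r _. rewrite !Rmult_0_l, Rabs_R0. unfold q. lra. }
  assert (Hm0 : 0 < Rabs mu) by now apply Rabs_pos_lt.
  exists (ln (q / Rabs mu)).
  assert (Hq : 1 < q / Rabs mu).
  { apply Rmult_lt_reg_r with (Rabs mu); auto. unfold Rdiv. rewrite Rmult_assoc, Rinv_l by lra.
    unfold q. lra. }
  split; [rewrite <- ln_1; apply ln_increasing; lra|].
  assert (X : forall x, x <= ln (q / Rabs mu) -> Rabs (mu * exp x) <= q).
  { intros x Hx. rewrite Rabs_mult, (Rabs_pos_eq (exp x)) by (left; apply exp_pos).
    apply Rle_trans with (Rabs mu * (q / Rabs mu)).
    - apply Rmult_le_compat_l; [lra|]. rewrite <- (exp_ln (q / Rabs mu)) by lra. now apply exp_le.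
    - right. field. lra. }
  intros r Hr. apply Rabs_le_between in Hr. split; apply X; lra.
Qed.

Lemma radii_range_ok (mu r : R) : -1 < mu < 1 ->
  Rabs (mu * exp (-1 * r)) <= (1 + Rabs mu) / 2 -> Rabs (mu * exp (1 * r)) <= (1 + Rabs mu) / 2 ->
  radii_ok mu r.
Proof.
  intros H A B. assert (Hm : Rabs mu < 1) by (apply Rabs_def1; lra).
  apply Rabs_le_between in A. apply Rabs_le_between in B. split; lra.
Qed.

Lemma edge_ratios_h (mu e : R) : edge_sign mu e ->
  forall eta, 0 < eta -> exists r0, 0 < r0 /\ forall r, 0 < r < r0 ->
    0 < curvh mu e r /\ 0 < heighth mu e r /\ 0 < gaph mu e r /\
    curvh mu e r <= 3 * edge_curv mu e * r /\
    Rabs (12 * edge_curv mu e ^ 2 * heighth mu e r / curvh mu e r ^ 3 - 1) <= eta /\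
    Rabs (4 / 9 * gaph mu e r ^ 3 / (edge_curv mu e * heighth mu e r ^ 2) - 1) <= eta.
Proof.
  intros H eta Heta. destruct (edge_sign_facts mu e H) as (H1 & H2 & _).
  destruct (radii_range mu H1) as (R0 & HR0 & HR).
  assert (OK : forall r, 0 <= r < R0 -> radii_ok mu r).
  { intros r Hr. destruct (HR r) as [A B]; [rewrite Rabs_pos_eq; lra|]. now apply radii_range_ok. }
  destruct (saddle_ratios (curvh mu e) (heighth mu e) (gaph mu e) (edge_curv mu e) R0 HR0
    (edge_curv_pos mu e H) ltac:(intros; apply is_derive_heighth; auto)
    ltac:(intros; apply is_derive_gaph; auto) (heighth_0 mu e) (gaph_0 mu e H1) (curvh_0 mu e)
    (is_derive_curvh_0 mu e H1) eta Heta) as (r0 & Hr0 & M).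
  exists r0. split; [lra|exact M].
Qed.

(** * The three regimes *)

Lemma den_bounds (q s : R) : -1 < q < 1 -> (1 - Rabs q) ^ 2 <= den q s <= 4.
Proof.
  intros Hq. unfold den. assert (T := COS_bound s).
  unfold Rabs. destruct (Rcase_abs q); split; nra.
Qed.

Lemma cos_sign_mult (e x : R) : e = 1 \/ e = -1 -> cos (e * x) = cos x.
Proof. intros [-> | ->]; [f_equal; ring|]. rewrite <- cos_neg. f_equal; ring. Qed.

Lemma sqrt_le_of_sq (x y : R) : 0 <= y -> x <= y ^ 2 -> sqrt x <= y.
Proof.
  intros Hy H. apply Rle_trans with (sqrt (y ^ 2)); [now apply sqrt_le_1_alt|].
  rewrite sqrt_pow2 by lra. lra.
Qed.

(** ** Two stationary points on the unit circle *)

Lemma is_derive_phase (mu e n k s : R) : -1 < mu < 1 ->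
  is_derive (fun s => e * (k * s - n * theta mu s)) s (e * (k - n * freq mu s)).
Proof.
  intros H. evar_last.
  { apply (is_derive_scal (fun s => k * s - n * theta mu s)).
    apply (is_derive_minus (fun s => k * s) (fun s => n * theta mu s)).
    - auto_derive; auto.
    - apply (is_derive_scal (theta mu)). now apply is_derive_theta. }
  unfold minus, plus, opp, mult; simpl. eqR. ring.
Qed.

Lemma is_derive_phase1 (mu e n k s : R) : edge_sign mu e ->
  is_derive (fun s => e * (k - n * freq mu s)) s (n * curv mu e s).
Proof.
  intros H. destruct (edge_sign_facts mu e H) as (H1 & H2 & _). evar_last.
  { apply (is_derive_scal (fun s => k - n * freq mu s)).
    apply (is_derive_minus (fun s => k) (fun s => n * freq mu s)).
    - apply is_derive_const.
    - apply (is_derive_scal (freq mu)). now apply (is_derive_freq mu e). }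
  unfold minus, plus, opp, zero, mult; simpl. eqR.
  replace (e * (0 + - (n * (- e * curv mu e s)))) with ((e * e) * (n * curv mu e s)) by ring.
  rewrite H2. ring.
Qed.

Lemma curv_nonneg (mu e s : R) : edge_sign mu e -> 0 <= s <= PI -> 0 <= curv mu e s.
Proof.
  intros H Hs. destruct (edge_sign_facts mu e H) as (H1 & _ & H2). assert (B := den_pos mu s H1).
  assert (S := sin_ge_0 s ltac:(lra) ltac:(lra)).
  unfold curv. replace (e * (1 - mu ^ 2) * (2 * mu * sin s)) with ((1 - mu ^ 2) * (2 * (e * mu)) * sin s) by ring.
  apply Rmult_le_pos; [|left; apply Rinv_0_lt_compat, pow_lt; lra].
  apply Rmult_le_pos; [|lra]. apply Rmult_le_pos; [nra|lra].
Qed.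

Lemma continuous_curv (mu e n s : R) : -1 < mu < 1 -> continuous (fun s => n * curv mu e s) s.
Proof.
  intros H. apply (continuous_scal_r n (curv mu e)). apply (ex_derive_continuous (curv mu e)).
  eexists. now apply is_derive_curv.
Qed.

Lemma coef_phase (mu e : R) (n k : nat) : e = 1 \/ e = -1 ->
  coef mu n k = / PI * RInt (fun s => cos (e * (INR k * s - INR n * theta mu s))) 0 PI.
Proof.
  intros He. unfold coef. f_equal. apply RInt_ext. intros s _.
  rewrite cos_sign_mult by exact He. unfold theta. rewrite <- cos_neg. f_equal. eqR. ring.
Qed.

Lemma edge_sign_or (mu e : R) : edge_sign mu e -> e = 1 \/ e = -1.
Proof. intros [[-> _]|[-> _]]; auto. Qed.

Lemma dcurv_bound (mu e s : R) : edge_sign mu e ->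
  Rabs (dcurv mu e s) <= 2 * (/ (1 - Rabs mu) ^ 4 + 4 / (1 - Rabs mu) ^ 6).
Proof.
  intros H. destruct (edge_sign_facts mu e H) as (H1 & H2 & H3).
  assert (Hm : Rabs mu < 1) by (apply Rabs_def1; lra).
  destruct (den_bounds mu s H1) as [B _]. set (d := (1 - Rabs mu) ^ 2) in *.
  assert (Hd : 0 < d) by (apply pow_lt; lra).
  replace ((1 - Rabs mu) ^ 4) with (d ^ 2) by (unfold d; ring).
  replace ((1 - Rabs mu) ^ 6) with (d ^ 3) by (unfold d; ring).
  assert (d ^ 2 <= den mu s ^ 2) by (apply pow_incr; lra).
  assert (d ^ 3 <= den mu s ^ 3) by (apply pow_incr; lra).
  assert (P2 : 0 < d ^ 2) by (apply pow_lt; lra). assert (P3 : 0 < d ^ 3) by (apply pow_lt; lra).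
  assert (I2 : 0 < / den mu s ^ 2 <= / d ^ 2).
  { split; [apply Rinv_0_lt_compat; lra|apply Rinv_le_contravar; lra]. }
  assert (I3 : 0 < / den mu s ^ 3 <= / d ^ 3).
  { split; [apply Rinv_0_lt_compat; lra|apply Rinv_le_contravar; lra]. }
  unfold dcurv. rewrite Rabs_mult.
  assert (A : Rabs (e * (1 - mu ^ 2) * (2 * mu)) <= 2).
  { apply Rabs_le. replace (e * (1 - mu ^ 2) * (2 * mu)) with (2 * (e * mu) * (1 - mu ^ 2)) by ring.
    assert (e * mu <= 1). { destruct H as [[-> ?]|[-> ?]]; lra. }
    assert (0 <= 1 - mu ^ 2 <= 1) by nra. split; nra. }
  assert (C : Rabs (cos s / den mu s ^ 2 - 4 * mu * sin s ^ 2 / den mu s ^ 3) <= / d ^ 2 + 4 / d ^ 3).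
  { assert (T1 := COS_bound s). assert (T2 := SIN_bound s).
    assert (T4 : -1 <= mu * sin s ^ 2 <= 1) by (split; nra).
    replace (cos s / den mu s ^ 2 - 4 * mu * sin s ^ 2 / den mu s ^ 3)
      with (cos s * / den mu s ^ 2 + - 4 * (mu * sin s ^ 2) * / den mu s ^ 3)
      by (unfold Rdiv; ring).
    unfold Rdiv. apply Rabs_le. split; nra. }
  apply Rmult_le_compat; auto; apply Rabs_pos.
Qed.

(** A single parameter controls the three conditions of stationary phase: up to
    constants, [sin p] bounds from below the curvature and the distance of [p] to
    both ends, while the third derivative of the phase is bounded by [n L].  The
    conditions then all read [n (sin p)^3 >= K]. *)
Lemma coef_stationary (mu e : R) : edge_sign mu e -> forall eps, 0 < eps -> exists K, 0 < K /\
  forall (n k : nat) (p : R), 0 < p < PI -> INR k = INR n * freq mu p ->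
  K <= INR n * sin p ^ 3 ->
  Rabs (coef mu n k * sqrt (INR n * curv mu e p)
        - sqrt (2 / PI) * cos (INR n * height mu e p - PI / 4)) <= eps.
Proof.
  intros H eps Heps. destruct (edge_sign_facts mu e H) as (H1 & H2 & H3).
  assert (PP := PI2_3_2). unfold PI2 in PP.
  destruct (stationary_phase eps Heps) as (K & HK & Main).
  set (L := 2 * (/ (1 - Rabs mu) ^ 4 + 4 / (1 - Rabs mu) ^ 6)).
  assert (HL : 0 < L).
  { assert (Hm : Rabs mu < 1) by (apply Rabs_def1; lra).
    assert (0 < / (1 - Rabs mu) ^ 4) by (apply Rinv_0_lt_compat, pow_lt; lra).
    assert (0 < / (1 - Rabs mu) ^ 6) by (apply Rinv_0_lt_compat, pow_lt; lra).
    unfold L, Rdiv. lra. }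
  set (c := (1 - mu ^ 2) * (2 * (e * mu)) / 16).
  assert (Hc : 0 < c) by (unfold c; assert (0 < 1 - mu ^ 2) by nra; nra).
  exists (K * L ^ 2 / c ^ 3 + K / c).
  assert (c3 : 0 < c ^ 3) by (apply pow_lt; lra).
  assert (L2 : 0 < L ^ 2) by (apply pow_lt; lra).
  assert (K1 : 0 < K * L ^ 2 / c ^ 3) by (apply Rdiv_lt_0_compat; nra).
  assert (K2 : 0 < K / c) by (apply Rdiv_lt_0_compat; lra).
  split; [lra|]. intros n k p Hp Hk HKn.
  assert (Sp : 0 < sin p) by (apply sin_gt_0; lra).
  assert (Sp3 : 0 < sin p ^ 3) by (apply pow_lt; lra).
  assert (Hn : 0 < INR n) by (assert (T := pos_INR n); nra).
  assert (Hcurv : c * sin p <= curv mu e p).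
  { unfold curv. destruct (den_bounds mu p H1) as [_ B]. assert (B0 := den_pos mu p H1).
    replace (e * (1 - mu ^ 2) * (2 * mu * sin p) / den mu p ^ 2)
      with (16 * (c * sin p) * / den mu p ^ 2) by (unfold c; field; lra).
    assert (/ 16 <= / den mu p ^ 2) by (apply Rinv_le_contravar; nra).
    assert (0 < c * sin p) by nra. nra. }
  set (h := curv mu e p) in *.
  assert (Hh3 : c ^ 3 * (INR n * sin p ^ 3) <= INR n * h ^ 3).
  { assert ((c * sin p) ^ 3 <= h ^ 3) by (apply pow_incr; nra).
    replace (c ^ 3 * (INR n * sin p ^ 3)) with (INR n * (c * sin p) ^ 3) by ring.
    apply Rmult_le_compat_l; lra. }
  (* [p] and [PI - p] both dominate [sin p]. *)
  assert (P1 : sin p <= p) by (assert (T := abs_sin_le p ltac:(lra)); apply Rabs_le_between in T; lra).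
  assert (P2 : sin p <= PI - p).
  { rewrite <- (sin_PI_x p).
    assert (T := abs_sin_le (PI - p) ltac:(lra)); apply Rabs_le_between in T; lra. }
  assert (Hend : forall d, sin p <= d -> K <= INR n * h * d ^ 2).
  { intros d Hd. apply Rle_trans with (c * (INR n * sin p ^ 3)).
    - apply Rle_trans with (c * (K / c)); [right; field; lra|]. apply Rmult_le_compat_l; lra.
    - replace (c * (INR n * sin p ^ 3)) with (INR n * (c * sin p) * sin p ^ 2) by ring.
      apply Rmult_le_compat; [nra|nra|nra|]. apply pow_incr; lra. }
  assert (B := Main (INR n * h) (INR n * L) 0 PI p
    (fun s => e * (INR k * s - INR n * theta mu s)) (fun s => e * (INR k - INR n * freq mu s))
    (fun s => INR n * curv mu e s)).
  cbv beta in B. clear Main.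
  assert (B' : Rabs (RInt (fun s => cos (e * (INR k * s - INR n * theta mu s))) 0 PI
     - sqrt (2 * PI) / sqrt (INR n * h) * cos (e * (INR k * p - INR n * theta mu p) + PI / 4))
     <= eps / sqrt (INR n * h)).
  { apply B; clear B.
    - nra.
    - lra.
    - intros; now apply is_derive_phase.
    - intros; now apply is_derive_phase1.
    - intros; now apply continuous_curv.
    - intros; apply Rmult_le_pos; [lra|]. now apply curv_nonneg.
    - rewrite Hk. ring.
    - nra.
    - intros x _. replace (INR n * curv mu e x - INR n * h) with (INR n * (curv mu e x - h)) by ring.
      rewrite Rabs_mult, (Rabs_pos_eq (INR n)), Rmult_assoc by lra.
      apply Rmult_le_compat_l; [lra|].
      destruct (MVT_gen (curv mu e) p x (dcurv mu e)) as (y & _ & E).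
      + intros y _. now apply is_derive_curv.
      + intros y _. apply continuity_pt_filterlim, (ex_derive_continuous (curv mu e)).
        eexists. now apply is_derive_curv.
      + unfold h. rewrite E, Rabs_mult. apply Rmult_le_compat_r; [apply Rabs_pos|].
        now apply dcurv_bound.
    - assert (K * L ^ 2 <= INR n * h ^ 3).
      { apply Rle_trans with (c ^ 3 * (INR n * sin p ^ 3)); [|exact Hh3].
        apply Rle_trans with (c ^ 3 * (K * L ^ 2 / c ^ 3)); [right; field; lra|].
        apply Rmult_le_compat_l; lra. }
      replace (K * (INR n * L) ^ 2) with (INR n ^ 2 * (K * L ^ 2)) by ring.
      replace ((INR n * h) ^ 3) with (INR n ^ 2 * (INR n * h ^ 3)) by ring.
      apply Rmult_le_compat_l; [|lra]. apply pow_le; lra.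
    - rewrite Rminus_0_r. now apply Hend.
    - now apply Hend. }
  rewrite (coef_phase mu e) by now apply (edge_sign_or mu).
  set (J := RInt (fun s => cos (e * (INR k * s - INR n * theta mu s))) 0 PI) in *.
  replace (cos (e * (INR k * p - INR n * theta mu p) + PI / 4))
    with (cos (INR n * height mu e p - PI / 4)) in B'.
  2:{ rewrite <- cos_neg. f_equal. unfold height. rewrite Hk. ring. }
  set (cc := cos (INR n * height mu e p - PI / 4)) in *.
  destruct (sqrt_props (INR n * h) ltac:(nra)) as [Hq _]. set (q := sqrt (INR n * h)) in *.
  assert (E : sqrt (2 / PI) = sqrt (2 * PI) / PI).
  { replace (2 / PI) with ((2 * PI) / PI ^ 2) by (field; lra).
    rewrite sqrt_div_alt by nra. rewrite sqrt_pow2 by lra. reflexivity. }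
  rewrite E.
  replace (/ PI * J * q - sqrt (2 * PI) / PI * cc)
    with ((J - sqrt (2 * PI) / q * cc) * (q / PI)) by (field; lra).
  rewrite Rabs_mult, (Rabs_pos_eq (q / PI)) by (apply Rlt_le, Rdiv_lt_0_compat; lra).
  apply Rle_trans with (eps / q * (q / PI)).
  - apply Rmult_le_compat_r; [apply Rlt_le, Rdiv_lt_0_compat; lra|exact B'].
  - replace (eps / q * (q / PI)) with (eps * / PI) by (field; lra).
    assert (/ PI <= 1) by (rewrite <- Rinv_1; apply Rinv_le_contravar; lra). nra.
Qed.

(** ** Bounded argument of the Airy function *)

(** With [s = t / w] the phase becomes [t^3 / 3 + x t] up to an error that is
    small, uniformly for [t <= T], when [w] is large and [eta] small.  On [t >= T] both integrals are small
    by van der Corput's test, the phases being convex. *)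
Lemma coef_bounded_range (mu e : R) : edge_sign mu e -> forall M eps, 0 < M -> 0 < eps ->
  exists eta w0, 0 < eta /\ 0 < w0 /\
  forall (n k : nat) (w x : R), w0 <= w -> w ^ 3 = INR n * edge_curv mu e ->
  Rabs x <= M -> Rabs (e * (INR k - INR n * edge mu) / w - x) <= eta ->
  Rabs (coef mu n k * w - Ai x) <= eps.
Proof.
  intros H M eps HM Heps. destruct (edge_sign_facts mu e H) as (H1 & H2 & H3).
  assert (PP := PI2_3_2). unfold PI2 in PP.
  assert (Hb := edge_curv_pos mu e H). set (b := edge_curv mu e) in *.
  (* beyond [t = T] both phases have derivative at least [T]. *)
  assert (H2e : 0 < 2 / eps) by (apply Rdiv_lt_0_compat; lra).
  set (T := 4 + 2 * M + 2 / eps).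
  assert (HT : 2 <= T /\ T <= T ^ 2 / 2 - M - 1).
  { assert (T = 4 + 2 * M + 2 / eps) by reflexivity. split; [lra|]. nra. }
  set (eta := Rmin 1 (eps / (2 * T ^ 2))).
  assert (Heta : 0 < eta /\ eta <= 1 /\ eta * T ^ 2 <= eps / 2).
  { assert (0 < eps / (2 * T ^ 2)) by (apply Rdiv_lt_0_compat; nra). unfold eta.
    assert (A1 := Rmin_l 1 (eps / (2 * T ^ 2))). assert (A2 := Rmin_r 1 (eps / (2 * T ^ 2))).
    repeat split; auto.
    - apply Rmin_glb_lt; lra.
    - apply Rle_trans with (eps / (2 * T ^ 2) * T ^ 2); [apply Rmult_le_compat_r; nra|].
      right. field. lra. }
  assert (HT4 : 0 < T ^ 4) by (apply pow_lt; lra).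
  set (z := Rmin (b / 2) (b * eps / (2 * T ^ 4))).
  assert (Hz : 0 < z /\ z <= b / 2 /\ z * T ^ 4 <= b * eps / 2).
  { assert (0 < b * eps / (2 * T ^ 4)) by (apply Rdiv_lt_0_compat; nra). unfold z.
    assert (A1 := Rmin_l (b / 2) (b * eps / (2 * T ^ 4))).
    assert (A2 := Rmin_r (b / 2) (b * eps / (2 * T ^ 4))).
    repeat split; auto.
    - apply Rmin_glb_lt; lra.
    - apply Rle_trans with (b * eps / (2 * T ^ 4) * T ^ 4); [apply Rmult_le_compat_r; lra|].
      right. field. lra. }
  destruct (saddle_expansion (curv mu e) (height mu e) (gap mu e) b 1 ltac:(lra)
    ltac:(intros; now apply is_derive_height)
    ltac:(intros; now apply is_derive_gap) (height_0 mu e) (gap_0 mu e H1) (curv_0 mu e)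
    ltac:(unfold b; rewrite <- dcurv_0 by exact H1; now apply is_derive_curv) z ltac:(lra)) as (r0 & Hr0 & G).
  exists eta, (1 + (T + 1) / r0). 
  assert (Hw0 : 0 < (T + 1) / r0) by (apply Rdiv_lt_0_compat; lra).
  split; [lra|]. split; [lra|].
  intros n k w x Hw Hw3 Hx Hd.
  assert (HTw : T / w < r0).
  { apply Rmult_lt_reg_r with w; [lra|]. unfold Rdiv. rewrite Rmult_assoc, Rinv_l by lra.
    assert (r0 * ((T + 1) / r0) = T + 1) by (field; lra). nra. }
  assert (HTw0 : 0 < T / w) by (apply Rdiv_lt_0_compat; lra).
  set (F := fun s => e * (INR k * s - INR n * theta mu s)).
  set (F1 := fun s => e * (INR k - INR n * freq mu s)).
  set (d := e * (INR k - INR n * edge mu)) in *.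
  assert (HF1 : forall s, F1 s = d + INR n * gap mu e s).
  { intros s. unfold F1, d, gap. ring. }
  assert (Hn : 0 < INR n).
  { assert (0 < w ^ 3) by (apply pow_lt; lra). rewrite Hw3 in H0. assert (Tn := pos_INR n). nra. }
  assert (HFs : forall s, F s = d * s + INR n * (s * gap mu e s - height mu e s)).
  { intros s. unfold F, d, gap, height.  ring. }
  apply Rabs_le_between in Hd.
  assert (HFt : forall t, 0 <= t <= T -> Rabs (F (t / w) - airy_phase x t) <= eta * T + z * T ^ 3 / b).
  { intros t Ht. destruct (Req_dec t 0) as [->|Hne].
    { rewrite HFs. unfold airy_phase. unfold Rdiv at 1 2 3 4. rewrite !Rmult_0_l, height_0.
      replace (d * 0 + INR n * (0 - 0) - (0 ^ 3 / 3 + x * 0)) with 0 by field.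
      rewrite Rabs_R0. assert (0 < T ^ 3) by (apply pow_lt; lra).
      assert (0 < z * T ^ 3 / b) by (apply Rdiv_lt_0_compat; nra). nra. }
    assert (Htw : 0 < t / w < r0).
    { split; [apply Rdiv_lt_0_compat; lra|]. apply Rle_lt_trans with (T / w); [|lra].
      apply Rmult_le_compat_r; [left; apply Rinv_0_lt_compat|]; lra. }
    destruct (G _ Htw) as (_ & G2 & G3). set (s := t / w) in *.
    assert (Es : t = w * s) by (unfold s; field; lra).
    assert (E3 : t ^ 3 = INR n * (b * s ^ 3)) by (rewrite Es, Rpow_mult_distr, Hw3; ring).
    assert (E1 : d * s = d / w * t) by (unfold s; field; lra).
    rewrite HFs, E1. unfold airy_phase. rewrite E3.
    replace (d / w * t + INR n * (s * gap mu e s - height mu e s) - (INR n * (b * s ^ 3) / 3 + x * t))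
      with ((d / w - x) * t + INR n * (s * (gap mu e s - b * s ^ 2) - (height mu e s - 2 / 3 * b * s ^ 3))) by (field; lra).
    assert (N1 : Rabs ((d / w - x) * t) <= eta * T).
    { rewrite Rabs_mult, (Rabs_pos_eq t) by lra. assert (Rabs (d / w - x) <= eta) by (apply Rabs_le; lra).
      apply Rmult_le_compat; try lra. apply Rabs_pos. }
    assert (s3 : 0 < s ^ 3) by (apply pow_lt; lra).
    assert (N2 : Rabs (s * (gap mu e s - b * s ^ 2) - (height mu e s - 2 / 3 * b * s ^ 3)) <= z * s ^ 3).
    { eapply Rle_trans; [apply Rabs_triang|]. rewrite Rabs_Ropp, Rabs_mult, (Rabs_pos_eq s) by lra.
      assert (s * Rabs (gap mu e s - b * s ^ 2) <= s * (z * s ^ 2 / 2)) by (apply Rmult_le_compat_l; lra).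
      replace (s * (z * s ^ 2 / 2)) with (z * s ^ 3 / 2) in H0 by field.
      assert (0 <= z * s ^ 3) by (apply Rmult_le_pos; lra). lra. }
    assert (N3 : INR n * s ^ 3 <= T ^ 3 / b).
    { apply Rmult_le_reg_r with b; [lra|]. unfold Rdiv. rewrite (Rmult_assoc (T ^ 3)), Rinv_l by lra.
      replace (INR n * s ^ 3 * b) with (t ^ 3) by (rewrite E3; ring).
      rewrite Rmult_1_r. apply pow_incr; lra. }
    eapply Rle_trans; [apply Rabs_triang|]. apply Rplus_le_compat; [exact N1|].
    rewrite Rabs_mult, (Rabs_pos_eq (INR n)) by lra.
    apply Rle_trans with (INR n * (z * s ^ 3)); [apply Rmult_le_compat_l; lra|].
    replace (INR n * (z * s ^ 3)) with (z * (INR n * s ^ 3)) by ring.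
    replace (z * T ^ 3 / b) with (z * (T ^ 3 / b)) by (field; lra).
    apply Rmult_le_compat_l; lra. }
  assert (CF : forall s, continuous F s).
  { intros s. apply (ex_derive_continuous F). eexists. now apply is_derive_phase. }
  assert (CcF : forall s, continuous (fun s => cos (F s)) s).
  { intros s. apply (continuous_comp F cos); [apply CF|apply continuous_cos]. }
  assert (Tail : Rabs (RInt (fun s => cos (F s)) (T / w) PI) <= 2 / (w * T)).
  { apply (van_der_corput F F1 (fun s => INR n * curv mu e s)); [lra| | | | |].
    - intros; now apply is_derive_phase.
    - intros; now apply is_derive_phase1.
    - intros; now apply continuous_curv.
    - intros s Hs; apply Rmult_le_pos; [lra|]. apply curv_nonneg; [exact H|lra].
    - split; [nra|]. rewrite HF1. destruct (G (T / w) ltac:(lra)) as (_ & _ & G3).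
      set (s := T / w) in *. assert (Es : T = w * s) by (unfold s; field; lra).
      apply Rabs_le_between in G3. apply Rabs_le_between in Hx.
      assert (D1 : d = w * (d / w)) by (field; lra).
      assert (D2 : w * (- M - 1) <= d) by (rewrite D1; apply Rmult_le_compat_l; lra).
      assert (D3 : b / 2 * s ^ 2 <= gap mu e s) by nra.
      assert (D4 : INR n * (b / 2 * s ^ 2) <= INR n * gap mu e s) by (apply Rmult_le_compat_l; lra).
      replace (INR n * (b / 2 * s ^ 2)) with (w * (T ^ 2 / 2)) in D4.
      2:{ transitivity (w ^ 3 / 2 * s ^ 2); [rewrite Es; field|rewrite Hw3; field]. }
      assert (w * T <= w * (T ^ 2 / 2 - M - 1)) by (apply Rmult_le_compat_l; lra). lra. }
  rewrite (coef_phase mu e) by now apply (edge_sign_or mu). fold F.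
  change (RInt (fun s => cos (e * (INR k * s - INR n * theta mu s))) 0 PI)
    with (RInt (fun s => cos (F s)) 0 PI).
  rewrite <- (RInt_Chasles (V := R_CompleteNormedModule) _ 0 (T / w) PI) by (apply ex_RInt_cont, CcF).
  plusR.
  assert (Sc : RInt (fun s => cos (F s)) 0 (T / w) = RInt (fun t => cos (F (t / w))) 0 T / w).
  { assert (E := RInt_scale (fun t => cos (F (t / w))) w 0 (T / w) ltac:(lra)).
    cbv beta in E. rewrite Rmult_0_r in E. replace (w * (T / w)) with T in E by (field; lra).
    rewrite <- E.
    - apply RInt_ext. intros s _. do 2 f_equal. eqR. field. lra.
    - intros t. apply (continuous_comp (fun t => t / w) (fun s => cos (F s))); [cont_ad; lra|apply CcF]. }
  rewrite Sc.
  assert (Cmp : Rabs (RInt (fun t => cos (F (t / w))) 0 T - airy_partial x T)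
                <= (T - 0) * (eta * T + z * T ^ 3 / b)).
  { assert (E1 : ex_RInt (fun t => cos (F (t / w))) 0 T).
    { apply ex_RInt_cont. intros t. apply (continuous_comp (fun t => t / w) (fun s => cos (F s))); [cont_ad; lra|apply CcF]. }
    assert (E2 : ex_RInt (fun t => cos (airy_phase x t)) 0 T) by apply ex_RInt_cont, continuous_airy.
    change (RInt (fun t => cos (F (t / w))) 0 T - airy_partial x T)
      with (minus (RInt (fun t => cos (F (t / w))) 0 T) (RInt (fun t => cos (airy_phase x t)) 0 T)).
    rewrite <- (RInt_minus (V := R_CompleteNormedModule)) by assumption.
    apply abs_RInt_le_const; [lra|now apply (ex_RInt_minus (V := R_CompleteNormedModule))|].
    intros t Ht. eapply Rle_trans; [apply abs_cos_diff|]. now apply HFt. }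
  assert (AT := Ai_tail x T T ltac:(lra)).
  assert (AT' : Rabs (PI * Ai x - airy_partial x T) <= 2 / T).
  { apply AT. apply Rabs_le_between in Hx. lra. }
  clear AT.
  assert (E2T : 2 / T <= eps).
  { apply Rmult_le_reg_r with T; [lra|]. unfold Rdiv. rewrite Rmult_assoc, Rinv_l by lra.
    assert (eps * (2 / eps) = 2) by (field; lra). unfold T. nra. }
  assert (Cmp' : (T - 0) * (eta * T + z * T ^ 3 / b) <= eps / 2 + eps / 2).
  { replace ((T - 0) * (eta * T + z * T ^ 3 / b)) with (eta * T ^ 2 + z * T ^ 4 / b) by (field; lra).
    apply Rplus_le_compat; [lra|].
    apply Rmult_le_reg_r with b; [lra|]. unfold Rdiv at 1. rewrite Rmult_assoc, Rinv_l by lra. lra. }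
  set (J1 := RInt (fun t => cos (F (t / w))) 0 T) in *.
  set (J2 := RInt (fun s => cos (F s)) (T / w) PI) in *.
  assert (Tail' : Rabs (w * J2) <= eps).
  { rewrite Rabs_mult, (Rabs_pos_eq w) by lra. eapply Rle_trans; [|exact E2T].
    replace (2 / T) with (w * (2 / (w * T))) by (field; lra). apply Rmult_le_compat_l; lra. }
  replace (/ PI * (J1 / w + J2) * w - Ai x)
    with (/ PI * ((J1 - airy_partial x T) - (PI * Ai x - airy_partial x T) + w * J2)) by (field; lra).
  rewrite Rabs_mult, (Rabs_pos_eq (/ PI)) by (left; apply Rinv_0_lt_compat; lra).
  apply Rmult_le_reg_l with PI; [lra|]. rewrite <- Rmult_assoc, Rinv_r, Rmult_1_l by lra.
  apply Rle_trans with (3 * eps); [|apply Rmult_le_compat_r; lra].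
  eapply Rle_trans; [apply Rabs_triang|].
  assert (Rabs (J1 - airy_partial x T - (PI * Ai x - airy_partial x T)) <= eps + eps); [|lra].
  eapply Rle_trans; [apply Rabs_triang|]. rewrite Rabs_Ropp. lra.
Qed.

(** ** A saddle point off the unit circle *)

Lemma one_minus_cos_ge (s : R) : 0 <= s <= PI -> s ^ 2 / 18 <= 1 - cos s.
Proof.
  intros Hs. assert (P4 := PI_4).
  assert (S : forall x, 0 <= x -> x - x ^ 3 / 6 <= sin x).
  { intros x Hx.
    assert (T := deriv_le_le (fun x => x - x ^ 3 / 6) (fun x => 1 - x ^ 2 / 2) sin cos 0 x Hx
      ltac:(intros; auto_derive; auto; field) ltac:(intros; apply is_derive_sin)
      ltac:(intros y _; assert (T := one_minus_cos_le y); lra)).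
    cbv beta in T. rewrite sin_0 in T. lra. }
  replace (cos s) with (cos (2 * (s / 2))) by (f_equal; field). rewrite cos_2a_sin.
  specialize (S (s / 2) ltac:(lra)).
  assert (X : s / 6 <= sin (s / 2)).
  { eapply Rle_trans; [|exact S]. set (x := s / 2) in *.
    replace (s / 6) with (x / 3) by (unfold x; field).
    assert (x * (x * x) <= x * 4) by (unfold x in *; apply Rmult_le_compat_l; nra). simpl. lra. }
  nra.
Qed.

Lemma sin_sub_le (s : R) : 0 <= s -> Rabs (sin s - s) <= s ^ 3 / 6.
Proof.
  intros Hs.
  assert (T1 := deriv_le_le (fun x => x - x ^ 3 / 6) (fun x => 1 - x ^ 2 / 2) sin cos 0 s Hs
      ltac:(intros; auto_derive; auto; field) ltac:(intros; apply is_derive_sin)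
      ltac:(intros y _; assert (T := one_minus_cos_le y); lra)).
  assert (T2 := abs_sin_le s Hs). apply Rabs_le_between in T2.
  cbv beta in T1. rewrite sin_0 in T1.
  assert (0 <= s ^ 3) by now apply pow_le. apply Rabs_le. lra.
Qed.

Lemma prod_bound (x y X Y : R) : - X <= x <= X -> 0 <= y <= Y -> - (X * Y) <= x * y <= X * Y.
Proof.
  intros Hx Hy. assert (0 <= X) by lra.
  assert (X * y <= X * Y) by (apply Rmult_le_compat_l; lra). split; nra.
Qed.

Lemma prod_bound_sym (x y X Y : R) : - X <= x <= X -> - Y <= y <= Y -> - (X * Y) <= x * y <= X * Y.
Proof.
  intros Hx Hy. destruct (Rle_dec 0 y) as [H|H].
  - apply prod_bound; lra.
  - assert (T := prod_bound x (- y) X Y Hx ltac:(lra)). lra.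
Qed.

(** On the circle through a saddle point [exp rho] the derivative in [s] of the logarithm of the
    modulus is [- h sin s] times [d^2 / (den q1 s * den q2 s)], with [q1] and [q2] equal to
    [mu exp (+- rho)]; its bounds provide both conditions of Laplace's method. *)
Section TwoRadii.

Variables (Q q1 q2 : R).
Hypothesis (HQ : 0 < Q < 1) (Hq1 : Rabs q1 <= Q) (Hq2 : Rabs q2 <= Q).

Let d := (1 - q1) * (1 - q2).

Lemma radius_bounds (q s : R) : Rabs q <= Q ->
  -1 < q < 1 /\ 1 - Q <= 1 - q <= 2 /\ (1 - Q) ^ 2 <= den q s <= 4.
Proof.
  intros Hq. assert (Hq' := Hq). apply Rabs_le_between in Hq'.
  destruct (den_bounds q s ltac:(lra)) as [A B]. repeat split; try lra.
  eapply Rle_trans; [|exact A]. apply pow_incr. lra.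
Qed.

Lemma den_ratio_lower (s : R) : (1 - Q) ^ 4 / 16 <= d ^ 2 / (den q1 s * den q2 s).
Proof.
  destruct (radius_bounds q1 s Hq1) as (_ & A1 & B1). destruct (radius_bounds q2 s Hq2) as (_ & A2 & B2).
  assert (P : 0 < (1 - Q) ^ 2) by (apply pow_lt; lra).
  apply Rmult_le_compat.
  - apply pow_le; lra.
  - lra.
  - unfold d. replace ((1 - Q) ^ 4) with (((1 - Q) * (1 - Q)) ^ 2) by ring.
    apply pow_incr. split; [nra|]. apply Rmult_le_compat; lra.
  - apply Rinv_le_contravar; nra.
Qed.

Lemma den_ratio_close (s : R) :
  Rabs (d ^ 2 / (den q1 s * den q2 s) - 1) <= 12 / (1 - Q) ^ 4 * s ^ 2.
Proof.
  destruct (radius_bounds q1 s Hq1) as (_ & A1 & B1). destruct (radius_bounds q2 s Hq2) as (_ & A2 & B2).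
  assert (P : 0 < (1 - Q) ^ 2) by (apply pow_lt; lra).
  assert (P4 : (1 - Q) ^ 4 <= den q1 s * den q2 s).
  { replace ((1 - Q) ^ 4) with ((1 - Q) ^ 2 * (1 - Q) ^ 2) by ring. apply Rmult_le_compat; lra. }
  assert (P40 : 0 < (1 - Q) ^ 4) by (apply pow_lt; lra).
  assert (C := one_minus_cos_le s). assert (Cb := COS_bound s).
  assert (N : Rabs (d ^ 2 - den q1 s * den q2 s) <= 12 * s ^ 2).
  { set (y := 1 - cos s) in *.
    assert (E1 : den q1 s = (1 - q1) ^ 2 + 2 * q1 * y) by (unfold den, y; ring).
    assert (E2 : den q2 s = (1 - q2) ^ 2 + 2 * q2 * y) by (unfold den, y; ring).
    rewrite E1, E2.
    replace (d ^ 2 - ((1 - q1) ^ 2 + 2 * q1 * y) * ((1 - q2) ^ 2 + 2 * q2 * y))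
      with (- (2 * y * (q1 * (1 - q2) ^ 2 + q2 * (1 - q1) ^ 2 + 2 * (q1 * (q2 * y))))) by (unfold d; ring).
    assert (Hy : 0 <= y <= 2) by (unfold y in *; lra).
    assert (X1 := Hq1). assert (X2 := Hq2). apply Rabs_le_between in X1. apply Rabs_le_between in X2.
    assert (Y : forall q, -1 <= q <= 1 -> 0 <= (1 - q) ^ 2 <= 4) by (clear; intros; nra).
    assert (Y1 := Y q2 ltac:(lra)). assert (Y2 := Y q1 ltac:(lra)).
    assert (Z1 := prod_bound q1 ((1 - q2) ^ 2) 1 4 ltac:(lra) Y1).
    assert (Z2 := prod_bound q2 ((1 - q1) ^ 2) 1 4 ltac:(lra) Y2).
    assert (Z3 : -1 <= q1 * q2 <= 1) by (clear - X1 X2 HQ; split; nra).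
    assert (Z4 := prod_bound (q1 * q2) y 1 2 ltac:(lra) Hy).
    rewrite Rmult_assoc in Z4.
    assert (Z5 := prod_bound (q1 * (1 - q2) ^ 2 + q2 * (1 - q1) ^ 2 + 2 * (q1 * (q2 * y))) (2 * y)
      12 (s ^ 2) ltac:(lra) ltac:(lra)).
    rewrite Rabs_Ropp. apply Rabs_le.
    rewrite (Rmult_comm (2 * y)). lra. }
  replace (d ^ 2 / (den q1 s * den q2 s) - 1)
    with ((d ^ 2 - den q1 s * den q2 s) * / (den q1 s * den q2 s)) by (field; split; nra).
  rewrite Rabs_mult, (Rabs_pos_eq (/ _)) by (left; apply Rinv_0_lt_compat; lra).
  replace (12 / (1 - Q) ^ 4 * s ^ 2) with (12 * s ^ 2 * / (1 - Q) ^ 4) by (field; lra).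
  apply Rmult_le_compat; auto.
  - apply Rabs_pos.
  - left; apply Rinv_0_lt_compat; lra.
  - apply Rinv_le_contravar; lra.
Qed.

(** At a saddle point the velocity of the argument vanishes at [s = 0], and being
    even in [s] it is of order [s^2]. *)
Lemma velocity_close (q s : R) : Rabs q <= Q ->
  Rabs ((q * cos s - q ^ 2) / den q s - q / (1 - q)) <= s ^ 2 / (1 - Q) ^ 3.
Proof.
  intros Hq. destruct (radius_bounds q s Hq) as (A0 & A & B).
  assert (P : 0 < (1 - Q) ^ 2) by (apply pow_lt; lra).
  replace ((q * cos s - q ^ 2) / den q s - q / (1 - q))
    with (- ((1 - cos s) * (q * (1 + q))) * / ((1 - q) * den q s)).
  2:{ unfold den in *. field. split; lra. }
  assert (P3 : (1 - Q) ^ 3 <= (1 - q) * den q s).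
  { replace ((1 - Q) ^ 3) with ((1 - Q) * (1 - Q) ^ 2) by ring. apply Rmult_le_compat; lra. }
  assert (P30 : 0 < (1 - Q) ^ 3) by (apply pow_lt; lra).
  rewrite Rabs_mult, (Rabs_pos_eq (/ _)) by (left; apply Rinv_0_lt_compat; lra).
  apply Rmult_le_compat.
  - apply Rabs_pos.
  - left; apply Rinv_0_lt_compat; lra.
  - rewrite Rabs_Ropp, Rabs_mult. assert (C := one_minus_cos_le s).
    rewrite (Rabs_pos_eq (1 - cos s)) by lra.
    assert (Rabs (q * (1 + q)) <= 2) by (apply Rabs_le; split; nra).
    assert (T := Rabs_pos (q * (1 + q))). nra.
  - apply Rinv_le_contravar; lra.
Qed.

End TwoRadii.

Lemma logmod_odd (mu a e r : R) : e = 1 \/ e = -1 -> logmod mu a (e * r) 0 = e * logmod mu a r 0.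
Proof.
  intros [-> | ->]; [rewrite !Rmult_1_l; reflexivity|]. unfold logmod.
  replace (-1 * (-1 * r)) with (1 * r) by ring. replace (1 * (-1 * r)) with (-1 * r) by ring. ring.
Qed.

Lemma denh_even (mu e r : R) : e = 1 \/ e = -1 -> denh mu (e * r) = denh mu r.
Proof.
  intros [-> | ->]; [rewrite Rmult_1_l; reflexivity|]. unfold denh.
  replace (- (-1 * r)) with r by ring. replace (-1 * r) with (- r) by ring. ring.
Qed.

(** On the circle through the saddle point the modulus of the integrand has its
    maximum there, so that, unlike on the unit circle, no cancellation is needed
    away from the saddle. *)
Lemma coef_laplace (mu e : R) : edge_sign mu e -> forall eps, 0 < eps ->
  exists K r0, 0 < K /\ 0 < r0 /\
  forall (n k : nat) (r : R), 0 < r < r0 -> INR k = INR n * freqh mu r ->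
  K <= INR n * curvh mu e r ^ 3 ->
  Rabs (coef mu n k * exp (INR n * heighth mu e r) * sqrt (2 * PI * (INR n * curvh mu e r)) - 1) <= eps.
Proof.
  intros H eps Heps. destruct (edge_sign_facts mu e H) as (H1 & H2 & H3).
  assert (Hor := edge_sign_or mu e H).
  assert (PP := PI2_3_2). unfold PI2 in PP.
  destruct (radii_range mu H1) as (R0 & HR0 & HR).
  assert (Hm : Rabs mu < 1) by (apply Rabs_def1; lra). assert (Pm := Rabs_pos mu).
  set (Q := (1 + Rabs mu) / 2) in *. assert (HQ : 0 < Q < 1) by (unfold Q; lra).
  assert (Q4 : 0 < (1 - Q) ^ 4) by (apply pow_lt; lra).
  assert (Q3 : 0 < (1 - Q) ^ 3) by (apply pow_lt; lra).
  set (c := (1 - Q) ^ 4 / 16 / 18). assert (Hc : 0 < c) by (unfold c; lra).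
  destruct (laplace_method eps c Heps Hc) as (U & eta & HU & Heta & Main).
  destruct (edge_ratios_h mu e H 1 ltac:(lra)) as (r1 & Hr1 & Rat).
  assert (Hb := edge_curv_pos mu e H). set (b := edge_curv mu e) in *.
  set (C := 12 / (1 - Q) ^ 4 + 1).
  assert (HC : 0 < C) by (unfold C; assert (0 < 12 / (1 - Q) ^ 4) by (apply Rdiv_lt_0_compat; lra); lra).
  set (C2 := 2 / (1 - Q) ^ 3). assert (HC2 : 0 < C2) by (apply Rdiv_lt_0_compat; lra).
  assert (U2 : 0 < U ^ 2) by (apply pow_lt; lra).
  assert (U4 : 0 < C * U ^ 4 / eta) by (apply Rdiv_lt_0_compat; [apply Rmult_lt_0_compat; [|apply pow_lt]|]; lra).
  assert (U6 : 0 < C2 ^ 2 * U ^ 6 / eta ^ 2).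
  { apply Rdiv_lt_0_compat; [apply Rmult_lt_0_compat|]; apply pow_lt; lra. }
  set (K := 1 + U ^ 2 + C * U ^ 4 / eta + C2 ^ 2 * U ^ 6 / eta ^ 2).
  assert (H3b : 0 < / (3 * b)) by (apply Rinv_0_lt_compat; lra).
  exists K, (Rmin (Rmin R0 r1) (/ (3 * b))). split; [unfold K; lra|].
  split; [repeat apply Rmin_glb_lt; lra|].
  intros n k r Hr Hk HKn.
  assert (Hr' : r < R0 /\ r < r1 /\ r < / (3 * b)).
  { assert (A1 := Rmin_l (Rmin R0 r1) (/ (3 * b))). assert (A2 := Rmin_r (Rmin R0 r1) (/ (3 * b))).
    assert (A3 := Rmin_l R0 r1). assert (A4 := Rmin_r R0 r1). lra. }
  destruct (Rat r ltac:(lra)) as (Hh & HV & _ & Hh1 & _). clear Rat.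
  set (h := curvh mu e r) in *.
  assert (Hhle : h <= 1).
  { eapply Rle_trans; [exact Hh1|]. replace 1 with (3 * b * / (3 * b)) by (field; lra).
    apply Rmult_le_compat_l; lra. }
  assert (Hh3 : 0 < h ^ 3) by (apply pow_lt; lra).
  assert (HK0 : 0 < K) by (unfold K; lra).
  assert (Hn : 0 < INR n).
  { apply Rmult_lt_reg_r with (h ^ 3); lra. }
  assert (HnN : (0 < n)%nat) by (apply INR_lt; exact Hn).
  assert (Hnh : K <= INR n * h).
  { eapply Rle_trans; [exact HKn|]. apply Rmult_le_compat_l; [lra|].
    replace (h ^ 3) with (h * (h * h)) by ring. rewrite <- (Rmult_1_r h) at 4. apply Rmult_le_compat_l; [lra|]. clear - Hh Hhle. nra. }
  set (a := INR k / INR n).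
  assert (Ha : a = freqh mu r) by (unfold a; rewrite Hk; field; lra).
  set (rho := e * r).
  assert (Hrho : Rabs rho = r).
  { unfold rho. destruct Hor as [-> | ->].
    - rewrite Rmult_1_l. apply Rabs_pos_eq. lra.
    - rewrite Rabs_left1; lra. }
  assert (OK : forall t, 0 <= t <= 1 -> radii_ok mu (t * rho)).
  { intros t Ht. destruct (HR (t * rho)) as [A B].
    - rewrite Rabs_mult, Hrho, Rabs_pos_eq by lra. apply Rle_trans with (1 * r); [apply Rmult_le_compat_r; lra|lra].
    - now apply radii_range_ok. }
  assert (OKr : radii_ok mu rho) by (rewrite <- (Rmult_1_l rho); apply OK; lra).
  destruct (HR rho ltac:(lra)) as [Hq1 Hq2].
  set (q1 := mu * exp (-1 * rho)) in *. set (q2 := mu * exp (1 * rho)) in *.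
  assert (q12 : q1 * q2 = mu ^ 2).
  { unfold q1, q2. replace (mu * exp (-1 * rho) * (mu * exp (1 * rho)))
      with (mu ^ 2 * (exp (-1 * rho) * exp (1 * rho))) by ring.
    rewrite <- exp_plus. replace (-1 * rho + 1 * rho) with 0 by ring. rewrite exp_0. ring. }
  assert (D12 : denh mu r = (1 - q1) * (1 - q2)).
  { rewrite <- (denh_even mu e r Hor). apply denh_factor. }
  assert (h12 : h = (1 - mu ^ 2) * (q2 - q1) / ((1 - q1) * (1 - q2)) ^ 2).
  { unfold h, curvh. rewrite D12. f_equal. unfold q1, q2, rho.
    destruct Hor as [-> | ->].
    - replace (-1 * (1 * r)) with (- r) by ring. replace (1 * (1 * r)) with r by ring. ring.
    - replace (-1 * (-1 * r)) with r by ring. replace (1 * (-1 * r)) with (- r) by ring. ring. }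
  destruct (radius_bounds Q HQ q1 0 Hq1) as (Q1a & Q1b & _).
  destruct (radius_bounds Q HQ q2 0 Hq2) as (Q2a & Q2b & _).
  set (g0 := fun s => logmod mu a rho 0 - logmod mu a rho s).
  set (R := fun s => ((1 - q1) * (1 - q2)) ^ 2 / (den q1 s * den q2 s)).
  assert (Dg : forall s, is_derive g0 s (h * R s * sin s)).
  { intros s. unfold g0. evar_last.
    { apply (is_derive_minus (fun _ => logmod mu a rho 0) (logmod mu a rho)).
      - apply is_derive_const.
      - now apply is_derive_logmod. }
    unfold minus, plus, opp, zero; simpl. eqR. unfold R, dlog_im. fold q1. fold q2.
    assert (B1 := den_pos q1 s Q1a). assert (B2 := den_pos q2 s Q2a).
    rewrite h12, <- q12. unfold den in *. field. repeat split; lra. }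
  assert (Df : forall s, is_derive (argument mu a rho) s (dlog_re mu a rho s))
    by (intros; now apply is_derive_argument).
  assert (RL : forall s, (1 - Q) ^ 4 / 16 <= R s) by (intros; now apply den_ratio_lower).
  assert (RC : forall s, Rabs (R s - 1) <= 12 / (1 - Q) ^ 4 * s ^ 2) by (intros; now apply den_ratio_close).
  assert (g00 : g0 0 = 0) by (unfold g0; ring).
  assert (GL : forall s, 0 <= s <= PI -> c * h * s ^ 2 <= g0 s).
  { intros s Hs.
    assert (T := deriv_le_le (fun s => h * ((1 - Q) ^ 4 / 16) * (1 - cos s)) (fun s => h * ((1 - Q) ^ 4 / 16) * sin s)
      g0 (fun s => h * R s * sin s) 0 s ltac:(lra)
      ltac:(intros; auto_derive; auto; field) ltac:(intros; apply Dg)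
      ltac:(intros x Hx; assert (S := sin_ge_0 x ltac:(lra) ltac:(lra)); specialize (RL x);
            apply Rmult_le_compat_r; [lra|]; apply Rmult_le_compat_l; lra)).
    cbv beta in T. rewrite g00, cos_0 in T.
    assert (T2 := one_minus_cos_ge s Hs).
    assert (T3 : h * ((1 - Q) ^ 4 / 16) * (s ^ 2 / 18) <= h * ((1 - Q) ^ 4 / 16) * (1 - cos s)).
    { apply Rmult_le_compat_l; [|lra]. apply Rmult_le_pos; lra. }
    replace (c * h * s ^ 2) with (h * ((1 - Q) ^ 4 / 16) * (s ^ 2 / 18)) by (unfold c; field). lra. }
  assert (Gc : forall s, 0 <= s -> Rabs (h * R s * sin s - h * s) <= h * C * s ^ 3).
  { intros s Hs. replace (h * R s * sin s - h * s) with (h * ((R s - 1) * sin s + (sin s - s))) by ring.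
    rewrite Rabs_mult, (Rabs_pos_eq h), Rmult_assoc by lra. apply Rmult_le_compat_l; [lra|].
    eapply Rle_trans; [apply Rabs_triang|]. rewrite Rabs_mult.
    assert (T1 := sin_sub_le s Hs). assert (T2 := abs_sin_le s Hs). specialize (RC s).
    assert (s3 : 0 <= s ^ 3) by now apply pow_le.
    assert (Rabs (R s - 1) * Rabs (sin s) <= (12 / (1 - Q) ^ 4 * s ^ 2) * s).
    { apply Rmult_le_compat; auto; apply Rabs_pos. }
    unfold C. replace ((12 / (1 - Q) ^ 4 + 1) * s ^ 3) with (12 / (1 - Q) ^ 4 * s ^ 2 * s + s ^ 3) by ring. lra. }
  assert (G4 : forall s, 0 <= s -> Rabs (g0 s - h * s ^ 2 / 2) <= h * C * s ^ 4 / 4).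
  { intros s Hs. apply Rabs_le.
    assert (Poly : forall v x, is_derive (fun s => h * s ^ 2 / 2 + v * (h * C * s ^ 4 / 4)) x (h * x + v * (h * C * x ^ 3))).
    { intros v x. auto_derive; auto. field. }
    assert (T1 := deriv_le_le g0 (fun s => h * R s * sin s)
      (fun s => h * s ^ 2 / 2 + 1 * (h * C * s ^ 4 / 4)) (fun x => h * x + 1 * (h * C * x ^ 3)) 0 s Hs
      (fun x _ => Dg x) (fun x _ => Poly 1 x)
      ltac:(intros x Hx; assert (T := Gc x ltac:(lra)); apply Rabs_le_between in T; lra)).
    assert (T2 := deriv_le_le 
      (fun s => h * s ^ 2 / 2 + -1 * (h * C * s ^ 4 / 4)) (fun x => h * x + -1 * (h * C * x ^ 3))
      g0 (fun s => h * R s * sin s) 0 s Hs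
      (fun x _ => Poly (-1) x) (fun x _ => Dg x) 
      ltac:(intros x Hx; assert (T := Gc x ltac:(lra)); apply Rabs_le_between in T; lra)).
    cbv beta in T1, T2. rewrite g00 in T1, T2. lra. }
  assert (Fc : forall s, 0 <= s -> Rabs (argument mu a rho s) <= C2 * s ^ 3).
  { intros s Hs.
    assert (Z0 : dlog_re mu a rho 0 = 0).
    { rewrite dlog_re_0 by exact OKr. rewrite Ha. unfold freqh, rho. rewrite denh_even by exact Hor. ring. }
    assert (Z1 : forall q, -1 < q < 1 -> (q * cos 0 - q ^ 2) / den q 0 = q / (1 - q)).
    { intros q Hq. rewrite den_0, cos_0. field. lra. }
    assert (B : forall x, Rabs (dlog_re mu a rho x) <= C2 * x ^ 2).
    { intros x. rewrite <- (Rminus_0_r (dlog_re mu a rho x)), <- Z0. unfold dlog_re. fold q1. fold q2.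
      rewrite !Z1 by assumption.
      match goal with |- Rabs (?u + ?v + ?w - (?u + ?v' + ?w')) <= _ =>
        replace (u + v + w - (u + v' + w')) with ((v - v') + (w - w')) by ring end.
      assert (T1 := velocity_close Q HQ q1 x Hq1). assert (T2 := velocity_close Q HQ q2 x Hq2).
      eapply Rle_trans; [apply Rabs_triang|].
      unfold C2. replace (2 / (1 - Q) ^ 3 * x ^ 2) with (x ^ 2 / (1 - Q) ^ 3 + x ^ 2 / (1 - Q) ^ 3) by (field; lra).
      lra. }
    assert (Poly : forall v x, is_derive (fun s => v * (C2 * s ^ 3 / 3)) x (v * (C2 * x ^ 2))).
    { intros v x. auto_derive; auto. field. }
    assert (T1 := deriv_le_le (argument mu a rho) (dlog_re mu a rho)
      (fun s => 1 * (C2 * s ^ 3 / 3)) (fun x => 1 * (C2 * x ^ 2)) 0 s Hs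
      (fun x _ => Df x) (fun x _ => Poly 1 x)
      ltac:(intros x Hx; assert (T := B x); apply Rabs_le_between in T; lra)).
    assert (T2 := deriv_le_le (fun s => -1 * (C2 * s ^ 3 / 3)) (fun x => -1 * (C2 * x ^ 2))
      (argument mu a rho) (dlog_re mu a rho) 0 s Hs
      (fun x _ => Poly (-1) x) (fun x _ => Df x) 
      ltac:(intros x Hx; assert (T := B x); apply Rabs_le_between in T; lra)).
    cbv beta in T1, T2. rewrite argument_at_0 in T1, T2.
    assert (0 <= C2 * s ^ 3) by (apply Rmult_le_pos; [lra|now apply pow_le]). apply Rabs_le. lra. }
  assert (HN : 0 < INR n * h) by lra.
  destruct (sqrt_props (INR n * h) HN) as [Hq Hqq]. set (q := sqrt (INR n * h)) in *.
  specialize (Main (INR n * h) PI (fun s => INR n * argument mu a rho s) (fun s => INR n * g0 s) HN).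
  fold q in Main.
  assert (B : Rabs (RInt (fun s => exp (- (INR n * g0 s)) * cos (INR n * argument mu a rho s)) 0 PI
                    - sqrt (PI / 2) / q) <= eps / q).
  { apply Main; clear Main.
    - apply (le_of_pow_le 1); [apply Rmult_le_pos; lra|]. replace ((PI * q) ^ 2) with (PI ^ 2 * (q * q)) by ring.
      rewrite Hqq. assert (1 * 1 <= PI * PI) by (apply Rmult_le_compat; lra).
      assert (1 * (INR n * h) <= PI ^ 2 * (INR n * h)) by (apply Rmult_le_compat_r; [lra|simpl; lra]).
      unfold K in Hnh. lra.
    - intros s _. apply (continuous_scal_r (INR n) (argument mu a rho)).
      apply (ex_derive_continuous (argument mu a rho)). eexists; apply Df.
    - intros s _. apply (continuous_scal_r (INR n) g0).
      apply (ex_derive_continuous g0). eexists; apply Dg.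
    - intros s Hs Hsq.
      assert (Hs4 : (s * q) ^ 4 <= U ^ 4) by (apply pow_incr; split; [apply Rmult_le_pos; lra|exact Hsq]).
      assert (Hs6 : (s * q) ^ 6 <= U ^ 6) by (apply pow_incr; split; [apply Rmult_le_pos; lra|exact Hsq]).
      replace ((s * q) ^ 4) with (s ^ 4 * (q * q) ^ 2) in Hs4 by ring. rewrite Hqq in Hs4.
      replace ((s * q) ^ 6) with (s ^ 6 * (q * q) ^ 3) in Hs6 by ring. rewrite Hqq in Hs6.
      split.
      + replace (INR n * g0 s - INR n * h * s ^ 2 / 2) with (INR n * (g0 s - h * s ^ 2 / 2)) by field.
        rewrite Rabs_mult, (Rabs_pos_eq (INR n)) by lra.
        apply Rle_trans with (INR n * (h * C * s ^ 4 / 4)).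
        { apply Rmult_le_compat_l; [lra|]. apply G4; lra. }
        set (N := INR n * h) in *.
        replace (INR n * (h * C * s ^ 4 / 4)) with (C * (N * s ^ 4) / 4) by (unfold N; field).
        assert (X : C * U ^ 4 <= eta * N).
        { replace (C * U ^ 4) with (eta * (C * U ^ 4 / eta)) by (field; lra).
          apply Rmult_le_compat_l; [lra|]. unfold K in Hnh. lra. }
        assert (X2 : C * (N * s ^ 4) <= eta).
        { apply Rmult_le_reg_r with N; [lra|].
          apply Rle_trans with (C * U ^ 4); [|lra].
          replace (C * (N * s ^ 4) * N) with (C * (s ^ 4 * N ^ 2)) by ring. apply Rmult_le_compat_l; lra. }
        lra.
      + rewrite Rabs_mult, (Rabs_pos_eq (INR n)) by lra.
        apply Rle_trans with (INR n * (C2 * s ^ 3)).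
        { apply Rmult_le_compat_l; [lra|]. apply Fc; lra. }
        apply (le_of_pow_le 1); [lra|].
        assert (X : C2 ^ 2 * U ^ 6 <= eta ^ 2 * (INR n * h ^ 3)).
        { assert (0 < eta ^ 2) by (apply pow_lt; lra).
          replace (C2 ^ 2 * U ^ 6) with (eta ^ 2 * (C2 ^ 2 * U ^ 6 / eta ^ 2)) by (field; lra).
          apply Rmult_le_compat_l; [lra|]. unfold K in HKn. lra. }
        assert (c22 : 0 < C2 ^ 2) by (apply pow_lt; lra).
        apply Rmult_le_reg_r with (INR n * h ^ 3); [apply Rmult_lt_0_compat; lra|].
        eapply Rle_trans; [|exact X].
        replace ((INR n * (C2 * s ^ 3)) ^ 2 * (INR n * h ^ 3)) with (C2 ^ 2 * (s ^ 6 * (INR n * h) ^ 3)) by ring.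
        apply Rmult_le_compat_l; lra.
    - intros s Hs. replace (c * (INR n * h) * s ^ 2) with (INR n * (c * h * s ^ 2)) by ring.
      apply Rmult_le_compat_l; [lra|]. now apply GL. }
  clear Main.
  rewrite (circle_shift mu n k rho HnN H1 OK). fold a.
  assert (E : RInt (circle_integrand mu a (INR n) rho) 0 PI
     = exp (- (INR n * heighth mu e r)) *
       RInt (fun s => exp (- (INR n * g0 s)) * cos (INR n * argument mu a rho s)) 0 PI).
  { rewrite <- (RInt_scal (V := R_CompleteNormedModule)
       (fun s => exp (- (INR n * g0 s)) * cos (INR n * argument mu a rho s))).
    2:{ apply ex_RInt_cont. intros s.
        apply (continuous_mult (fun s => exp (- (INR n * g0 s))) (fun s => cos (INR n * argument mu a rho s))).
        - apply (continuous_comp (fun s => - (INR n * g0 s)) exp); [|apply continuous_exp].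
          apply (continuous_opp (fun s => INR n * g0 s)).
          apply (continuous_scal_r (INR n) g0). apply (ex_derive_continuous g0). eexists; apply Dg.
        - apply (continuous_comp (fun s => INR n * argument mu a rho s) cos); [|apply continuous_cos].
          apply (continuous_scal_r (INR n) (argument mu a rho)).
          apply (ex_derive_continuous (argument mu a rho)). eexists; apply Df. }
    apply RInt_ext. intros s _. scalR. rewrite <- Rmult_assoc, <- exp_plus.
    unfold circle_integrand. f_equal. f_equal. eqR.
    unfold g0, heighth. rewrite <- Ha. unfold rho at 2. rewrite logmod_odd by exact Hor. ring. }
  rewrite E.
  set (J := RInt (fun s => exp (- (INR n * g0 s)) * cos (INR n * argument mu a rho s)) 0 PI) in *.
  assert (E2 : exp (- (INR n * heighth mu e r)) * exp (INR n * heighth mu e r) = 1)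
    by (rewrite <- exp_plus, Rplus_opp_l; apply exp_0).
  rewrite sqrt_mult by lra. fold q.
  assert (SPI : sqrt (2 * PI) * sqrt (PI / 2) = PI).
  { rewrite <- sqrt_mult by lra. replace (2 * PI * (PI / 2)) with (PI ^ 2) by field. apply sqrt_pow2; lra. }
  assert (S2P : 0 <= sqrt (2 * PI) <= PI).
  { split; [apply sqrt_pos|]. apply sqrt_le_of_sq; [lra|]. replace (PI ^ 2) with (PI * PI) by ring. apply Rmult_le_compat_r; lra. }
  set (s2p := sqrt (2 * PI)) in *. set (sp2 := sqrt (PI / 2)) in *.
  replace (/ PI * (exp (- (INR n * heighth mu e r)) * J) * exp (INR n * heighth mu e r) * (s2p * q) - 1)
    with (/ PI * s2p * q * (J - sp2 / q)).
  2:{ replace (/ PI * (exp (- (INR n * heighth mu e r)) * J) * exp (INR n * heighth mu e r) * (s2p * q))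
        with ((exp (- (INR n * heighth mu e r)) * exp (INR n * heighth mu e r)) * (/ PI * s2p * q * J)) by ring.
      rewrite E2. replace (/ PI * s2p * q * (J - sp2 / q)) with (/ PI * s2p * q * J - / PI * (s2p * sp2)) by (field; lra).
      rewrite SPI. field. lra. }
  rewrite Rabs_mult.
  assert (Hf : 0 <= / PI * s2p * q).
  { apply Rmult_le_pos; [apply Rmult_le_pos|]; try lra. left; apply Rinv_0_lt_compat; lra. }
  rewrite (Rabs_pos_eq _ Hf).
  apply Rle_trans with (/ PI * s2p * q * (eps / q)); [now apply Rmult_le_compat_l|].
  replace (/ PI * s2p * q * (eps / q)) with (/ PI * s2p * eps) by (field; lra).
  assert (/ PI * s2p <= 1).
  { apply Rmult_le_reg_l with PI; [lra|]. rewrite <- Rmult_assoc, Rinv_r by lra. lra. }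
  rewrite <- (Rmult_1_l eps) at 2. apply Rmult_le_compat_r; lra.
Qed.

(** * Airy asymptotics near an edge *)

(** Fractional powers are compared through an integral power that clears the
    exponents. *)
Lemma near_one_of_pow (t eta : R) (k : nat) : 0 < t -> Rabs (t ^ S k - 1) <= eta ->
  Rabs (t - 1) <= eta.
Proof.
  intros Ht H. apply Rabs_le_between in H. apply Rabs_le.
  destruct (Rle_dec 1 t) as [H1|H1].
  - assert (1 <= t ^ k) by now apply pow_R1_Rle.
    simpl in H. nra.
  - assert (t ^ k <= 1).
    { rewrite <- (pow1 k). apply pow_incr. lra. }
    assert (0 <= t ^ k) by (apply pow_le; lra). simpl in H. nra.
Qed.

Lemma quotient_close (A B C d : R) : 0 < d <= 1 / 20 -> Rabs (A - 1) <= d -> Rabs (B - 1) <= d ->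
  Rabs (C - 1) <= d -> Rabs (A * C / B - 1) <= 4 * d.
Proof.
  intros Hd HA HB HC. apply Rabs_le_between in HA. apply Rabs_le_between in HB.
  apply Rabs_le_between in HC.
  replace (A * C / B - 1) with ((A * C - B) * / B) by (field; lra).
  assert (HBi : 0 < / B <= / (19 / 20)) by (split; [apply Rinv_0_lt_compat|apply Rinv_le_contravar]; lra).
  rewrite Rabs_mult, (Rabs_pos_eq (/ B)) by lra.
  assert (Rabs (A * C - B) <= 3 * d + d / 20) by (apply Rabs_le; split; nra).
  assert (T := Rabs_pos (A * C - B)).
  apply Rle_trans with ((3 * d + d / 20) * / (19 / 20)); [apply Rmult_le_compat; lra|]. lra.
Qed.

(** Homogeneity: [w ^ 3 = n b], [y ^ 3 = 3 / 2 n V] turn the dimensionless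
    quotients of the saddle point into amplitude and argument of the Airy function. *)
Lemma amplitude_close (n b H V w y eta : R) : 0 < n -> 0 < b -> 0 < H -> 0 < V -> 0 < w -> 0 < y ->
  w ^ 3 = n * b -> y ^ 3 = 3 / 2 * (n * V) ->
  Rabs (12 * b ^ 2 * V / H ^ 3 - 1) <= eta ->
  Rabs (sqrt 2 * (w * sqrt y) / sqrt (n * H) - 1) <= eta.
Proof.
  intros Hn Hb HH HV Hw Hy Ew Ey Hr.
  assert (HnH : 0 < n * H) by nra.
  destruct (sqrt_props (n * H) HnH) as [Hq Hqq]. destruct (sqrt_props y Hy) as [Hs Hss].
  destruct (sqrt_props 2 ltac:(lra)) as [H2 H22].
  set (q := sqrt (n * H)) in *. set (s := sqrt y) in *. set (t := sqrt 2) in *.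
  apply (near_one_of_pow _ _ 5).
  - apply Rdiv_lt_0_compat; [|lra]. apply Rmult_lt_0_compat; nra.
  - replace ((t * (w * s) / q) ^ 6) with ((t * t) ^ 3 * (w ^ 3) ^ 2 * (s * s) ^ 3 / (q * q) ^ 3)
      by (field; lra).
    rewrite H22, Hss, Hqq, Ew, Ey.
    replace (2 ^ 3 * (n * b) ^ 2 * (3 / 2 * (n * V)) / (n * H) ^ 3) with (12 * b ^ 2 * V / H ^ 3)
      by (field; split; lra).
    exact Hr.
Qed.

Lemma argument_close (n b D V w y eta : R) : 0 < n -> 0 < b -> 0 < D -> 0 < V -> 0 < w -> 0 < y ->
  w ^ 3 = n * b -> y ^ 3 = 3 / 2 * (n * V) ->
  Rabs (4 / 9 * D ^ 3 / (b * V ^ 2) - 1) <= eta ->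
  Rabs (n * D / w - y ^ 2) <= eta * y ^ 2.
Proof.
  intros Hn Hb HD HV Hw Hy Ew Ey Hr.
  assert (y2 : 0 < y ^ 2) by (apply pow_lt; lra).
  replace (n * D / w - y ^ 2) with ((n * D / (w * y ^ 2) - 1) * y ^ 2) by (field; lra).
  rewrite Rabs_mult, (Rabs_pos_eq (y ^ 2)) by lra. apply Rmult_le_compat_r; [lra|].
  apply (near_one_of_pow _ _ 2).
  - apply Rdiv_lt_0_compat; nra.
  - replace ((n * D / (w * y ^ 2)) ^ 3) with (n ^ 3 * D ^ 3 / (w ^ 3 * (y ^ 3) ^ 2)) by (field; lra).
    rewrite Ew, Ey.
    replace (n ^ 3 * D ^ 3 / (n * b * (3 / 2 * (n * V)) ^ 2)) with (4 / 9 * D ^ 3 / (b * V ^ 2))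
      by (field; repeat split; lra).
    exact Hr.
Qed.

Lemma curvature_lower (n b H V y eta : R) : 0 < n -> 0 < b -> 0 < H -> 0 < V ->
  y ^ 3 = 3 / 2 * (n * V) -> eta <= 1 -> Rabs (12 * b ^ 2 * V / H ^ 3 - 1) <= eta ->
  4 * b ^ 2 * y ^ 3 <= n * H ^ 3.
Proof.
  intros Hn Hb HH HV Ey Heta Hr. apply Rabs_le_between in Hr.
  assert (H3 : 0 < H ^ 3) by (apply pow_lt; lra).
  assert (X : 12 * b ^ 2 * V <= 2 * H ^ 3).
  { replace (12 * b ^ 2 * V) with (12 * b ^ 2 * V / H ^ 3 * H ^ 3) by (field; lra).
    apply Rmult_le_compat_r; lra. }
  rewrite Ey. replace (4 * b ^ 2 * (3 / 2 * (n * V))) with (n * (12 * b ^ 2 * V / 2)) by field.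
  apply Rmult_le_compat_l; lra.
Qed.

Lemma pow3_ge (y K : R) : 1 + K <= y -> 0 <= K -> K <= y ^ 3.
Proof. intros H HK. assert (y * 1 <= y * (y * y)) by (apply Rmult_le_compat_l; nra). simpl. lra. Qed.

Lemma pos_of_cube (n b w : R) : 0 < w -> 0 < b -> w ^ 3 = n * b -> 0 < n.
Proof.
  intros Hw Hb E. assert (0 < w ^ 3) by (apply pow_lt; lra).
  apply Rmult_lt_reg_r with b; [lra|]. lra.
Qed.

(** Above a threshold [Y0] for [y], the Laplace formula of the coefficient and
    the asymptotics of [Ai] have the same exponential factor, and only the
    amplitudes have to be compared.  Below [Y0], [Ai] is bounded away from 0, so
    that an absolute error suffices. *)
Lemma edge_outer (mu e : R) : edge_sign mu e -> forall eps, 0 < eps ->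
  exists r0 w0, 0 < r0 /\ 0 < w0 /\ forall (n k : nat) (w r y : R),
  w0 <= w -> w ^ 3 = INR n * edge_curv mu e -> 0 < r < r0 -> INR k = INR n * freqh mu r ->
  0 < y -> y ^ 3 = 3 / 2 * (INR n * heighth mu e r) ->
  Rabs (coef mu n k * w / Ai (y ^ 2) - 1) <= eps.
Proof.
  intros H eps Heps. destruct (edge_sign_facts mu e H) as (H1 & H2 & _).
  assert (PP := PI2_3_2). unfold PI2 in PP.
  assert (Hb := edge_curv_pos mu e H). set (b := edge_curv mu e) in *.
  set (d := Rmin (1 / 20) (eps / 4)).
  assert (Hd : 0 < d <= 1 / 20 /\ 4 * d <= eps).
  { assert (A := Rmin_l (1 / 20) (eps / 4)). assert (B := Rmin_r (1 / 20) (eps / 4)).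
    unfold d. repeat split; try lra. apply Rmin_glb_lt; lra. }
  destruct (Ai_pos_asymptotic d ltac:(lra)) as (Y1 & HY1 & HAi).
  destruct (coef_laplace mu e H d ltac:(lra)) as (K & rL & HK & HrL & Lap).
  assert (b2 : 0 < b ^ 2) by (apply pow_lt; lra).
  assert (HKb : 0 < K / (4 * b ^ 2)) by (apply Rdiv_lt_0_compat; lra).
  set (Y0 := Y1 + (1 + K / (4 * b ^ 2))).
  destruct (Ai_bounded_below Y0 ltac:(unfold Y0; lra)) as (m & Hm & Hmin).
  destruct (coef_bounded_range mu e H (Y0 ^ 2) (m * eps)) as (eta & w0 & Heta & Hw0 & Bd).
  { apply pow_lt. unfold Y0; lra. } { nra. }
  assert (Y02 : 0 < Y0 ^ 2) by (apply pow_lt; unfold Y0; lra).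
  assert (HeY : 0 < eta / Y0 ^ 2) by (apply Rdiv_lt_0_compat; lra).
  destruct (edge_ratios_h mu e H (Rmin d (eta / Y0 ^ 2)) ltac:(apply Rmin_glb_lt; lra)) as (r1 & Hr1 & Rat).
  assert (Md := Rmin_l d (eta / Y0 ^ 2)). assert (Me := Rmin_r d (eta / Y0 ^ 2)).
  set (z := Rmin d (eta / Y0 ^ 2)) in *.
  exists (Rmin rL r1), w0. split; [apply Rmin_glb_lt; lra|]. split; [exact Hw0|].
  intros n k w r y Hw Hw3 Hr Hk Hy Hy3.
  assert (Rl := Rmin_l rL r1). assert (Rr := Rmin_r rL r1).
  destruct (Rat r ltac:(lra)) as (Hh & HV & HD & _ & R1 & R2).
  assert (Hn := pos_of_cube _ _ w ltac:(lra) Hb Hw3).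
  assert (PAi := Ai_pos y ltac:(lra)).
  destruct (Rle_dec Y0 y) as [HyY|HyY].
  - specialize (HAi y ltac:(unfold Y0 in HyY; lra)).
    assert (CL := curvature_lower (INR n) b (curvh mu e r) (heighth mu e r) y z Hn Hb Hh HV Hy3 ltac:(lra) R1).
    assert (Kn : K <= INR n * curvh mu e r ^ 3).
    { eapply Rle_trans; [|exact CL].
      assert (T := pow3_ge y (K / (4 * b ^ 2)) ltac:(unfold Y0 in HyY; lra) ltac:(lra)).
      replace K with (4 * b ^ 2 * (K / (4 * b ^ 2))) by (field; lra). apply Rmult_le_compat_l; lra. }
    specialize (Lap n k r ltac:(lra) Hk Kn).
    assert (Am := amplitude_close (INR n) b (curvh mu e r) (heighth mu e r) w y z Hn Hb Hh HV
       ltac:(lra) Hy Hw3 Hy3 R1).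
    replace (2 / 3 * y ^ 3) with (INR n * heighth mu e r) in HAi by (rewrite Hy3; field).
    assert (HnH : 0 < INR n * curvh mu e r) by now apply Rmult_lt_0_compat.
    rewrite sqrt_mult in Lap by lra. rewrite (sqrt_mult 2 PI) in Lap by lra.
    destruct (sqrt_props (INR n * curvh mu e r) HnH) as [Hq _].
    destruct (sqrt_props y Hy) as [Hs _]. destruct (sqrt_props 2 ltac:(lra)) as [Ht Htt].
    destruct (sqrt_props PI ltac:(lra)) as [Hp _].
    assert (E0 := exp_pos (INR n * heighth mu e r)).
    set (E := exp (INR n * heighth mu e r)) in *. set (q := sqrt (INR n * curvh mu e r)) in *.
    set (s := sqrt y) in *. set (t := sqrt 2) in *. set (p := sqrt PI) in *.
    assert (QC := quotient_close _ _ _ d ltac:(lra) Lap HAi ltac:(eapply Rle_trans; [exact Am|lra])).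
    replace (coef mu n k * E * (t * p * q) * (t * (w * s) / q) / (Ai (y ^ 2) * E * (2 * p * s)))
      with (coef mu n k * w / Ai (y ^ 2)) in QC.
    + lra.
    + transitivity (coef mu n k * w / Ai (y ^ 2) * (t * t / 2)); [rewrite Htt; field; lra|].
      field. repeat split; lra.
  - specialize (Hmin y ltac:(lra)).
    assert (AC := argument_close (INR n) b (gaph mu e r) (heighth mu e r) w y z Hn Hb HD HV
       ltac:(lra) Hy Hw3 Hy3 R2).
    assert (y2 : 0 < y ^ 2 <= Y0 ^ 2) by (split; [apply pow_lt; lra|apply pow_incr; lra]).
    specialize (Bd n k w (y ^ 2) Hw Hw3).
    replace (e * (INR k - INR n * edge mu)) with (INR n * gaph mu e r) in Bd
      by (rewrite Hk; unfold gaph; ring).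
    assert (B : Rabs (coef mu n k * w - Ai (y ^ 2)) <= m * eps).
    { apply Bd; [rewrite Rabs_pos_eq; lra|].
      eapply Rle_trans; [exact AC|].
      apply Rle_trans with (eta / Y0 ^ 2 * Y0 ^ 2); [|right; field; lra].
      apply Rmult_le_compat; try lra. unfold z. apply Rmin_glb; lra. }
    replace (coef mu n k * w / Ai (y ^ 2) - 1) with ((coef mu n k * w - Ai (y ^ 2)) * / Ai (y ^ 2)) by (field; lra).
    rewrite Rabs_mult, (Rabs_pos_eq (/ _)) by (left; apply Rinv_0_lt_compat; lra).
    apply Rmult_le_reg_r with (Ai (y ^ 2)); [lra|]. rewrite Rmult_assoc, Rinv_l, Rmult_1_r by lra.
    apply Rle_trans with (m * eps); [exact B|]. rewrite Rmult_comm. apply Rmult_le_compat_l; lra.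
Qed.

Lemma edge_exact (mu e : R) : edge_sign mu e -> forall eps, 0 < eps ->
  exists w0, 0 < w0 /\ forall (n k : nat) (w : R),
  w0 <= w -> w ^ 3 = INR n * edge_curv mu e -> INR k = INR n * edge mu ->
  Rabs (coef mu n k * w / Ai 0 - 1) <= eps.
Proof.
  intros H eps Heps.
  assert (PAi := Ai_pos 0 ltac:(lra)). replace (0 ^ 2) with 0 in PAi by ring.
  destruct (coef_bounded_range mu e H 1 (Ai 0 * eps)) as (eta & w0 & Heta & Hw0 & Bd); [lra|nra|].
  exists w0. split; [exact Hw0|]. intros n k w Hw Hw3 Hk.
  assert (B : Rabs (coef mu n k * w - Ai 0) <= Ai 0 * eps).
  { apply Bd; auto.
    - rewrite Rabs_R0. lra.
    - rewrite Hk. replace (e * (INR n * edge mu - INR n * edge mu) / w - 0) with 0 by (field; lra).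
      rewrite Rabs_R0. lra. }
  replace (coef mu n k * w / Ai 0 - 1) with ((coef mu n k * w - Ai 0) * / Ai 0) by (field; lra).
  rewrite Rabs_mult, (Rabs_pos_eq (/ _)) by (left; apply Rinv_0_lt_compat; lra).
  apply Rmult_le_reg_r with (Ai 0); [lra|]. rewrite Rmult_assoc, Rinv_l by lra. nra.
Qed.

(** The same splitting at [Y0]; here both asymptotic formulas contain the same
    cosine, and the error is measured on the scale of its amplitude. *)
Lemma edge_inner (mu e : R) : edge_sign mu e -> forall eps, 0 < eps ->
  exists r0 w0, 0 < r0 /\ 0 < w0 /\ forall (n k : nat) (w p y : R),
  w0 <= w -> w ^ 3 = INR n * edge_curv mu e -> 0 < p < r0 -> INR k = INR n * freq mu p ->
  0 < y -> y ^ 3 = 3 / 2 * (INR n * height mu e p) ->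
  Rabs (coef mu n k * w - Ai (- y ^ 2)) * sqrt (1 + y) <= eps.
Proof.
  intros H eps Heps. destruct (edge_sign_facts mu e H) as (H1 & H2 & H3).
  assert (PP := PI2_3_2). unfold PI2 in PP.
  assert (Hb := edge_curv_pos mu e H). set (b := edge_curv mu e) in *.
  set (d := Rmin 1 (eps / 8)).
  assert (Hd : 0 < d <= 1 /\ 8 * d <= eps).
  { assert (A := Rmin_l 1 (eps / 8)). assert (B := Rmin_r 1 (eps / 8)).
    unfold d. repeat split; try lra. apply Rmin_glb_lt; lra. }
  destruct (Ai_neg_asymptotic d ltac:(lra)) as (Y1 & HY1 & HAi).
  destruct (coef_stationary mu e H d ltac:(lra)) as (K & HK & Sta).
  assert (b2 : 0 < b ^ 2) by (apply pow_lt; lra).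
  assert (Hm : Rabs mu < 1) by (apply Rabs_def1; lra).
  set (c := (1 - Rabs mu) ^ 4 / 2).
  assert (Hc : 0 < c) by (unfold c; assert (0 < (1 - Rabs mu) ^ 4) by (apply pow_lt; lra); lra).
  assert (c3 : 0 < c ^ 3) by (apply pow_lt; lra).
  assert (HKb : 0 < K / (4 * b ^ 2 * c ^ 3)) by (apply Rdiv_lt_0_compat; [|apply Rmult_lt_0_compat]; lra).
  set (Y0 := Y1 + (1 + K / (4 * b ^ 2 * c ^ 3))).
  assert (HY0 : 1 <= Y0) by (unfold Y0; lra).
  assert (He1 : 0 < eps / (1 + Y0)) by (apply Rdiv_lt_0_compat; lra).
  destruct (coef_bounded_range mu e H (Y0 ^ 2) (eps / (1 + Y0))) as (eta & w0 & Heta & Hw0 & Bd);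
    [apply pow_lt; lra|lra|].
  assert (Y02 : 0 < Y0 ^ 2) by (apply pow_lt; unfold Y0; lra).
  assert (HeY : 0 < eta / Y0 ^ 2) by (apply Rdiv_lt_0_compat; lra).
  destruct (edge_ratios mu e H (Rmin d (eta / Y0 ^ 2)) ltac:(apply Rmin_glb_lt; lra)) as (r1 & Hr1 & Rat).
  assert (Md := Rmin_l d (eta / Y0 ^ 2)). assert (Me := Rmin_r d (eta / Y0 ^ 2)).
  set (z := Rmin d (eta / Y0 ^ 2)) in *.
  exists (Rmin 1 r1), w0. split; [apply Rmin_glb_lt; lra|]. split; [exact Hw0|].
  intros n k w p y Hw Hw3 Hr Hk Hy Hy3.
  assert (Rl := Rmin_l 1 r1). assert (Rr := Rmin_r 1 r1).
  destruct (Rat p ltac:(lra)) as (Hh & HV & HD & _ & R1 & R2).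
  assert (Hn := pos_of_cube _ _ w ltac:(lra) Hb Hw3).
  destruct (Rle_dec Y0 y) as [HyY|HyY].
  - specialize (HAi y ltac:(unfold Y0 in HyY; lra)).
    assert (CL := curvature_lower (INR n) b (curv mu e p) (height mu e p) y z Hn Hb Hh HV Hy3 ltac:(lra) R1).
    assert (Sp : 0 < sin p) by (apply sin_gt_0; lra).
    assert (Hcs : c * curv mu e p <= sin p).
    { destruct (den_bounds mu p H1) as [B _]. assert (B0 := den_pos mu p H1).
      assert (B2 : (1 - Rabs mu) ^ 4 <= den mu p ^ 2).
      { replace ((1 - Rabs mu) ^ 4) with (((1 - Rabs mu) ^ 2) ^ 2) by ring.
        apply pow_incr. split; [apply pow_le; lra|exact B]. }
      unfold curv, c.
      replace ((1 - Rabs mu) ^ 4 / 2 * (e * (1 - mu ^ 2) * (2 * mu * sin p) / den mu p ^ 2))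
        with ((1 - Rabs mu) ^ 4 / den mu p ^ 2 * ((e * mu) * (1 - mu ^ 2)) * sin p) by (field; lra).
      assert (e * mu <= 1) by (destruct H as [[-> ?]|[-> ?]]; lra).
      assert (0 <= 1 - mu ^ 2 <= 1) by (clear - H1; nra).
      assert ((1 - Rabs mu) ^ 4 / den mu p ^ 2 <= 1).
      { apply Rmult_le_reg_r with (den mu p ^ 2); [apply pow_lt; lra|]. unfold Rdiv.
        rewrite Rmult_assoc, Rinv_l by (apply pow_nonzero; lra). lra. }
      assert (0 <= (1 - Rabs mu) ^ 4 / den mu p ^ 2).
      { apply Rmult_le_pos; [apply pow_le; lra|left; apply Rinv_0_lt_compat, pow_lt; lra]. }
      assert (0 <= (e * mu) * (1 - mu ^ 2)) by (apply Rmult_le_pos; lra).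
      assert (X := prod_bound (e * mu) (1 - mu ^ 2) 1 1 ltac:(lra) ltac:(lra)).
      apply Rle_trans with (1 * sin p); [|lra]. apply Rmult_le_compat_r; [lra|].
      rewrite <- (Rmult_1_r 1). apply Rmult_le_compat; lra. }
    assert (Kn : K <= INR n * sin p ^ 3).
    { assert (T := pow3_ge y (K / (4 * b ^ 2 * c ^ 3)) ltac:(unfold Y0 in HyY; lra) ltac:(lra)).
      apply Rle_trans with (c ^ 3 * (4 * b ^ 2 * y ^ 3)).
      - replace K with (c ^ 3 * (4 * b ^ 2 * (K / (4 * b ^ 2 * c ^ 3)))) by (field; lra).
        apply Rmult_le_compat_l; [lra|]. apply Rmult_le_compat_l; lra.
      - apply Rle_trans with (c ^ 3 * (INR n * curv mu e p ^ 3)); [apply Rmult_le_compat_l; lra|].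
        replace (c ^ 3 * (INR n * curv mu e p ^ 3)) with (INR n * (c * curv mu e p) ^ 3) by ring.
        apply Rmult_le_compat_l; [lra|]. apply pow_incr. split; [apply Rmult_le_pos; lra|exact Hcs]. }
    specialize (Sta n k p ltac:(lra) Hk Kn).
    assert (Am := amplitude_close (INR n) b (curv mu e p) (height mu e p) w y z Hn Hb Hh HV
       ltac:(lra) Hy Hw3 Hy3 R1).
    replace (2 / 3 * y ^ 3) with (INR n * height mu e p) in HAi by (rewrite Hy3; field).
    destruct (sqrt_props (INR n * curv mu e p) (Rmult_lt_0_compat _ _ Hn Hh)) as [Hq _].
    destruct (sqrt_props y Hy) as [Hs Hss]. destruct (sqrt_props 2 ltac:(lra)) as [Ht Htt].
    destruct (sqrt_props PI ltac:(lra)) as [Hp _].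
    rewrite sqrt_div_alt in Sta by lra.
    assert (Hp1 : 1 <= sqrt PI) by (rewrite <- sqrt_1 at 1; apply sqrt_le_1; lra).
    assert (Ht1 : 1 <= sqrt 2) by (rewrite <- sqrt_1 at 1; apply sqrt_le_1; lra).
    assert (CB := COS_bound (INR n * height mu e p - PI / 4)).
    set (cc := cos (INR n * height mu e p - PI / 4)) in *.
    set (q := sqrt (INR n * curv mu e p)) in *.
    set (s := sqrt y) in *. set (t := sqrt 2) in *. set (P := sqrt PI) in *.
    set (C := coef mu n k) in *. set (A := Ai (- y ^ 2)) in *.
    set (R := t * (w * s) / q) in *.
    assert (S1 : Rabs (A * s - cc / P) <= d).
    { replace (A * s - cc / P) with ((A - / (P * s) * cc) * s) by (field; lra).
      rewrite Rabs_mult, (Rabs_pos_eq s) by lra.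
      apply Rle_trans with (d / s * s); [apply Rmult_le_compat_r; lra|]. right. field. lra. }
    assert (S2 : Rabs ((C * w - A) * s) <= 4 * d).
    { replace ((C * w - A) * s)
        with ((C * q - t / P * cc) * (R / t) + cc / P * (R - 1) - (A * s - cc / P)).
      2:{ unfold R. field. repeat split; lra. }
      apply Rabs_le_between in Am. apply Rabs_le_between in Sta. apply Rabs_le_between in S1.
      assert (Rt : 0 <= R / t <= 2).
      { split.
        - apply Rmult_le_pos; [lra|left; apply Rinv_0_lt_compat; lra].
        - apply Rmult_le_reg_r with t; [lra|]. unfold Rdiv. rewrite Rmult_assoc, Rinv_l by lra. lra. }
      assert (cP : -1 <= cc / P <= 1).
      { split; apply Rmult_le_reg_r with P; try lra; unfold Rdiv; rewrite Rmult_assoc, Rinv_l by lra; lra. }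
      set (u := C * q - t / P * cc) in *. set (v := R / t) in *. set (x := cc / P) in *.
      assert (X1 := prod_bound u v d 2 ltac:(lra) ltac:(lra)).
      assert (X2 := prod_bound_sym x (R - 1) 1 d ltac:(lra) ltac:(lra)).
      apply Rabs_le. lra. }
    assert (S3 : sqrt (1 + y) <= 2 * s).
    { apply sqrt_le_of_sq; [lra|]. replace ((2 * s) ^ 2) with (4 * (s * s)) by ring. rewrite Hss. lra. }
    rewrite Rabs_mult, (Rabs_pos_eq s) in S2 by lra.
    assert (T := Rabs_pos (C * w - A)).
    apply Rle_trans with (Rabs (C * w - A) * (2 * s)); [apply Rmult_le_compat_l; lra|]. lra.
  - assert (AC := argument_close (INR n) b (gap mu e p) (height mu e p) w y z Hn Hb HD HV
       ltac:(lra) Hy Hw3 Hy3 R2).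
    assert (y2 : 0 < y ^ 2 <= Y0 ^ 2) by (split; [apply pow_lt; lra|apply pow_incr; lra]).
    specialize (Bd n k w (- y ^ 2) Hw Hw3).
    replace (e * (INR k - INR n * edge mu)) with (- (INR n * gap mu e p)) in Bd
      by (rewrite Hk; unfold gap; ring).
    assert (B : Rabs (coef mu n k * w - Ai (- y ^ 2)) <= eps / (1 + Y0)).
    { apply Bd; [rewrite Rabs_Ropp, Rabs_pos_eq; lra|].
      replace (- (INR n * gap mu e p) / w - - y ^ 2) with (- (INR n * gap mu e p / w - y ^ 2)) by (field; lra).
      rewrite Rabs_Ropp. eapply Rle_trans; [exact AC|].
      apply Rle_trans with (eta / Y0 ^ 2 * Y0 ^ 2); [|right; field; lra].
      apply Rmult_le_compat; try lra. unfold z. apply Rmin_glb; lra. }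
    apply Rle_trans with (eps / (1 + Y0) * (1 + Y0)); [|right; field; lra].
    apply Rmult_le_compat; auto; [apply Rabs_pos|apply sqrt_pos|].
    apply sqrt_le_of_sq; [lra|]. clear - Hy HyY HY0. nra.
Qed.

(** * Fourier coefficients as real integrals *)

Lemma cis_plus (a b : R) : cis (a + b) = (cis a * cis b)%C.
Proof.
  unfold cis, Cmult; simpl. rewrite cos_plus, sin_plus. f_equal; ring.
Qed.

Lemma cis_0 : cis 0 = 1%C.
Proof. unfold cis. now rewrite cos_0, sin_0. Qed.

Lemma cis_neq_0 (a : R) : cis a <> 0%C.
Proof.
  intros E. injection E as E1 E2. assert (T := sin2_cos2 a). unfold Rsqr in T.
  rewrite E1, E2 in T. lra.
Qed.

Lemma cis_opp (a : R) : (/ cis a)%C = cis (- a).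
Proof.
  assert (E : (cis a * cis (- a))%C = 1%C) by (rewrite <- cis_plus, Rplus_opp_r; apply cis_0).
  assert (N := cis_neq_0 a).
  transitivity ((/ cis a) * (cis a * cis (- a)))%C.
  - rewrite E. ring.
  - field. exact N.
Qed.

Lemma cis_pow (a : R) (n : nat) : (cis a ^ n)%C = cis (INR n * a).
Proof.
  induction n as [|n IH].
  - simpl. rewrite Rmult_0_l. symmetry. apply cis_0.
  - rewrite S_INR. replace ((INR n + 1) * a) with (a + INR n * a) by ring.
    rewrite cis_plus, <- IH. reflexivity.
Qed.

Lemma cis_double_atan (x : R) :
  cos (2 * atan x) = (1 - x ^ 2) / (1 + x ^ 2) /\ sin (2 * atan x) = 2 * x / (1 + x ^ 2).
Proof.
  assert (P : 0 < 1 + x ^ 2) by nra.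
  assert (S := sqrt_sqrt (1 + x ^ 2) ltac:(lra)). assert (S0 := sqrt_lt_R0 _ P).
  assert (C : cos (atan x) * cos (atan x) = / (1 + x ^ 2)).
  { rewrite cos_atan. unfold Rsqr. replace (1 + x * x) with (1 + x ^ 2) by ring.
    rewrite <- S at 3. field. lra. }
  assert (D : sin (atan x) = x * cos (atan x)).
  { rewrite cos_atan, sin_atan. field. unfold Rsqr. replace (1 + x * x) with (1 + x ^ 2) by ring. lra. }
  rewrite cos_2a, sin_2a, D. split.
  - replace (cos (atan x) * cos (atan x) - x * cos (atan x) * (x * cos (atan x)))
      with ((cos (atan x) * cos (atan x)) * (1 - x ^ 2)) by ring. rewrite C. field. lra.
  - replace (2 * (x * cos (atan x)) * cos (atan x)) with (2 * x * (cos (atan x) * cos (atan x))) by ring.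
    rewrite C. field. lra.
Qed.

Lemma blaschke_cis (mu t : R) : -1 < mu < 1 -> blaschke mu (cis t) = cis (theta mu t).
Proof.
  intros H. assert (V := abs_mul_cos_lt mu t H). assert (D := den_pos mu t H).
  assert (E : (cis t - mu)%C = (cis (theta mu t) * (1 - mu * cis t))%C).
  { unfold theta. rewrite cis_plus. unfold argq. set (u := mu * sin t). set (v := 1 - mu * cos t).
    fold v in V. destruct (cis_double_atan (u / v)) as [E1 E2].
    assert (Dv : 0 < u ^ 2 + v ^ 2) by nra.
    assert (C2 : cos (2 * atan (u / v)) = (v ^ 2 - u ^ 2) / (u ^ 2 + v ^ 2)) by (rewrite E1; field; split; nra).
    assert (S2 : sin (2 * atan (u / v)) = 2 * u * v / (u ^ 2 + v ^ 2)) by (rewrite E2; field; split; nra).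
    assert (T := sin2_cos2 t). unfold Rsqr in T.
    assert (F1 : (v ^ 2 - u ^ 2) / (u ^ 2 + v ^ 2) * v + 2 * u * v / (u ^ 2 + v ^ 2) * u = v) by (field; lra).
    assert (F2 : 2 * u * v / (u ^ 2 + v ^ 2) * v - (v ^ 2 - u ^ 2) / (u ^ 2 + v ^ 2) * u = u) by (field; lra).
    unfold cis, Cmult, Cminus, Cplus, Copp, RtoC. simpl. rewrite C2, S2.
    set (c2 := (v ^ 2 - u ^ 2) / (u ^ 2 + v ^ 2)) in *. set (s2 := 2 * u * v / (u ^ 2 + v ^ 2)) in *.
    replace (1 + - (mu * cos t - 0 * sin t)) with v by (unfold v; ring).
    replace (0 + - (mu * sin t + 0 * cos t)) with (- u) by (unfold u; ring).
    f_equal.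
    - replace ((cos t * c2 - sin t * s2) * v - (cos t * s2 + sin t * c2) * - u)
        with (cos t * (c2 * v + s2 * u) - sin t * (s2 * v - c2 * u)) by ring.
      rewrite F1, F2. unfold u, v. replace (- mu) with (- mu * (sin t * sin t + cos t * cos t)) by (rewrite T; ring). ring.
    - replace ((cos t * c2 - sin t * s2) * - u + (cos t * s2 + sin t * c2) * v)
        with (cos t * (s2 * v - c2 * u) + sin t * (c2 * v + s2 * u)) by ring.
      rewrite F1, F2. unfold u, v. ring. }
  unfold blaschke. rewrite E. field.
  intros Z. unfold cis, Cmult, Cminus, Cplus, Copp, RtoC in Z. injection Z as Z1 Z2. simpl in Z1.
  nra.
Qed.

Lemma theta_reflect (mu t : R) : theta mu (2 * PI - t) = 2 * PI - theta mu t.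
Proof.
  unfold theta, argq.
  replace (cos (2 * PI - t)) with (cos t).
  2:{ rewrite <- cos_neg. replace (- t) with ((2 * PI - t) - 2 * PI) by ring.
      rewrite cos_minus, cos_2PI, sin_2PI. ring. }
  replace (sin (2 * PI - t)) with (- sin t) by (rewrite sin_minus, cos_2PI, sin_2PI; ring).
  replace (mu * - sin t / (1 - mu * cos t)) with (- (mu * sin t / (1 - mu * cos t)))
    by (unfold Rdiv; ring).
  rewrite atan_opp. ring.
Qed.

Lemma theta_half_turn (mu t : R) : theta mu (PI - t) = PI - theta (- mu) t.
Proof.
  unfold theta, argq. rewrite sin_PI_x.
  replace (cos (PI - t)) with (- cos t).
  2:{ rewrite cos_minus, cos_PI, sin_PI. ring. }
  replace (- mu * sin t / (1 - - mu * cos t)) with (- (mu * sin t / (1 - mu * - cos t))).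
  2:{ unfold Rdiv. replace (1 - - mu * cos t) with (1 - mu * - cos t) by ring. ring. }
  rewrite atan_opp. ring.
Qed.

Lemma cis_2PI_nat (n : nat) : cis (INR n * (2 * PI)) = 1%C.
Proof.
  rewrite <- cis_pow. unfold cis at 1. rewrite cos_2PI, sin_2PI.
  induction n as [|n IH]; [reflexivity|]. simpl. rewrite IH.
  unfold Cmult, RtoC; simpl. f_equal; ring.
Qed.

Lemma continuous_theta_comb (mu n k : R) (t : R) : -1 < mu < 1 ->
  continuous (fun t => n * theta mu t - k * t) t.
Proof.
  intros H. apply (ex_derive_continuous (fun t => n * theta mu t - k * t)).
  eexists. apply (is_derive_minus (fun t => n * theta mu t) (fun t => k * t)).
  - apply (is_derive_scal (theta mu)). now apply is_derive_theta.
  - apply (is_derive_scal (fun t => t)). apply is_derive_id.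
Qed.

Lemma RInt_reflect_at (f : R -> R) (c a b : R) : (forall x, continuous f x) ->
  RInt f (c - b) (c - a) = RInt (fun t => f (c - t)) a b.
Proof.
  intros Hf.
  rewrite <- (RInt_reflect (fun t => f (c - t))).
  2:{ apply ex_RInt_cont. intros x. apply (continuous_comp (fun t => c - t) f); [cont_ad; auto|apply Hf]. }
  assert (T := RInt_comp_lin f 1 c (- b) (- a) (ex_RInt_cont _ _ _ Hf)).
  replace (1 * - b + c) with (c - b) in T by ring.
  replace (1 * - a + c) with (c - a) in T by ring.
  rewrite <- T. apply RInt_ext. intros x _. scalR. rewrite Rmult_1_l. f_equal. ring.
Qed.

(** On the circle the integrand is [cis] of the phase; reflecting [t] into
    [2 PI - t] conjugates it, so the sines cancel and the cosines double. *)
Lemma fourier_coef_eq (lambda : R) (n k : nat) : -1 < lambda < 1 ->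
  fourier_coef lambda n k = RtoC (coef lambda n k).
Proof.
  intros H. set (F := fun t => INR n * theta lambda t - INR k * t).
  assert (PP := PI_RGT_0).
  assert (CF : forall t, continuous F t) by (intros; now apply continuous_theta_comb).
  assert (Cc : forall t, continuous (fun t => cos (F t)) t).
  { intros t. apply (continuous_comp F cos); [apply CF|apply continuous_cos]. }
  assert (Cs : forall t, continuous (fun t => sin (F t)) t).
  { intros t. apply (continuous_comp F sin); [apply CF|apply continuous_sin]. }
  assert (Refl : forall t, cis (F (2 * PI - t)) = cis (- F t)).
  { intros t. unfold F. rewrite theta_reflect.
    replace (INR n * (2 * PI - theta lambda t) - INR k * (2 * PI - t))
      with (INR n * (2 * PI) + (- (INR k * (2 * PI)) + - (INR n * theta lambda t - INR k * t))) by ring.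
    rewrite !cis_plus, <- cis_opp, !cis_2PI_nat. field. }
  assert (Half : forall g : R -> R, (forall t, continuous g t) ->
     RInt g 0 (2 * PI) = RInt g 0 PI + RInt (fun t => g (2 * PI - t)) 0 PI).
  { intros g Cg. rewrite <- (RInt_Chasles (V := R_CompleteNormedModule) g 0 PI (2 * PI))
      by now apply ex_RInt_cont.
    plusR. f_equal. rewrite <- RInt_reflect_at by exact Cg. f_equal; ring. }
  assert (Ic : RInt (fun t => cos (F t)) 0 (2 * PI) = 2 * RInt (fun t => cos (F t)) 0 PI).
  { rewrite Half by exact Cc. rewrite (RInt_ext (fun t => cos (F (2 * PI - t))) (fun t => cos (F t))).
    - set (J := RInt (fun t => cos (F t)) 0 PI : R). change (J + J = 2 * J). ring.
    - intros t _. assert (T := f_equal fst (Refl t)). simpl in T. rewrite T. apply cos_neg. }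
  assert (Is : RInt (fun t => - sin (F t)) 0 (2 * PI) = 0).
  { rewrite Half.
    2:{ intros t. apply (continuous_opp (fun t => sin (F t))). apply Cs. }
    rewrite (RInt_ext (fun t => - sin (F (2 * PI - t))) (fun t => opp (- sin (F t)))).
    - rewrite (RInt_opp (V := R_CompleteNormedModule) (fun t => - sin (F t))).
      + set (J := RInt (fun t => - sin (F t)) 0 PI : R). change (J + - J = 0). ring.
      + apply ex_RInt_cont. intros t. apply (continuous_opp (fun t => sin (F t))). apply Cs.
    - intros t _. assert (T := f_equal snd (Refl t)). simpl in T. rewrite T, sin_neg. reflexivity. }
  assert (I : circle_int (fun z => (blaschke lambda z ^ n * / z ^ k * / z)%C)
              = (0, 2 * RInt (fun t => cos (F t)) 0 PI)).
  { unfold circle_int. apply (is_RInt_unique (V := C_R_CompleteNormedModule)).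
    apply (is_RInt_ext (V := C_R_NormedModule) (fun t => (- sin (F t), cos (F t)))).
    - intros t _. rewrite blaschke_cis by exact H. rewrite !cis_pow, !cis_opp.
      replace (cis (INR n * theta lambda t) * cis (- (INR k * t)) * cis (- t) * (Ci * cis t))%C
        with ((cis (INR n * theta lambda t) * cis (- (INR k * t))) * Ci * (cis (- t) * cis t))%C by ring.
      rewrite <- !cis_plus, Rplus_opp_l, cis_0. unfold F, cis, Ci, Cmult, RtoC; simpl.
      replace (INR n * theta lambda t + - (INR k * t)) with (INR n * theta lambda t - INR k * t) by ring.
      f_equal; ring.
    - apply (is_RInt_fct_extend_pair (U := R_NormedModule) (V := R_NormedModule)); simpl.
      + refine (eq_ind _ (fun l => is_RInt _ 0 (2 * PI) l) _ _ Is). apply (RInt_correct (V := R_CompleteNormedModule)), ex_RInt_cont.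
        intros t. apply (continuous_opp (fun t => sin (F t))). apply Cs.
      + refine (eq_ind _ (fun l => is_RInt _ 0 (2 * PI) l) _ _ Ic). apply (RInt_correct (V := R_CompleteNormedModule)), ex_RInt_cont, Cc. }
  unfold fourier_coef. rewrite I. unfold coef.
  change (RInt (fun s => cos (INR n * (s + 2 * argq lambda s) - INR k * s)) 0 PI)
    with (RInt (fun t => cos (F t)) 0 PI).
  set (J := RInt (fun t => cos (F t)) 0 PI : R). change (RInt (fun t => cos (F t)) 0 PI) with J.
  replace (0, 2 * J) with (2 * Ci * RtoC J)%C
    by (unfold Ci, Cmult, RtoC; simpl; f_equal; ring).
  rewrite RtoC_mult, RtoC_inv by lra. field.
  split; intros Z; injection Z; lra.
Qed.

Lemma cos_nat_PI (n : nat) : cos (INR n * PI) = (-1) ^ n /\ sin (INR n * PI) = 0.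
Proof.
  induction n as [|n [IH1 IH2]]; [simpl; rewrite Rmult_0_l, cos_0, sin_0; auto|].
  rewrite S_INR, Rmult_plus_distr_r, Rmult_1_l, cos_plus, sin_plus, cos_PI, sin_PI, IH1, IH2.
  simpl. split; ring.
Qed.

Lemma m1_pow_sq (n : nat) : (-1) ^ n * (-1) ^ n = 1.
Proof. rewrite <- Rpow_mult_distr. replace (-1 * -1) with 1 by ring. apply pow1. Qed.

Lemma powerRZ_m1_sub (n k : nat) :
  powerRZ (-1) (Z.of_nat n - Z.of_nat k) = (-1) ^ n * (-1) ^ k.
Proof.
  unfold Zminus. rewrite powerRZ_add by lra. rewrite powerRZ_neg', <- !pow_powerRZ.
  assert (T := m1_pow_sq k). f_equal.
  assert ((-1) ^ k <> 0) by (apply pow_nonzero; lra).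
  apply (Rmult_eq_reg_l ((-1) ^ k)); auto. rewrite Rinv_r, T; auto.
Qed.

Lemma powerRZ_m1_sq (z : Z) : powerRZ (-1) z * powerRZ (-1) z = 1.
Proof.
  destruct z as [|p|p]; simpl; try ring.
  - apply m1_pow_sq.
  - rewrite <- Rinv_mult, m1_pow_sq. apply Rinv_1.
Qed.

(** [b_lambda (- z) = - b_(- lambda) z]; on the circle, [- z] is reached from the
    other end of [[0, PI]]. *)
Lemma coef_opp (lambda : R) (n k : nat) : -1 < lambda < 1 ->
  coef lambda n k = powerRZ (-1) (Z.of_nat n - Z.of_nat k) * coef (- lambda) n k.
Proof.
  intros H. rewrite powerRZ_m1_sub. unfold coef.
  set (F := fun t => INR n * theta lambda t - INR k * t).
  set (G := fun t => INR n * theta (- lambda) t - INR k * t).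
  assert (CF : forall t, continuous (fun t => cos (F t)) t).
  { intros t. apply (continuous_comp F cos); [now apply continuous_theta_comb|apply continuous_cos]. }
  change (RInt (fun s => cos (INR n * (s + 2 * argq lambda s) - INR k * s)) 0 PI)
    with (RInt (fun t => cos (F t)) 0 PI).
  change (RInt (fun s => cos (INR n * (s + 2 * argq (- lambda) s) - INR k * s)) 0 PI)
    with (RInt (fun t => cos (G t)) 0 PI).
  assert (E := RInt_reflect_at (fun t => cos (F t)) PI 0 PI CF).
  rewrite Rminus_0_r, Rminus_diag in E. rewrite E.
  rewrite (RInt_ext _ (fun t => scal ((-1) ^ n * (-1) ^ k) (cos (G t)))).
  - rewrite (RInt_scal (V := R_CompleteNormedModule) (fun t => cos (G t))).
    + scalR. set (J := RInt (fun t => cos (G t)) 0 PI : R).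
      change (/ PI * ((-1) ^ n * (-1) ^ k * J) = (-1) ^ n * (-1) ^ k * (/ PI * J)). ring.
    + apply ex_RInt_cont. intros t.
      apply (continuous_comp G cos); [apply continuous_theta_comb; lra|apply continuous_cos].
  - intros t _. scalR. unfold F. rewrite theta_half_turn.
    replace (INR n * (PI - theta (- lambda) t) - INR k * (PI - t))
      with (INR n * PI - (INR k * PI + G t)) by (unfold G; ring).
    destruct (cos_nat_PI n) as [Cn Sn]. destruct (cos_nat_PI k) as [Ck Sk].
    rewrite cos_minus, cos_plus, Cn, Sn, Ck, Sk. eqR. ring.
Qed.

(** * The exponent [gamma ^ 2] *)

(** The branch is continuous near the point [e] of the circle at which the
    two saddle points merge. *)
Definition branch (e : R) (log : C -> C) : Prop :=
  e = 1 /\ log = Clog \/ e = -1 /\ log = Clog_pos_cut.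

Lemma branch_or (e : R) (log : C -> C) : branch e log -> e = 1 \/ e = -1.
Proof. intros [[-> _]|[-> _]]; auto. Qed.

Lemma branch_edge_sign (e lambda : R) (log : C -> C) : branch e log -> 0 < lambda < 1 ->
  edge_sign (e * lambda) e.
Proof. intros [[-> _]|[-> _]] H; [left|right]; split; lra. Qed.

Lemma branch_re (e : R) (log : C -> C) : branch e log -> forall z, Re (log z) = ln (Cmod z).
Proof.
  intros [[_ ->]|[_ ->]] z; [reflexivity|].
  unfold Clog_pos_cut, Clog. rewrite Cmod_opp.
  unfold Re, Cplus, Cmult, Ci, RtoC; simpl. ring.
Qed.

Lemma ln_den_0 (q : R) : q < 1 -> ln (den q 0) / 2 = ln (1 - q).
Proof.
  intros H. rewrite den_0. replace ((1 - q) ^ 2) with ((1 - q) * (1 - q)) by ring.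
  rewrite ln_mult by lra. field.
Qed.

Lemma Re_Phi_radial (e lambda a rho : R) (log : C -> C) : branch e log -> 0 < lambda < 1 ->
  radii_ok (e * lambda) rho ->
  Re (Phi log lambda a (RtoC (e * exp rho))) = logmod (e * lambda) a rho 0.
Proof.
  intros Hb Hl [H1 H2]. assert (Hor := branch_or e log Hb). assert (E := exp_pos rho).
  unfold Phi, Cminus. rewrite re_plus, re_opp, re_scal_l, !(branch_re e log Hb).
  unfold logmod. rewrite !ln_den_0 by lra.
  replace (-1 * rho) with (- rho) in * by ring. rewrite Rmult_1_l in *.
  rewrite exp_Ropp in *.
  assert (P1 : 0 < exp rho - e * lambda).
  { assert (0 < (1 - e * lambda * / exp rho) * exp rho) by (apply Rmult_lt_0_compat; lra).
    replace ((1 - e * lambda * / exp rho) * exp rho) with (exp rho - e * lambda) in H by (field; lra). lra. }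
  rewrite blaschke_RtoC.
  2:{ replace (lambda * (e * exp rho)) with (e * lambda * exp rho) by ring. lra. }
  rewrite !Cmod_R.
  replace ((e * exp rho - lambda) / (1 - lambda * (e * exp rho)))
    with (e * ((exp rho - e * lambda) / (1 - e * lambda * exp rho))).
  2:{ destruct Hor as [-> | ->]; field; lra. }
  assert (Ae : Rabs e = 1) by (destruct Hor as [-> | ->]; [apply Rabs_R1|rewrite Rabs_left; lra]).
  rewrite !Rabs_mult, Ae, !Rmult_1_l, (Rabs_pos_eq (exp rho)), ln_exp by lra.
  rewrite Rabs_pos_eq by (apply Rlt_le, Rdiv_lt_0_compat; lra).
  replace ((exp rho - e * lambda) / (1 - e * lambda * exp rho))
    with (exp rho * ((1 - e * lambda * / exp rho) / (1 - e * lambda * exp rho))) by (field; split; lra).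
  rewrite ln_mult, ln_exp, ln_div by (first [lra | apply Rdiv_lt_0_compat; lra]). ring.
Qed.

Lemma Im_Phi_radial (e lambda a r : R) (log : C -> C) : branch e log -> 0 < lambda < 1 ->
  radii_ok (e * lambda) r ->
  Im (gamma3 log lambda a) = 3 / 4 * (Im (Phi log lambda a (z_plus lambda a)) - Im (Phi log lambda a (z_minus lambda a))) ->
  z_plus lambda a = RtoC (e * exp (e * r)) -> z_minus lambda a = RtoC (e * exp (- (e * r))) ->
  Im (gamma3 log lambda a) = 0.
Proof.
  intros Hb Hl [H1 H2] E Ep Em. rewrite E, Ep, Em. clear E Ep Em.
  replace (-1 * r) with (- r) in H1 by ring. rewrite Rmult_1_l in H2.
  destruct Hb as [[-> ->]|[-> ->]].
  - rewrite !Rmult_1_l in *.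
    assert (E2 := exp_pos (- r)).
    assert (E12 : exp r * exp (- r) = 1) by (rewrite <- exp_plus, Rplus_opp_r; apply exp_0).
    assert (L1 : lambda < exp r) by nra. assert (L2 : lambda < exp (- r)) by nra.
    rewrite !Phi_Clog_im; try lra; apply Rdiv_lt_0_compat; lra.
  - assert (E1 := exp_pos (-1 * r)). assert (E2 := exp_pos (- (-1 * r))).
    rewrite !Phi_Clog_pos_cut_im by (auto; lra). lra.
Qed.

Lemma Re_square (z : C) : Re (z ^ 2)%C = Re z ^ 2 - Im z ^ 2.
Proof. destruct z as [u v]. unfold Re, Im, Cmult, RtoC; simpl. unfold RtoC; simpl. ring. Qed.

(** Here [Phi] is real up to a constant that the difference cancels, and it is odd
    in [ln |z|], so the two saddle points contribute equally to [gamma^3]. *)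
Lemma gamma2_outer (e lambda a r : R) (log : C -> C) : branch e log -> 0 < lambda < 1 ->
  radii_ok (e * lambda) r -> a = freqh (e * lambda) r ->
  z_plus lambda a = RtoC (e * exp (e * r)) -> z_minus lambda a = RtoC (e * exp (- (e * r))) ->
  gamma2 log lambda a ^ 3 = 9 / 4 * heighth (e * lambda) e r ^ 2.
Proof.
  intros Hb Hl Hr Ha Ep Em. assert (Hor := branch_or e log Hb).
  unfold gamma2. rewrite cbrt_cube, Re_square.
  rewrite (Im_Phi_radial e lambda a r log Hb Hl Hr (gamma3_im log lambda a) Ep Em).
  rewrite gamma3_re, Ep, Em.
  assert (R1 : radii_ok (e * lambda) (e * r) /\ radii_ok (e * lambda) (- (e * r))).
  { destruct Hr as [A B]. unfold radii_ok. destruct Hor as [-> | ->].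
    - replace (-1 * (1 * r)) with (-1 * r) by ring. replace (1 * (1 * r)) with (1 * r) by ring.
      replace (-1 * - (1 * r)) with (1 * r) by ring. replace (1 * - (1 * r)) with (-1 * r) by ring. auto.
    - replace (-1 * (-1 * r)) with (1 * r) by ring. replace (1 * (-1 * r)) with (-1 * r) by ring.
      replace (-1 * - (-1 * r)) with (-1 * r) by ring. replace (1 * - (-1 * r)) with (1 * r) by ring. auto. }
  rewrite !(Re_Phi_radial e) by tauto.
  replace (- (e * r)) with (-1 * (e * r)) by ring.
  rewrite (logmod_odd _ _ (-1)) by auto. rewrite (logmod_odd _ _ e) by auto.
  unfold heighth. rewrite <- Ha. field.
Qed.

Lemma Carg_cis (t : R) : - PI < t < PI -> Carg (cis t) = t.
Proof.
  intros Ht. unfold Carg.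
  assert (M : Cmod (cis t) = 1).
  { unfold Cmod, cis; simpl. replace (cos t * (cos t * 1) + sin t * (sin t * 1)) with 1; [apply sqrt_1|].
    assert (T := sin2_cos2 t). unfold Rsqr in T. lra. }
  rewrite M. unfold Re, Im, cis; simpl. rewrite Rdiv_1_r.
  destruct (Rle_dec 0 t) as [H|H].
  - assert (S := sin_ge_0 t ltac:(lra) ltac:(lra)).
    destruct (Rle_dec 0 (sin t)); [|lra]. rewrite acos_cos; lra.
  - assert (S := sin_gt_0 (- t) ltac:(lra) ltac:(lra)). rewrite sin_neg in S.
    destruct (Rle_dec 0 (sin t)); [lra|]. rewrite <- cos_neg, acos_cos; lra.
Qed.

(** The constant [c] disappears from [Phi z_plus - Phi z_minus]. *)
Lemma branch_im (e : R) (log : C -> C) : branch e log -> exists c, forall t, - PI < t < PI ->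
  Im (log (RtoC e * cis t)%C) = t + c.
Proof.
  intros [[-> ->]|[-> ->]].
  - exists 0. intros t Ht. replace (RtoC 1 * cis t)%C with (cis t) by ring.
    unfold Clog. simpl. rewrite Carg_cis by exact Ht. ring.
  - exists PI. intros t Ht. unfold Clog_pos_cut. rewrite im_plus.
    replace (- (RtoC (-1) * cis t))%C with (cis t).
    + unfold Clog. simpl. rewrite Carg_cis by exact Ht. ring.
    + unfold cis, Copp, Cmult, RtoC; simpl. f_equal; ring.
Qed.

Lemma blaschke_sign (e lambda t : R) : e = 1 \/ e = -1 -> 0 < lambda < 1 ->
  blaschke lambda (RtoC e * cis t)%C = (RtoC e * cis (theta (e * lambda) t))%C.
Proof.
  intros He Hl. assert (Hm : -1 < e * lambda < 1) by (destruct He as [-> | ->]; lra).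
  rewrite <- blaschke_cis by exact Hm.
  assert (N : (1 - RtoC (e * lambda) * cis t)%C <> 0%C).
  { intros Z. injection Z as Z1 Z2. simpl in Z1.
    assert (V := abs_mul_cos_lt _ t Hm). lra. }
  unfold blaschke. rewrite RtoC_mult in *.
  assert (E : (RtoC e * RtoC e)%C = 1%C).
  { rewrite <- RtoC_mult. f_equal. destruct He as [-> | ->]; ring. }
  replace (RtoC lambda * (RtoC e * cis t))%C with (RtoC e * RtoC lambda * cis t)%C by ring.
  replace (RtoC e * ((cis t - RtoC e * RtoC lambda) / (1 - RtoC e * RtoC lambda * cis t)))%C
    with ((RtoC e * cis t - (RtoC e * RtoC e) * RtoC lambda) / (1 - RtoC e * RtoC lambda * cis t))%C
    by (field; exact N).
  rewrite E. f_equal. ring.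
Qed.

Lemma theta_opp (mu t : R) : theta mu (- t) = - theta mu t.
Proof.
  unfold theta, argq. rewrite sin_neg, cos_neg.
  replace (mu * - sin t / (1 - mu * cos t)) with (- (mu * sin t / (1 - mu * cos t))) by (unfold Rdiv; ring).
  rewrite atan_opp. ring.
Qed.

Lemma theta_range (mu p : R) : -1 < mu < 1 -> 0 < p < PI -> 0 < theta mu p < PI.
Proof.
  intros H Hp.
  assert (c0 : 0 < (1 - mu ^ 2) / 4) by nra.
  assert (L : forall s, (1 - mu ^ 2) / 4 <= freq mu s).
  { intros s. unfold freq. destruct (den_bounds mu s H) as [_ B]. assert (B0 := den_pos mu s H).
    apply Rmult_le_compat_l; [nra|]. apply Rinv_le_contravar; lra. }
  assert (Inc : forall a b, a < b -> theta mu a < theta mu b).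
  { intros a b Hab.
    assert (T := deriv_le_le (fun s => (1 - mu ^ 2) / 4 * s) (fun _ => (1 - mu ^ 2) / 4) (theta mu) (freq mu) a b
      ltac:(lra) ltac:(intros; auto_derive; auto; field) ltac:(intros; now apply is_derive_theta)
      ltac:(intros; apply L)).
    cbv beta in T. nra. }
  assert (TP : theta mu PI = PI).
  { unfold theta, argq. rewrite sin_PI, Rmult_0_r. unfold Rdiv. rewrite Rmult_0_l, atan_0. ring. }
  split.
  - rewrite <- (theta_0 mu). apply Inc. lra.
  - rewrite <- TP. apply Inc. lra.
Qed.

(** On the circle [Phi] is imaginary, so [gamma^3] is, and its square is
    negative. *)
Lemma gamma2_inner (e lambda a p : R) (log : C -> C) : branch e log -> 0 < lambda < 1 ->
  0 < p < PI -> a = freq (e * lambda) p ->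
  z_plus lambda a = (RtoC e * cis (e * p))%C -> z_minus lambda a = (RtoC e * cis (- (e * p)))%C ->
  saddle_x lambda a ^ 2 <= 1 ->
  gamma2 log lambda a ^ 3 = - (9 / 4) * height (e * lambda) e p ^ 2.
Proof.
  intros Hb Hl Hp Ha Ep Em Hx. assert (Hor := branch_or e log Hb).
  assert (Hm : -1 < e * lambda < 1) by (destruct Hor as [-> | ->]; lra).
  unfold gamma2. rewrite cbrt_cube, Re_square.
  rewrite (gamma3_circle log lambda a (branch_re e log Hb) Hl Hx).
  destruct (branch_im e log Hb) as [c Hc].
  assert (Th := theta_range (e * lambda) p Hm Hp).
  assert (IP : forall t, - PI < t < PI -> - PI < theta (e * lambda) t < PI ->
    Im (Phi log lambda a (RtoC e * cis t)%C) = theta (e * lambda) t + c - a * (t + c)).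
  { intros t Ht Ht2. unfold Phi, Cminus. rewrite im_plus, im_opp, im_scal_l.
    rewrite blaschke_sign by assumption. rewrite !Hc by assumption. ring. }
  rewrite gamma3_im, Ep, Em.
  assert (E : Im (Phi log lambda a (RtoC e * cis (e * p))%C)
            - Im (Phi log lambda a (RtoC e * cis (- (e * p)))%C)
            = 2 * height (e * lambda) e p).
  { rewrite !IP; try (destruct Hor as [-> | ->]; rewrite ?theta_opp; lra).
    - unfold height. rewrite <- Ha. rewrite theta_opp.
      destruct Hor as [-> | ->].
      + rewrite !Rmult_1_l. ring.
      + replace (-1 * p) with (- p) by ring. rewrite theta_opp. ring.
    - rewrite theta_opp. destruct Hor as [-> | ->].
      + rewrite !Rmult_1_l in *. lra.
      + replace (-1 * p) with (- p) by ring. rewrite theta_opp. lra.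
    - destruct Hor as [-> | ->].
      + rewrite !Rmult_1_l in *. lra.
      + replace (-1 * p) with (- p) by ring. rewrite theta_opp. lra. }
  rewrite E. field.
Qed.

Lemma saddle_edge (e lambda a : R) : e = 1 \/ e = -1 -> 0 < lambda < 1 -> 0 < a ->
  e * saddle_x lambda a - 1 = (1 - e * lambda) ^ 2 * (e * (a - edge (e * lambda))) / (2 * lambda * a).
Proof. intros [-> | ->] Hl Ha; unfold saddle_x, edge; field; lra. Qed.

Lemma saddle_den (lambda a : R) : 0 < lambda < 1 -> 0 < a ->
  1 + lambda ^ 2 - 2 * lambda * saddle_x lambda a = (1 - lambda ^ 2) / a.
Proof. intros Hl Ha. unfold saddle_x. field. lra. Qed.

Lemma cosh_lower (r : R) : 0 <= r -> r ^ 2 <= exp r + exp (- r) - 2.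
Proof.
  intros Hr. set (t := r / 2).
  assert (A : forall x, 2 <= exp x + exp (- x)).
  { intros x. assert (P := exp_pos x). assert (P2 := exp_pos (- x)).
    assert (E : exp x * exp (- x) = 1) by (rewrite <- exp_plus, Rplus_opp_r; apply exp_0).
    apply (le_of_pow_le 1); [lra|]. assert (T := pow2_ge_0 (exp x - exp (- x))). nra. }
  assert (B := deriv_le_le (fun x => 2 * x) (fun _ => 2) (fun x => exp x - exp (- x)) (fun x => exp x + exp (- x))
    0 t ltac:(unfold t; lra) ltac:(intros; auto_derive; auto; ring) ltac:(intros; auto_derive; auto; ring)
    ltac:(intros; apply A)).
  cbv beta in B. rewrite Ropp_0, exp_0 in B.
  assert (E : exp t * exp (- t) = 1) by (rewrite <- exp_plus, Rplus_opp_r; apply exp_0).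
  replace (exp r) with (exp t * exp t) by (rewrite <- exp_plus; f_equal; unfold t; field).
  replace (exp (- r)) with (exp (- t) * exp (- t)) by (rewrite <- exp_plus; f_equal; unfold t; field).
  replace (exp t * exp t + exp (- t) * exp (- t) - 2) with ((exp t - exp (- t)) * (exp t - exp (- t)))
    by (transitivity (exp t * exp t + exp (- t) * exp (- t) - 2 * (exp t * exp (- t))); [ring|rewrite E; ring]).
  replace (r ^ 2) with ((2 * t) * (2 * t)) by (unfold t; field).
  apply Rmult_le_compat; unfold t in *; lra.
Qed.

(** Both [freqh r = a] and [freq p = a] are solved by reading [r] or [p] off the
    saddle points [z_plus] and [z_minus]; they are small when [a] is near the edge
    because [e saddle_x - 1] is comparable to the distance of [a] to it. *)
Lemma gamma2_cases (e lambda : R) (log : C -> C) : branch e log -> 0 < lambda < 1 ->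
  forall r0, 0 < r0 -> exists d, 0 < d /\ forall a, Rabs (a - edge (e * lambda)) < d -> 0 < a /\
  ((exists r, 0 < r < r0 /\ a = freqh (e * lambda) r /\ 0 < e * (a - edge (e * lambda)) /\
      gamma2 log lambda a ^ 3 = 9 / 4 * heighth (e * lambda) e r ^ 2) \/
   (a = edge (e * lambda) /\ gamma2 log lambda a = 0) \/
   (exists p, 0 < p < r0 /\ a = freq (e * lambda) p /\ e * (a - edge (e * lambda)) < 0 /\
      gamma2 log lambda a ^ 3 = - (9 / 4) * height (e * lambda) e p ^ 2)).
Proof.
  intros Hb Hl r1 Hr1. assert (Hor := branch_or e log Hb).
  assert (Hs := branch_edge_sign e lambda log Hb Hl).
  destruct (edge_sign_facts _ _ Hs) as (Hm & Hee & _).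
  set (mu := e * lambda) in *. set (kp := edge mu).
  destruct (radii_range mu Hm) as (R0 & HR0 & HR).
  set (r0 := Rmin r1 R0). assert (Hr0 : 0 < r0) by (apply Rmin_glb_lt; lra).
  assert (Hr01 : r0 <= r1) by apply Rmin_l. assert (Hr0R : r0 <= R0) by apply Rmin_r.
  assert (Hk : 0 < kp) by (apply Rdiv_lt_0_compat; lra).
  assert (Hlk : 0 < lambda * kp) by nra.
  assert (M4 : 0 < (1 - mu) ^ 2 <= 4) by (split; [apply pow_lt; lra|nra]).
  assert (r02 : 0 < r0 ^ 2) by (apply pow_lt; lra).
  exists (Rmin (kp / 2) (Rmin (lambda * kp / 4) (lambda * kp * r0 ^ 2 / 72))). split.
  { repeat apply Rmin_glb_lt; nra. }
  intros a Ha.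
  assert (A1 := Rmin_l (kp / 2) (Rmin (lambda * kp / 4) (lambda * kp * r0 ^ 2 / 72))).
  assert (A2 := Rmin_r (kp / 2) (Rmin (lambda * kp / 4) (lambda * kp * r0 ^ 2 / 72))).
  assert (A3 := Rmin_l (lambda * kp / 4) (lambda * kp * r0 ^ 2 / 72)).
  assert (A4 := Rmin_r (lambda * kp / 4) (lambda * kp * r0 ^ 2 / 72)).
  set (dd := Rmin (lambda * kp / 4) (lambda * kp * r0 ^ 2 / 72)) in *.
  set (d := Rmin (kp / 2) dd) in *.
  assert (Ha2 : kp / 2 < a) by (apply Rabs_def2 in Ha; lra).
  split; [lra|].
  assert (SE := saddle_edge e lambda a Hor Hl ltac:(lra)). fold mu in SE. fold kp in SE.
  assert (SD := saddle_den lambda a Hl ltac:(lra)).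
  set (x := saddle_x lambda a) in *. set (X := e * x) in *.
  assert (ex : x = e * X) by (unfold X; rewrite <- Rmult_assoc, Hee; ring).
  assert (x2 : x ^ 2 = X ^ 2) by (rewrite ex; replace ((e * X) ^ 2) with ((e * e) * X ^ 2) by ring; rewrite Hee; ring).
  assert (H2la : lambda * kp <= 2 * lambda * a).
  { replace (2 * lambda * a) with (lambda * (2 * a)) by ring. apply Rmult_le_compat_l; lra. }
  assert (XB : Rabs (X - 1) < Rmin 1 (r0 ^ 2 / 18)).
  { rewrite SE. unfold Rdiv at 1. rewrite Rabs_mult, (Rabs_pos_eq (/ _)).
    2:{ left; apply Rinv_0_lt_compat; lra. }
    apply Rmult_lt_reg_r with (2 * lambda * a); [lra|]. rewrite Rmult_assoc, Rinv_l, Rmult_1_r by lra.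
    rewrite Rabs_mult, (Rabs_pos_eq ((1 - mu) ^ 2)) by lra.
    assert (Ae : Rabs (e * (a - kp)) = Rabs (a - kp)).
    { rewrite Rabs_mult. assert (Rabs e = 1) by (destruct Hor as [-> | ->]; [apply Rabs_R1|rewrite Rabs_left; lra]).
      rewrite H. ring. }
    rewrite Ae. assert (Pa := Rabs_pos (a - kp)).
    apply Rle_lt_trans with (4 * Rabs (a - kp)); [apply Rmult_le_compat_r; lra|].
    apply Rlt_le_trans with (4 * d); [lra|].
    apply Rle_trans with (Rmin 1 (r0 ^ 2 / 18) * (lambda * kp)).
    - destruct (Rle_dec 1 (r0 ^ 2 / 18));
        [rewrite (Rmin_left 1 (r0 ^ 2 / 18)) by lra|rewrite (Rmin_right 1 (r0 ^ 2 / 18)) by lra]; lra.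
    - apply Rmult_le_compat_l; [|lra]. apply Rmin_glb; lra. }
  assert (XB1 := Rmin_l 1 (r0 ^ 2 / 18)). assert (XB2 := Rmin_r 1 (r0 ^ 2 / 18)).
  apply Rabs_def2 in XB.
  assert (muX : 1 - mu * (2 * X) + mu ^ 2 = (1 - mu ^ 2) / a).
  { replace (mu ^ 2) with (lambda ^ 2) by (unfold mu; replace ((e * lambda) ^ 2) with ((e * e) * lambda ^ 2) by ring; rewrite Hee; ring).
    rewrite <- SD. unfold mu, X. replace (e * lambda * (2 * (e * x))) with ((e * e) * (2 * lambda * x)) by ring.
    rewrite Hee. ring. }
  assert (Hmu2 : 0 < 1 - mu ^ 2) by (clear - Hm; nra).
  assert (Sign : forall P : Prop, (0 < X - 1 -> 0 < e * (a - kp) -> P) -> (X - 1 < 0 -> e * (a - kp) < 0 -> P) ->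
            (X = 1 -> a = kp -> P) -> P).
  { intros P P1 P2 P3.
    assert (Q : 0 < (1 - mu) ^ 2 / (2 * lambda * a)) by (apply Rdiv_lt_0_compat; lra).
    assert (SE' : X - 1 = (1 - mu) ^ 2 / (2 * lambda * a) * (e * (a - kp))) by (rewrite SE; field; lra).
    destruct (Rtotal_order (e * (a - kp)) 0) as [L|[Z|G]].
    - apply P2; auto. rewrite SE'. clear - Q L. nra.
    - apply P3; [rewrite Z in SE'; lra|]. destruct Hor as [-> | ->]; lra.
    - apply P1; auto. rewrite SE'. apply Rmult_lt_0_compat; lra. }
  apply Sign; intros HX Hka.
  - left. assert (X2 : 0 < X ^ 2 - 1) by (clear - HX; nra).
    assert (S := sqrt_sqrt (X ^ 2 - 1) ltac:(lra)). assert (S0 := sqrt_lt_R0 _ X2).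
    set (s := sqrt (X ^ 2 - 1)) in *.
    set (r := ln (X + s)).
    assert (E1 : exp r = X + s) by (apply exp_ln; lra).
    assert (E2 : exp (- r) = X - s).
    { rewrite exp_Ropp, E1. apply (Rmult_eq_reg_l (X + s)); [|lra]. rewrite Rinv_r by lra.
      replace ((X + s) * (X - s)) with (X ^ 2 - s * s) by ring. rewrite S. ring. }
    assert (Hr : 0 < r) by (rewrite <- ln_1; apply ln_increasing; lra).
    assert (Hden : denh mu r = (1 - mu ^ 2) / a).
    { unfold denh. rewrite E1, E2, <- muX. ring. }
    assert (Em1 : 0 < exp (- r) <= 1).
    { split; [apply exp_pos|]. rewrite <- exp_0. apply exp_le. lra. }
    assert (Hrr0 : r < r0).
    { apply Rnot_le_lt. intros Hle. assert (CL := cosh_lower r ltac:(lra)). rewrite E1, E2 in CL.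
      assert (r0 ^ 2 <= r ^ 2) by (apply pow_incr; lra). lra. }
    exists r. repeat split; try lra.
    + unfold freqh. rewrite Hden. field. lra.
    + assert (ok : radii_ok mu r).
      { destruct (HR r) as [B1 B2]; [rewrite Rabs_pos_eq; lra|]. now apply radii_range_ok. }
      apply gamma2_outer; auto.
      * fold mu. unfold freqh. rewrite Hden. field. lra.
      * destruct (z_real lambda a) as [-> _]; [fold x; rewrite x2; lra|]. fold x. rewrite x2. fold s. f_equal. rewrite ex.
        destruct Hor as [-> | ->].
        -- rewrite !Rmult_1_l, E1. ring.
        -- replace (-1 * r) with (- r) by ring. rewrite E2. ring.
      * destruct (z_real lambda a) as [_ ->]; [fold x; rewrite x2; lra|]. fold x. rewrite x2. fold s. f_equal. rewrite ex.
        destruct Hor as [-> | ->].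
        -- rewrite !Rmult_1_l, E2. ring.
        -- replace (- (-1 * r)) with r by ring. rewrite E1. ring.
  - right; right.
    set (p := acos X).
    assert (Cp : cos p = X) by (apply cos_acos; lra).
    assert (Pb := acos_bound X). fold p in Pb.
    assert (Hp : 0 < p < PI).
    { split.
      - destruct (Req_dec p 0) as [Z|Z]; [|lra]. rewrite Z, cos_0 in Cp. lra.
      - destruct (Req_dec p PI) as [Z|Z]; [|lra]. rewrite Z, cos_PI in Cp. lra. }
    assert (Sp : sin p = sqrt (1 - X ^ 2)).
    { unfold p. rewrite sin_acos by lra. f_equal. unfold Rsqr. ring. }
    assert (X2 : X ^ 2 <= 1) by (clear - HX XB XB1; nra).
    exists p. repeat split; try lra.
    + apply Rlt_le_trans with r0; [|lra].
      apply Rnot_le_lt. intros Hle. assert (CL := one_minus_cos_ge p ltac:(lra)). rewrite Cp in CL.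
      assert (r0 ^ 2 <= p ^ 2) by (apply pow_incr; lra). lra.
    + unfold freq, den. rewrite Cp. replace (1 - 2 * mu * X + mu ^ 2) with ((1 - mu ^ 2) / a) by (rewrite <- muX; ring).
      field. lra.
    + apply gamma2_inner; auto.
      * unfold freq, den. fold mu. rewrite Cp. replace (1 - 2 * mu * X + mu ^ 2) with ((1 - mu ^ 2) / a) by (rewrite <- muX; ring).
        field. lra.
      * destruct (z_circle lambda a) as [-> _]; [fold x; rewrite x2; lra|]. fold x. rewrite x2, <- Sp. rewrite ex.
        unfold cis, Cmult, RtoC; simpl. destruct Hor as [-> | ->].
        -- rewrite !Rmult_1_l, Cp. f_equal; ring.
        -- replace (-1 * p) with (- p) by ring. rewrite cos_neg, sin_neg, Cp. f_equal; ring.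
      * destruct (z_circle lambda a) as [_ ->]; [fold x; rewrite x2; lra|]. fold x. rewrite x2, <- Sp. rewrite ex.
        unfold cis, Cmult, RtoC; simpl. destruct Hor as [-> | ->].
        -- rewrite !Rmult_1_l, cos_neg, sin_neg, Cp. f_equal; ring.
        -- replace (- (-1 * p)) with p by ring. rewrite Cp. f_equal; ring.
      * fold x. rewrite x2. lra.
  - right; left. split; [exact Hka|].
    assert (Z : gamma2 log lambda a ^ 3 = 0).
    { unfold gamma2. rewrite cbrt_cube, Re_square, gamma3_re, gamma3_im.
      destruct (z_circle lambda a) as [-> ->]; [fold x; rewrite x2, HX; lra|]. fold x. rewrite x2, HX.
      replace (1 - 1 ^ 2) with 0 by ring. rewrite sqrt_0, Ropp_0. ring. }
    assert (Z2 : gamma2 log lambda a * (gamma2 log lambda a * gamma2 log lambda a) = 0) by (simpl in Z; lra).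
    apply Rmult_integral in Z2. destruct Z2 as [Z2|Z2]; [exact Z2|].
    apply Rmult_integral in Z2. tauto.
Qed.

(** * Asymptotic equivalence along sequences *)

Lemma Rpower_nat (u x : R) (m : nat) : Rpower u x ^ m = Rpower u (x * INR m).
Proof. rewrite <- Rpower_mult, Rpower_pow; [reflexivity|apply exp_pos]. Qed.

Lemma Rpower_nat_eq (u x : R) (m j : nat) : 0 < u -> x * INR m = INR j -> Rpower u x ^ m = u ^ j.
Proof. intros Hu E. rewrite Rpower_nat, E. now apply Rpower_pow. Qed.

Lemma pow3_inj (x y : R) : x ^ 3 = y ^ 3 -> x = y.
Proof.
  intros E. assert (F : (x - y) * (x ^ 2 + x * y + y ^ 2) = 0) by (transitivity (x ^ 3 - y ^ 3); [ring|lra]).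
  apply Rmult_integral in F. destruct F as [F|F]; [lra|].
  assert (Y : y * y = 0) by nra. apply Rmult_integral in Y. assert (y = 0) by tauto. subst y.
  assert (X : x * x = 0) by nra. apply Rmult_integral in X. tauto.
Qed.

(** With [y^3 = 3 / 2 n V], the cube of [x = n^(2/3) gamma^2] is [+- y^6]; so
    [x = y^2] or [x = - y^2], depending on the side of the edge. *)
Lemma edge_uniform (e lambda : R) (log : C -> C) : branch e log -> 0 < lambda < 1 ->
  forall eps, 0 < eps -> exists d w0, 0 < d /\ 0 < w0 /\ forall (n k : nat) (w : R), (0 < n)%nat ->
  w0 <= w -> w ^ 3 = INR n * edge_curv (e * lambda) e ->
  Rabs (INR k / INR n - edge (e * lambda)) < d ->
  let x := Rpower (INR n) (2 / 3) * gamma2 log lambda (INR k / INR n) in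
  (0 <= x -> 0 < Ai x /\ Rabs (coef (e * lambda) n k * w / Ai x - 1) <= eps) /\
  (x < 0 -> Rabs (coef (e * lambda) n k * w - Ai x) * sqrt (1 + sqrt (- x)) <= eps).
Proof.
  intros Hb Hl eps Heps. assert (Hs := branch_edge_sign e lambda log Hb Hl).
  set (mu := e * lambda) in *.
  destruct (edge_outer mu e Hs eps Heps) as (r1 & w1 & Hr1 & Hw1 & Out).
  destruct (edge_exact mu e Hs eps Heps) as (w2 & Hw2 & Ex).
  destruct (edge_inner mu e Hs eps Heps) as (r3 & w3 & Hr3 & Hw3 & Inn).
  destruct (edge_ratios mu e Hs 1 ltac:(lra)) as (r4 & Hr4 & Rat).
  destruct (edge_ratios_h mu e Hs 1 ltac:(lra)) as (r5 & Hr5 & Rath).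
  destruct (gamma2_cases e lambda log Hb Hl (Rmin (Rmin r1 r3) (Rmin r4 r5))) as (d & Hd & Cases).
  { repeat apply Rmin_glb_lt; lra. }
  assert (M1 := Rmin_l (Rmin r1 r3) (Rmin r4 r5)). assert (M2 := Rmin_r (Rmin r1 r3) (Rmin r4 r5)).
  assert (M3 := Rmin_l r1 r3). assert (M4 := Rmin_r r1 r3). assert (M5 := Rmin_l r4 r5). assert (M6 := Rmin_r r4 r5).
  exists d, (w1 + w2 + w3). split; [exact Hd|]. split; [lra|].
  intros n k w Hn Hw Hwc Ha x. set (a := INR k / INR n) in *. fold mu in Cases.
  assert (HN : 0 < INR n) by (apply lt_0_INR; exact Hn).
  assert (Ek : INR k = INR n * a) by (unfold a; field; lra).
  assert (X3 : x ^ 3 = INR n ^ 2 * gamma2 log lambda a ^ 3).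
  { unfold x. rewrite Rpow_mult_distr. f_equal. apply Rpower_nat_eq; [lra|simpl; field]. }
  destruct (Cases a Ha) as (Ha0 & [(r & Hr & Er & _ & G)|[(Ea & G)|(p & Hp & Ep & _ & G)]]).
  - destruct (Rath r ltac:(lra)) as (_ & HV & _).
    set (V := heighth mu e r) in *. set (y := Rpower (3 / 2 * (INR n * V)) (1 / 3)).
    assert (Hy : 0 < y) by apply exp_pos.
    assert (Y3 : y ^ 3 = 3 / 2 * (INR n * V)).
    { transitivity ((3 / 2 * (INR n * V)) ^ 1); [|ring]. apply Rpower_nat_eq; [|simpl; field].
      apply Rmult_lt_0_compat; [lra|now apply Rmult_lt_0_compat]. }
    assert (Exy : x = y ^ 2).
    { apply pow3_inj. rewrite X3, G. replace ((y ^ 2) ^ 3) with ((y ^ 3) ^ 2) by ring. rewrite Y3. field. }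
    rewrite Exy. split.
    + intros _. split; [apply Ai_pos; lra|]. apply (Out n k w r y); auto; try lra.
      rewrite Ek. f_equal. exact Er.
    + intros Hneg. assert (0 < y ^ 2) by (apply pow_lt; lra). lra.
  - assert (Ex0 : x = 0) by (unfold x; rewrite G; ring). rewrite Ex0. split; [|lra].
    intros _. split; [assert (T := Ai_pos 0 ltac:(lra)); replace (0 ^ 2) with 0 in T by ring; exact T|].
    apply Ex; auto; try lra. rewrite Ek. f_equal. exact Ea.
  - destruct (Rat p ltac:(lra)) as (_ & HV & _).
    set (V := height mu e p) in *. set (y := Rpower (3 / 2 * (INR n * V)) (1 / 3)).
    assert (Hy : 0 < y) by apply exp_pos.
    assert (Y3 : y ^ 3 = 3 / 2 * (INR n * V)).
    { transitivity ((3 / 2 * (INR n * V)) ^ 1); [|ring]. apply Rpower_nat_eq; [|simpl; field].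
      apply Rmult_lt_0_compat; [lra|now apply Rmult_lt_0_compat]. }
    assert (Exy : x = - y ^ 2).
    { apply pow3_inj. rewrite X3, G. replace ((- y ^ 2) ^ 3) with (- (y ^ 3) ^ 2) by ring. rewrite Y3. field. }
    assert (0 < y ^ 2) by (apply pow_lt; lra).
    rewrite Exy. split; [lra|]. intros _.
    rewrite Ropp_involutive, sqrt_pow2 by lra. apply (Inn n k w p y); auto; try lra.
    rewrite Ek. f_equal. exact Ep.
Qed.

Lemma is_lim_seq_close (u : nat -> R) (l eps : R) : is_lim_seq u l -> 0 < eps ->
  eventually (fun n => Rabs (u n - l) < eps).
Proof. intros H Heps. apply is_lim_seq_spec in H. exact (H (mkposreal eps Heps)). Qed.

Lemma eventually_large (M : R) : eventually (fun n => M < INR n).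
Proof.
  assert (H := is_lim_seq_INR). apply is_lim_seq_spec in H. apply H.
Qed.

Lemma eventually_pos : eventually (fun n => (0 < n)%nat).
Proof. exists 1%nat. intros n Hn. lia. Qed.

(** Dividing by the weight of the oscillatory regime costs at most the factor
    that the uniform estimate controls. *)
Lemma weight_bound (x : R) : x < 0 ->
  0 < / Rpower (1 + Rabs x) (- (1 / 4)) <= sqrt (1 + sqrt (- x)).
Proof.
  intros Hx. rewrite Rpower_Ropp, Rinv_inv. split; [apply exp_pos|].
  assert (S := sqrt_pos (- x)). assert (SS := sqrt_sqrt (- x) ltac:(lra)).
  apply (le_of_pow_le 3); [apply sqrt_pos|].
  rewrite (Rpower_nat_eq _ _ 4 1) by (try (simpl; field); assert (T := Rabs_pos x); lra).
  rewrite Rabs_left by exact Hx.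
  replace (sqrt (1 + sqrt (- x)) ^ 4) with ((sqrt (1 + sqrt (- x)) * sqrt (1 + sqrt (- x))) ^ 2) by ring.
  rewrite sqrt_sqrt by lra. nra.
Qed.

(** The uniform estimate is normalized by [w = (n b)^(1/3)], while the amplitude
    is expressed through [k / n]; by hypothesis the product of both tends to 1.
    The signs [s n] are [(-1)^(n - k)] at the lower edge and 1 at the upper. *)
Lemma edge_equiv_Ai (e lambda : R) (log : C -> C) (f : nat -> C) (k : nat -> nat) (A s : nat -> R) :
  branch e log -> 0 < lambda < 1 ->
  (forall n, f n = RtoC (s n * coef (e * lambda) n (k n))) -> (forall n, s n * s n = 1) ->
  is_lim_seq (fun n => INR (k n) / INR n) (edge (e * lambda)) ->
  is_lim_seq (fun n => s n * A n * Rpower (INR n * edge_curv (e * lambda) e) (1 / 3)) 1 ->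
  equiv_Ai f A (fun n => Rpower (INR n) (2 / 3) * gamma2 log lambda (INR (k n) / INR n)).
Proof.
  intros Hb Hl Hf Hs2 Hk HA. assert (Hs := branch_edge_sign e lambda log Hb Hl).
  set (mu := e * lambda) in *. assert (Hbeta := edge_curv_pos mu e Hs).
  set (b := edge_curv mu e) in *.
  set (x := fun n => Rpower (INR n) (2 / 3) * gamma2 log lambda (INR (k n) / INR n)).
  set (w := fun n => Rpower (INR n * b) (1 / 3)).
  set (t := fun n => s n * A n * w n).
  assert (Uni : forall eps, 0 < eps -> eventually (fun n =>
     0 < w n /\ Rabs (t n - 1) < eps /\
     (0 <= x n -> 0 < Ai (x n) /\ Rabs (coef mu n (k n) * w n / Ai (x n) - 1) <= eps) /\
     (x n < 0 -> Rabs (coef mu n (k n) * w n - Ai (x n)) * sqrt (1 + sqrt (- x n)) <= eps))).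
  { intros eps Heps. destruct (edge_uniform e lambda log Hb Hl eps Heps) as (d & w0 & Hd & Hw0 & U).
    generalize (filter_and _ _ (is_lim_seq_close _ _ _ HA Heps)
      (filter_and _ _ (is_lim_seq_close _ _ _ Hk Hd)
      (filter_and _ _ eventually_pos (eventually_large (w0 ^ 3 / b))))).
    apply filter_imp. intros n (H1 & H2 & H3 & H4).
    assert (HN : 0 < INR n) by (apply lt_0_INR; exact H3).
    assert (W : 0 < w n) by apply exp_pos.
    assert (W3 : w n ^ 3 = INR n * b).
    { transitivity ((INR n * b) ^ 1); [|ring].
      apply Rpower_nat_eq; [now apply Rmult_lt_0_compat|simpl; field]. }
    assert (W0 : w0 <= w n).
    { apply (le_of_pow_le 2); [lra|]. rewrite W3.
      apply Rle_trans with (w0 ^ 3 / b * b); [right; field; lra|]. apply Rmult_le_compat_r; lra. }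
    split; [exact W|]. split; [exact H1|]. exact (U n (k n) (w n) H3 W0 W3 H2). }
  assert (At : forall n, 0 < w n -> 1 / 2 < t n -> A n <> 0 /\ s n <> 0 /\ s n / A n = w n / t n).
  { intros n Hw Ht. assert (HAn : A n <> 0). { intros Z. unfold t in Ht. rewrite Z in Ht. lra. }
    assert (Hsn : s n <> 0). { intros Z. specialize (Hs2 n). rewrite Z in Hs2. lra. }
    repeat split; auto. unfold t. apply (Rmult_eq_reg_r (s n)); auto.
    replace (s n / A n * s n) with ((s n * s n) / A n) by (field; exact HAn).
    rewrite Hs2. field. repeat split; auto; lra. }
  split.
  - intros P [eps HP]. unfold filtermap, within.
    set (d := Rmin (1 / 20) (eps / 8)).
    assert (Hd : 0 < d /\ d <= 1 / 20 /\ 4 * d < eps).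
    { assert (E := cond_pos eps). assert (D1 := Rmin_l (1 / 20) (eps / 8)). assert (D2 := Rmin_r (1 / 20) (eps / 8)).
      fold d in D1, D2. assert (0 < d) by (apply Rmin_glb_lt; lra). lra. }
    generalize (Uni d ltac:(lra)). apply filter_imp. intros n (W & T & Hpos & _) Hx.
    destruct (Hpos Hx) as [PAi R]. assert (T' := T). apply Rabs_def2 in T'.
    destruct (At n W ltac:(lra)) as (HAn & Hsn & E).
    assert (Q := quotient_close _ _ 1 d ltac:(lra) R (Rlt_le _ _ T)
      ltac:(replace (1 - 1) with 0 by ring; rewrite Rabs_R0; lra)).
    rewrite Rmult_1_r in Q.
    replace (coef mu n (k n) * w n / Ai (x n) / t n) with (s n * coef mu n (k n) / (A n * Ai (x n))) in Q.
    2:{ transitivity (s n / A n * (coef mu n (k n) / Ai (x n))); [field; split; [lra|exact HAn]|].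
        rewrite E. field. lra. }
    apply HP. rewrite Hf. fold x. change (Rpower (INR n) (2 / 3) * gamma2 log lambda (INR (k n) / INR n)) with (x n).
    rewrite <- RtoC_div.
    2:{ apply Rmult_integral_contrapositive_currified; [exact HAn|lra]. }
    split; simpl.
    + change (Rabs (s n * coef mu n (k n) / (A n * Ai (x n)) - 1) < eps). lra.
    + change (Rabs (0 - 0) < eps). rewrite Rminus_0_r, Rabs_R0. apply cond_pos.
  - destruct Ai_neg_bound as (C & HC & BC).
    set (wt := fun n => Rpower (1 + Rabs (x n)) (- (1 / 4))).
    exists (fun n => if Rlt_dec (x n) 0 then (s n * coef mu n (k n) / A n - Ai (x n)) / wt n else 0).
    split.
    + apply is_lim_seq_spec. intros eps. assert (Pe := cond_pos eps).
      set (d := Rmin (1 / 4) (eps / (4 * (1 + C)))).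
      assert (Hd : 0 < d /\ d <= 1 / 4 /\ d * (4 * (1 + C)) <= eps).
      { assert (0 < eps / (4 * (1 + C))) by (apply Rdiv_lt_0_compat; lra).
        assert (D1 := Rmin_l (1 / 4) (eps / (4 * (1 + C)))). assert (D2 := Rmin_r (1 / 4) (eps / (4 * (1 + C)))).
        fold d in D1, D2. assert (0 < d) by (apply Rmin_glb_lt; lra). repeat split; try lra.
        apply Rle_trans with (eps / (4 * (1 + C)) * (4 * (1 + C))); [apply Rmult_le_compat_r; lra|].
        right. field. lra. }
      generalize (Uni d ltac:(lra)). apply filter_imp. intros n (W & T & _ & Hneg).
      rewrite Rminus_0_r. destruct (Rlt_dec (x n) 0) as [Hx|Hx]; [|rewrite Rabs_R0; lra].
      specialize (Hneg Hx). assert (T' := T). apply Rabs_def2 in T'.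
      destruct (At n W ltac:(lra)) as (HAn & Hsn & E).
      destruct (weight_bound (x n) Hx) as [W1 W2]. fold (wt n) in W1, W2.
      assert (B := BC (sqrt (- x n)) (sqrt_pos _)).
      rewrite pow2_sqrt, Ropp_involutive in B by lra.
      set (q := sqrt (1 + sqrt (- x n))) in *.
      replace ((s n * coef mu n (k n) / A n - Ai (x n)) / wt n)
        with (((coef mu n (k n) * w n - Ai (x n)) + (1 - t n) * Ai (x n)) * / t n * / wt n).
      2:{ unfold Rdiv at 1. f_equal. transitivity (s n / A n * coef mu n (k n) - Ai (x n)); [|field; exact HAn].
          rewrite E. field. lra. }
      rewrite !Rabs_mult, (Rabs_pos_eq (/ wt n)) by lra.
      rewrite (Rabs_pos_eq (/ t n)) by (left; apply Rinv_0_lt_compat; lra).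
      assert (It : 0 < / t n <= 2).
      { split; [apply Rinv_0_lt_compat; lra|]. replace 2 with (/ (1 / 2)) by field. apply Rinv_le_contravar; lra. }
      set (u := coef mu n (k n) * w n - Ai (x n)) in *.
      assert (Nn : Rabs (u + (1 - t n) * Ai (x n)) * / wt n <= d * (1 + C)).
      { apply Rle_trans with ((Rabs u + d * Rabs (Ai (x n))) * q).
        - apply Rmult_le_compat; try lra; [apply Rabs_pos|].
          eapply Rle_trans; [apply Rabs_triang|]. apply Rplus_le_compat_l.
          rewrite Rabs_mult. apply Rmult_le_compat_r; [apply Rabs_pos|].
          rewrite Rabs_minus_sym. lra.
        - replace ((Rabs u + d * Rabs (Ai (x n))) * q) with (Rabs u * q + d * (Rabs (Ai (x n)) * q)) by ring.
          assert (d * (Rabs (Ai (x n)) * q) <= d * C) by (apply Rmult_le_compat_l; lra). lra. }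
      replace (Rabs (u + (1 - t n) * Ai (x n)) * / t n * / wt n)
        with ((Rabs (u + (1 - t n) * Ai (x n)) * / wt n) * / t n) by ring.
      apply Rle_lt_trans with (d * (1 + C) * 2).
      * apply Rmult_le_compat; try lra. apply Rmult_le_pos; [apply Rabs_pos|lra].
      * assert (0 < d * (1 + C)) by (apply Rmult_lt_0_compat; lra). lra.
    + generalize (Uni (1 / 4) ltac:(lra)). apply filter_imp. intros n (W & T & _) Hx.
      change (Rpower (INR n) (2 / 3) * gamma2 log lambda (INR (k n) / INR n)) with (x n) in *.
      apply Rabs_def2 in T. destruct (At n W ltac:(lra)) as (HAn & _ & _).
      destruct (Rlt_dec (x n) 0) as [_|N]; [|lra].
      rewrite Hf. f_equal. fold (wt n). field. split; [exact HAn|].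
      unfold wt. apply Rgt_not_eq, exp_pos.
Qed.

(** The cube of the quotient is the inverse of the second ratio of the saddle
    geometry, on both sides of the edge. *)
Lemma gamma2_linear (e lambda c : R) (log : C -> C) : branch e log -> 0 < lambda < 1 ->
  0 < c -> c ^ 3 * edge_curv (e * lambda) e = 1 ->
  is_lim (fun a => gamma2 log lambda a / (e * (a - edge (e * lambda)) * c)) (edge (e * lambda)) 1.
Proof.
  intros Hb Hl Hc Hc3. assert (Hs := branch_edge_sign e lambda log Hb Hl).
  set (mu := e * lambda) in *. assert (Hbeta := edge_curv_pos mu e Hs).
  set (b := edge_curv mu e) in *.
  apply is_lim_spec. intros eps. assert (Pe := cond_pos eps).
  set (eta := Rmin (1 / 2) (eps / 4)).
  assert (Heta : 0 < eta /\ eta <= 1 / 2 /\ 2 * eta < eps).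
  { assert (D1 := Rmin_l (1 / 2) (eps / 4)). assert (D2 := Rmin_r (1 / 2) (eps / 4)).
    fold eta in D1, D2. assert (0 < eta) by (apply Rmin_glb_lt; lra). lra. }
  destruct (edge_ratios mu e Hs eta ltac:(lra)) as (r4 & Hr4 & Rat).
  destruct (edge_ratios_h mu e Hs eta ltac:(lra)) as (r5 & Hr5 & Rath).
  destruct (gamma2_cases e lambda log Hb Hl (Rmin r4 r5) ltac:(apply Rmin_glb_lt; lra)) as (d & Hd & Cases).
  assert (M4 := Rmin_l r4 r5). assert (M5 := Rmin_r r4 r5).
  exists (mkposreal d Hd). intros a Ha Hne. fold mu in Cases.
  change (Rabs (a - edge mu) < d) in Ha.
  set (g := gamma2 log lambda a) in *.
  assert (Key : forall V D sg, 0 < V -> 0 < D -> sg * sg = 1 -> g ^ 3 = sg * (9 / 4) * V ^ 2 ->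
     e * (a - edge mu) = sg * D -> Rabs (4 / 9 * D ^ 3 / (b * V ^ 2) - 1) <= eta ->
     Rabs (g / (e * (a - edge mu) * c) - 1) < eps).
  { intros V D sg HV HD Hsg Hg HDe Hq. rewrite HDe.
    assert (Hsg0 : sg <> 0) by (intros Z; rewrite Z in Hsg; lra).
    assert (Cube : (g / (sg * D * c)) ^ 3 = / (4 / 9 * D ^ 3 / (b * V ^ 2))).
    { replace ((g / (sg * D * c)) ^ 3) with (g ^ 3 / ((sg * sg) * sg * D ^ 3 * c ^ 3)) by (field; repeat split; lra).
      rewrite Hg, Hsg. apply (Rmult_eq_reg_r (c ^ 3 * b)); [|lra].
      rewrite Hc3 at 2. field. repeat split; try lra. }
    set (q := 4 / 9 * D ^ 3 / (b * V ^ 2)) in *. apply Rabs_le_between in Hq.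
    assert (Iq : 0 < / q <= 2).
    { split; [apply Rinv_0_lt_compat; lra|]. replace 2 with (/ (1 / 2)) by field. apply Rinv_le_contravar; lra. }
    assert (Pos : 0 < g / (sg * D * c)).
    { apply Rnot_le_lt. intros L. set (z := g / (sg * D * c)) in *.
      assert (Z3 : z ^ 3 <= 0).
      { replace (z ^ 3) with (z * z ^ 2) by ring. assert (T := pow2_ge_0 z). clear - T L. nra. }
      lra. }
    apply Rle_lt_trans with (2 * eta); [|lra].
    apply (near_one_of_pow _ _ 2); [exact Pos|]. rewrite Cube.
    replace (/ q - 1) with ((1 - q) * / q) by (field; lra).
    rewrite Rabs_mult, (Rabs_pos_eq (/ q)) by lra.
    assert (Rabs (1 - q) <= eta) by (apply Rabs_le; lra). replace (2 * eta) with (eta * 2) by ring.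
    apply Rmult_le_compat; try lra. apply Rabs_pos. }
  destruct (Cases a Ha) as (Ha0 & [(r & Hr & Er & _ & G)|[(Ea & G)|(p & Hp & Ep & _ & G)]]).
  - destruct (Rath r ltac:(lra)) as (_ & HV & HD & _ & _ & Q). fold b in Q. fold g in G.
    apply (Key (heighth mu e r) (gaph mu e r) 1); auto; try lra.
    unfold gaph. rewrite <- Er. ring.
  - exfalso. apply Hne. exact Ea.
  - destruct (Rat p ltac:(lra)) as (_ & HV & HD & _ & _ & Q). fold b in Q. fold g in G.
    apply (Key (height mu e p) (gap mu e p) (-1)); auto; try lra.
    unfold gap. rewrite <- Ep. ring.
Qed.

(** At the edge itself, the amplitude and [(n b) ^ (1 / 3)] cancel; elsewhere they
    do so in the limit. *)
Lemma amplitude_limit (e lambda : R) (a : nat -> R) : e = 1 \/ e = -1 -> 0 < lambda < 1 ->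
  is_lim_seq a (edge (e * lambda)) ->
  is_lim_seq (fun n => sqrt 2 * (Rpower (1 - e * lambda) (1 / 4) / Rpower (lambda * (1 + e * lambda)) (1 / 12))
     * Rpower (edge_curv (e * lambda) e) (1 / 3)
     * (1 / (sqrt (a n) * Rpower (e * (a n - edge (- (e * lambda)))) (1 / 4)))) 1.
Proof.
  intros He Hl Ha.
  assert (Hs : edge_sign (e * lambda) e) by (destruct He as [-> | ->]; [left|right]; split; lra).
  assert (Hm : -1 < e * lambda < 1) by apply (edge_sign_facts _ _ Hs).
  assert (Hbeta := edge_curv_pos _ e Hs).
  set (mu := e * lambda) in *. set (b := edge_curv mu e) in *.
  set (kp := edge mu) in *.
  assert (Hk : 0 < kp) by (apply Rdiv_lt_0_compat; lra).
  assert (Hd : e * (kp - edge (- mu)) = 4 * lambda / ((1 - mu) * (1 + mu))).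
  { unfold kp, edge, mu. destruct He as [-> | ->]; field; lra. }
  assert (Hd0 : 0 < e * (kp - edge (- mu))).
  { rewrite Hd. apply Rdiv_lt_0_compat; [lra|apply Rmult_lt_0_compat; lra]. }
  set (K := sqrt 2 * (Rpower (1 - mu) (1 / 4) / Rpower (lambda * (1 + mu)) (1 / 12)) * Rpower b (1 / 3)).
  set (phi := fun a => K * (1 / (sqrt a * Rpower (e * (a - edge (- mu))) (1 / 4)))).
  assert (S2 : 0 < sqrt 2) by (apply sqrt_lt_R0; lra).
  assert (Sk : 0 < sqrt kp) by (apply sqrt_lt_R0; lra).
  assert (Hlm : 0 < lambda * (1 + mu)) by (apply Rmult_lt_0_compat; lra).
  assert (E : phi kp = 1).
  { assert (T : Rabs (phi kp - 1) <= 0); [|assert (T2 := Rabs_pos (phi kp - 1));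
      assert (T3 : Rabs (phi kp - 1) = 0) by lra; apply Rabs_eq_0 in T3; lra].
    (* 12 is a common denominator of the exponents 1/2, 1/3, 1/4, 1/12. *)
    apply (near_one_of_pow _ _ 11).
    - unfold phi, K, Rdiv. rewrite Rmult_1_l.
      repeat apply Rmult_lt_0_compat; try lra; try apply exp_pos; apply Rinv_0_lt_compat;
        [apply exp_pos|apply Rmult_lt_0_compat; [lra|apply exp_pos]].
    - replace (phi kp ^ 12) with
        ((sqrt 2 * sqrt 2) ^ 6 * (Rpower (1 - mu) (1 / 4) ^ 12 / Rpower (lambda * (1 + mu)) (1 / 12) ^ 12)
         * Rpower b (1 / 3) ^ 12
         * (1 / ((sqrt kp * sqrt kp) ^ 6 * Rpower (e * (kp - edge (- mu))) (1 / 4) ^ 12))).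
      2:{ unfold phi, K. field. repeat split; try lra; apply Rgt_not_eq, exp_pos. }
      rewrite !sqrt_sqrt by lra.
      rewrite (Rpower_nat_eq (1 - mu) (1 / 4) 12 3) by (try (simpl; field); lra).
      rewrite (Rpower_nat_eq (lambda * (1 + mu)) (1 / 12) 12 1) by (try (simpl; field); lra).
      rewrite (Rpower_nat_eq b (1 / 3) 12 4) by (try (simpl; field); lra).
      rewrite (Rpower_nat_eq (e * (kp - edge (- mu))) (1 / 4) 12 3) by (try (simpl; field); lra).
      rewrite Hd. unfold b, edge_curv, kp, edge.
      replace (e * mu) with lambda by (unfold mu; destruct He as [-> | ->]; ring).
      replace (_ - 1) with 0; [rewrite Rabs_R0; lra|].
      field. repeat split; lra. }
  apply (is_lim_seq_ext (fun n => phi (a n))); [reflexivity|].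
  rewrite <- E. apply is_lim_seq_continuous; [|exact Ha].
  apply continuity_pt_filterlim.
  apply (continuous_mult (fun _ => K) (fun a => 1 / (sqrt a * Rpower (e * (a - edge (- mu))) (1 / 4)))).
  { apply continuous_const. }
  unfold Rpower. apply (ex_derive_continuous (fun a => 1 / (sqrt a * exp (1 / 4 * ln (e * (a - edge (- mu))))))).
  auto_derive. repeat split; auto; try lra.
  apply Rmult_integral_contrapositive_currified; [lra|apply Rgt_not_eq, exp_pos].
Qed.

(** * Between the edges *)

Lemma cis_Carg_cis (g : R) : cis (Carg (cis g)) = cis g.
Proof.
  assert (T := sin2_cos2 g). assert (CB := COS_bound g).
  assert (M : Cmod (cis g) = 1).
  { unfold Cmod, cis; simpl. replace (cos g * (cos g * 1) + sin g * (sin g * 1)) with 1; [apply sqrt_1|].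
    unfold Rsqr in T. lra. }
  assert (S : sqrt (1 - (cos g)²) = Rabs (sin g)).
  { rewrite <- sqrt_Rsqr_abs. f_equal. lra. }
  unfold Carg. rewrite M. unfold Re, Im, cis; simpl. rewrite Rdiv_1_r.
  destruct (Rle_dec 0 (sin g)) as [H|H].
  - rewrite cos_acos, sin_acos, S, Rabs_pos_eq by lra. reflexivity.
  - rewrite cos_neg, sin_neg, cos_acos, sin_acos, S, Rabs_left by lra. now rewrite Ropp_involutive.
Qed.

(** This makes the choice of the argument in [h] immaterial. *)
Lemma cos_nat_mult_eq (n : nat) (g g' c : R) : cis g = cis g' ->
  cos (INR n * g - c) = cos (INR n * g' - c).
Proof.
  intros E. assert (F : cis (INR n * g) = cis (INR n * g')) by (rewrite <- !cis_pow, E; reflexivity).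
  injection F as F1 F2. rewrite !cos_minus, F1, F2. reflexivity.
Qed.

Lemma edge_alpha0_inv (lambda : R) : 0 < lambda < 1 -> edge lambda = / alpha0 lambda.
Proof. intros Hl. unfold edge, alpha0. field. lra. Qed.

Lemma edge_alpha0 (lambda : R) : edge (- lambda) = alpha0 lambda.
Proof. unfold edge, alpha0. f_equal; ring. Qed.

Lemma sqrt_ge_of_sq (x y : R) : 0 <= y -> y ^ 2 <= x -> y <= sqrt x.
Proof. intros Hy H. rewrite <- (sqrt_pow2 y) by lra. now apply sqrt_le_1_alt. Qed.

(** All from [cos p = saddle_x lambda a] and the factorization of
    [1 - saddle_x^2] into the distances of [a] to the two edges. *)
Lemma stationary_point (lambda a : R) : 0 < lambda < 1 -> alpha0 lambda < a < / alpha0 lambda ->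
  let p := phi_plus lambda a in
  let D := (/ alpha0 lambda - a) * (a - alpha0 lambda) in
  0 < p < PI /\ freq lambda p = a /\ sin p = (1 - lambda ^ 2) * sqrt D / (2 * lambda * a) /\
  curv lambda 1 p = a * sqrt D /\ cis (h lambda a p) = cis (height lambda 1 p).
Proof.
  intros Hl Ha p D. assert (Hp := alpha0_pos lambda Hl).
  assert (HD : 0 < D) by (apply Rmult_lt_0_compat; lra).
  assert (Hla : 0 < 2 * lambda * a) by (apply Rmult_lt_0_compat; lra).
  destruct (phi_plus_spec lambda a Hl ltac:(lra)) as [Pb Pc]. fold p in Pb, Pc.
  assert (Em := saddle_x_minus lambda a Hl ltac:(lra)). assert (Ep := saddle_x_plus lambda a Hl ltac:(lra)).
  assert (SD := saddle_den lambda a Hl ltac:(lra)).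
  set (x := saddle_x lambda a) in *.
  assert (Sq : 1 - x ^ 2 = ((1 - lambda ^ 2) / (2 * lambda * a)) ^ 2 * D).
  { replace (1 - x ^ 2) with (- ((x + 1) * (x - 1))) by ring. rewrite Em, Ep. unfold D. field. split; lra. }
  assert (Fac : 0 < (1 - lambda ^ 2) / (2 * lambda * a)) by (apply Rdiv_lt_0_compat; [nra|lra]).
  assert (Sq0 : 0 < 1 - x ^ 2).
  { rewrite Sq. apply Rmult_lt_0_compat; [apply pow_lt|]; lra. }
  assert (SD0 : 0 < sqrt D) by now apply sqrt_lt_R0.
  destruct (z_circle lambda a) as [Z _]; [fold x; lra|]. fold x in Z. rewrite Z in Pc.
  injection Pc as Cp Sp.
  assert (Sp' : sin p = (1 - lambda ^ 2) * sqrt D / (2 * lambda * a)).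
  { replace (1 - x * (x * 1)) with (1 - x ^ 2) in Sp by ring.
    rewrite Sp, Sq, sqrt_mult, sqrt_pow2 by (try apply pow_le; lra). field. lra. }
  assert (Sp0 : 0 < sin p).
  { rewrite Sp'. apply Rdiv_lt_0_compat; [apply Rmult_lt_0_compat; [nra|lra]|lra]. }
  assert (Den : den lambda p = (1 - lambda ^ 2) / a).
  { rewrite <- SD. unfold den. rewrite Cp. ring. }
  assert (L2 : 0 < 1 - lambda ^ 2) by nra.
  assert (Fr : freq lambda p = a) by (unfold freq; rewrite Den; field; lra).
  repeat split; auto.
  - destruct (Req_dec p 0) as [E|E]; [rewrite E, sin_0 in Sp0; lra|lra].
  - destruct (Req_dec p PI) as [E|E]; [rewrite E, sin_PI in Sp0; lra|lra].
  - unfold curv. rewrite Den, Sp'. field. repeat split; lra.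
  - unfold h. rewrite blaschke_cis by lra. rewrite <- cis_plus, cis_Carg_cis.
    f_equal. unfold height. rewrite Fr. ring.
Qed.

Lemma middle_amplitude (lambda a N : R) : 0 < N -> alpha0 lambda < a < / alpha0 lambda -> 0 < a ->
  let D := (/ alpha0 lambda - a) * (a - alpha0 lambda) in
  sqrt (2 / (N * PI)) * (1 / (sqrt a * Rpower D (1 / 4))) * sqrt (N * (a * sqrt D)) = sqrt (2 / PI).
Proof.
  intros HN Ha Ha0 D. assert (PP := PI_RGT_0).
  assert (HD : 0 < D) by (apply Rmult_lt_0_compat; lra).
  assert (SD : 0 < sqrt D) by now apply sqrt_lt_R0.
  assert (R4 : Rpower D (1 / 4) = sqrt (sqrt D)).
  { rewrite <- (Rpower_sqrt (sqrt D)), <- (Rpower_sqrt D), Rpower_mult by lra. f_equal. field. }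
  rewrite R4.
  replace (2 / (N * PI)) with (2 / PI * / N) by (field; lra).
  assert (0 < 2 / PI) by (apply Rdiv_lt_0_compat; lra).
  assert (IN : 0 < / N) by now apply Rinv_0_lt_compat.
  assert (E : sqrt (/ N) * sqrt N = 1).
  { rewrite <- sqrt_mult by lra. rewrite Rinv_l by lra. apply sqrt_1. }
  rewrite (sqrt_mult (2 / PI)), (sqrt_mult N), (sqrt_mult a) by (try apply Rmult_le_pos; lra).
  assert (0 < sqrt a) by now apply sqrt_lt_R0. assert (0 < sqrt (sqrt D)) by now apply sqrt_lt_R0.
  transitivity (sqrt (2 / PI) * (sqrt (/ N) * sqrt N)); [field; lra|rewrite E; ring].
Qed.

(** With [v = omega n / n], the square of [sin p] is at least [c0 v], so that
    [n (sin p)^3] dominates [(omega n / n^(1/3))^(3/2)] and tends to infinity. *)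
Lemma middle_range (lambda : R) (omega : nat -> R) (k : nat -> nat) : 0 < lambda < 1 ->
  (forall n : nat, (1 <= n)%nat -> 0 < omega n) ->
  is_lim_seq (fun n => omega n / Rpower (INR n) (1 / 3)) p_infty ->
  eventually (fun n =>
    alpha0 lambda * INR n + omega n <= INR (k n) <= / alpha0 lambda * INR n - omega n) ->
  equiv_osc
    (fun n => fourier_coef lambda n (k n))
    (fun n => sqrt (2 / (INR n * PI))
       * (1 / (sqrt (INR (k n) / INR n)
               * Rpower ((/ alpha0 lambda - INR (k n) / INR n)
                         * (INR (k n) / INR n - alpha0 lambda)) (1 / 4))))
    (fun n => cos (INR n * h lambda (INR (k n) / INR n)
                      (phi_plus lambda (INR (k n) / INR n)) - PI / 4)).
Proof.
  intros Hl Hpos Hinf Hk. assert (Hp := alpha0_pos lambda Hl). assert (PP := PI_RGT_0). assert (P4 := PI_4).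
  assert (Hs : edge_sign lambda 1) by (left; split; lra).
  set (al := alpha0 lambda) in *.
  set (a := fun n => INR (k n) / INR n).
  set (D := fun n => (/ al - a n) * (a n - al)).
  set (A := fun n => sqrt (2 / (INR n * PI)) * (1 / (sqrt (a n) * Rpower (D n) (1 / 4)))).
  set (c := fun n => cos (INR n * h lambda (a n) (phi_plus lambda (a n)) - PI / 4)).
  assert (Far : eventually (fun n => (0 < n)%nat /\ al + omega n / INR n <= a n <= / al - omega n / INR n /\ 0 < omega n)).
  { generalize (filter_and _ _ eventually_pos Hk). apply filter_imp. intros n [Hn [K1 K2]].
    assert (HN : 0 < INR n) by (apply lt_0_INR; exact Hn).
    split; [exact Hn|]. split; [|now apply Hpos]. unfold a.
    split; apply Rmult_le_reg_r with (INR n); auto.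
    - replace ((al + omega n / INR n) * INR n) with (al * INR n + omega n) by (field; lra).
      replace (INR (k n) / INR n * INR n) with (INR (k n)) by (field; lra). lra.
    - replace ((/ al - omega n / INR n) * INR n) with (/ al * INR n - omega n) by (field; lra).
      replace (INR (k n) / INR n * INR n) with (INR (k n)) by (field; lra). lra. }
  set (L := / al - al). set (c0 := ((1 - lambda ^ 2) * al / (2 * lambda)) ^ 2 * (L / 2)).
  assert (HL : 0 < L).
  { unfold L, al, alpha0. replace (/ ((1 - lambda) / (1 + lambda)) - (1 - lambda) / (1 + lambda))
      with (4 * lambda / ((1 - lambda) * (1 + lambda))) by (field; lra).
    apply Rdiv_lt_0_compat; [lra|]. apply Rmult_lt_0_compat; lra. }
  assert (Hc0 : 0 < c0).
  { apply Rmult_lt_0_compat; [|lra]. apply pow_lt. apply Rdiv_lt_0_compat; [|lra].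
    apply Rmult_lt_0_compat; [nra|lra]. }
  assert (Main : forall eps, 0 < eps -> eventually (fun n =>
     0 < A n /\ Rabs (coef lambda n (k n) / A n - c n) <= 2 * eps)).
  { intros eps Heps. destruct (coef_stationary lambda 1 Hs eps Heps) as (K & HK & St).
    assert (c03 : 0 < c0 ^ 3) by (apply pow_lt; lra).
    assert (HK2 : 0 < K ^ 2 / c0 ^ 3) by (apply Rdiv_lt_0_compat; [apply pow_lt|]; lra).
    apply is_lim_seq_spec in Hinf. generalize (filter_and _ _ Far (Hinf (1 + K ^ 2 / c0 ^ 3))).
    apply filter_imp. intros n ((Hn & Ha & Hom) & Hbig).
    assert (HN : 0 < INR n) by (apply lt_0_INR; exact Hn).
    assert (Hv : 0 < omega n / INR n) by (apply Rdiv_lt_0_compat; lra).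
    set (v := omega n / INR n) in *.
    destruct (stationary_point lambda (a n) Hl) as (Pp & Fr & Sp & Cu & Ci); [fold al; lra|].
    fold al in Sp, Cu. fold (D n) in Sp, Cu. set (p := phi_plus lambda (a n)) in *.
    assert (HD : 0 < D n) by (apply Rmult_lt_0_compat; lra).
    assert (HDv : v * (L / 2) <= D n).
    { unfold D. destruct (Rle_dec (L / 2) (a n - al)).
      - apply Rmult_le_compat; lra.
      - rewrite Rmult_comm. apply Rmult_le_compat; unfold L in *; lra. }
    assert (Sp2 : c0 * v <= sin p ^ 2).
    { rewrite Sp. assert (SD := sqrt_sqrt (D n) ltac:(lra)).
      replace (((1 - lambda ^ 2) * sqrt (D n) / (2 * lambda * a n)) ^ 2)
        with (((1 - lambda ^ 2) * / a n / (2 * lambda)) ^ 2 * (sqrt (D n) * sqrt (D n))) by (field; lra).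
      rewrite SD. unfold c0. rewrite Rmult_assoc, (Rmult_comm (L / 2)).
      apply Rmult_le_compat; try lra.
      - apply pow2_ge_0.
      - apply Rmult_le_pos; lra.
      - apply pow_incr.
        assert (Ia : al <= / a n).
        { rewrite <- (Rinv_inv al). apply Rinv_le_contravar; lra. }
        assert (L2 : 0 < 1 - lambda ^ 2) by nra.
        split; [apply Rmult_le_pos; [apply Rmult_le_pos; lra|left; apply Rinv_0_lt_compat; lra]|].
        apply Rmult_le_compat_r; [left; apply Rinv_0_lt_compat; lra|]. apply Rmult_le_compat_l; lra. }
    assert (Sp0 : 0 < sin p) by (apply sin_gt_0; lra).
    assert (Kn : K <= INR n * sin p ^ 3).
    { apply (le_of_pow_le 1); [apply Rmult_le_pos; [lra|apply pow_le; lra]|].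
      set (u := omega n / Rpower (INR n) (1 / 3)) in *.
      assert (T := pow3_ge u (K ^ 2 / c0 ^ 3) ltac:(lra) ltac:(lra)).
      assert (U3 : u ^ 3 = INR n ^ 2 * v ^ 3).
      { unfold u, v. unfold Rdiv. rewrite !Rpow_mult_distr, <- !Rinv_pow_depr.
        - rewrite (Rpower_nat_eq (INR n) (1 * / 3) 3 1) by (try (simpl; field); lra). field. lra.
        - lra.
        - apply Rgt_not_eq, exp_pos. }
      apply Rle_trans with (c0 ^ 3 * u ^ 3).
      - replace (K ^ 2) with (c0 ^ 3 * (K ^ 2 / c0 ^ 3)) by (field; lra). apply Rmult_le_compat_l; lra.
      - rewrite U3. replace (c0 ^ 3 * (INR n ^ 2 * v ^ 3)) with (INR n ^ 2 * (c0 * v) ^ 3) by ring.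
        replace ((INR n * sin p ^ 3) ^ 2) with (INR n ^ 2 * (sin p ^ 2) ^ 3) by ring.
        apply Rmult_le_compat_l; [apply pow2_ge_0|]. apply pow_incr. split; [apply Rmult_le_pos; lra|exact Sp2]. }
    specialize (St n (k n) p Pp ltac:(rewrite Fr; unfold a; field; lra) Kn).
    rewrite Cu in St.
    assert (Am := middle_amplitude lambda (a n) (INR n) HN ltac:(fold al; lra) ltac:(lra)).
    fold al in Am. cbv zeta in Am. fold (D n) in Am. fold (A n) in Am.
    assert (Ec : cos (INR n * height lambda 1 p - PI / 4) = c n).
    { unfold c. symmetry. apply cos_nat_mult_eq. exact Ci. }
    rewrite Ec in St. set (q := sqrt (INR n * (a n * sqrt (D n)))) in *.
    assert (S2 : 1 / 2 <= sqrt (2 / PI)).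
    { apply sqrt_ge_of_sq; [lra|]. apply Rmult_le_reg_r with PI; [lra|].
      unfold Rdiv. rewrite (Rmult_assoc 2), Rinv_l by lra. lra. }
    assert (Hq : 0 < q).
    { apply sqrt_lt_R0. apply Rmult_lt_0_compat; [lra|]. apply Rmult_lt_0_compat; [lra|now apply sqrt_lt_R0]. }
    assert (HA : 0 < A n).
    { apply Rmult_lt_reg_r with q; [exact Hq|]. rewrite Am. lra. }
    split; [exact HA|].
    replace (coef lambda n (k n) / A n - c n)
      with ((coef lambda n (k n) * q - sqrt (2 / PI) * c n) * / sqrt (2 / PI)).
    2:{ rewrite <- Am. field. lra. }
    assert (IS : 0 < / sqrt (2 / PI) <= 2).
    { split; [apply Rinv_0_lt_compat; lra|]. replace 2 with (/ (1 / 2)) at 2 by field. apply Rinv_le_contravar; lra. }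
    rewrite Rabs_mult, (Rabs_pos_eq (/ _)) by lra. rewrite (Rmult_comm 2).
    apply Rmult_le_compat; try lra. apply Rabs_pos. }
  exists (fun n => coef lambda n (k n) / A n - c n). split.
  - apply is_lim_seq_spec. intros eps. assert (Pe := cond_pos eps).
    generalize (Main (eps / 4) ltac:(lra)). apply filter_imp. intros n [_ B]. rewrite Rminus_0_r. lra.
  - generalize (Main 1 ltac:(lra)). apply filter_imp. intros n [HA _].
    rewrite fourier_coef_eq by lra. f_equal.
    change (coef lambda n (k n) = A n * (c n + (coef lambda n (k n) / A n - c n))). field. lra.
Qed.

Lemma is_lim_seq_window (omega : nat -> R) (k : nat -> nat) (l : R) :
  is_lim_seq (fun n => omega n / INR n) 0 ->
  eventually (fun n => l * INR n - omega n <= INR (k n) <= l * INR n + omega n) ->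
  is_lim_seq (fun n => INR (k n) / INR n) l.
Proof.
  intros Ho Hk. apply is_lim_seq_spec. intros eps.
  generalize (filter_and _ _ eventually_pos (filter_and _ _ Hk (is_lim_seq_close _ _ _ Ho (cond_pos eps)))).
  apply filter_imp. intros n (Hn & [K1 K2] & B).
  assert (HN : 0 < INR n) by (apply lt_0_INR; exact Hn).
  rewrite Rminus_0_r in B. apply Rabs_def2 in B.
  assert (E : omega n / INR n * INR n = omega n) by (field; lra).
  assert (Eb : omega n < eps * INR n) by (rewrite <- E; apply Rmult_lt_compat_r; lra).
  replace (INR (k n) / INR n - l) with ((INR (k n) - l * INR n) / INR n) by (field; lra).
  apply Rabs_def1; apply Rmult_lt_reg_r with (INR n); auto;
    unfold Rdiv; rewrite Rmult_assoc, Rinv_l, Rmult_1_r by lra; lra.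
Qed.

Lemma amplitude_algebra (s q t w z N : R) : s * s = 1 -> N <> 0 ->
  q * t * w * z = s * (s * q / N * t * z) * (N * w).
Proof.
  intros Hs HN. transitivity (s * s * (q * t * w * z)); [rewrite Hs; ring|]. field. exact HN.
Qed.

Theorem theorem2 (lambda : R) (omega : nat -> R)
  (Hlambda : 0 < lambda < 1)
  (Homega_pos : forall n : nat, (1 <= n)%nat -> 0 < omega n)
  (Homega_inf : is_lim_seq (fun n => omega n / Rpower (INR n) (1 / 3)) p_infty)
  (Homega_o : is_lim_seq (fun n => omega n / INR n) 0) :
  (* (1) *)
  ((forall k : nat -> nat,
      eventually (fun n =>
        alpha0 lambda * INR n - omega n <= INR (k n)
          <= alpha0 lambda * INR n + omega n) ->
      equiv_Ai
        (fun n => fourier_coef lambda n (k n))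
        (fun n =>
           powerRZ (-1) (Z.of_nat n - Z.of_nat (k n)) * sqrt 2
             / Rpower (INR n) (1 / 3)
           * (Rpower (1 + lambda) (1 / 4)
                / Rpower (lambda * (1 - lambda)) (1 / 12))
           * (1 / (sqrt (INR (k n) / INR n)
                   * Rpower (/ alpha0 lambda - INR (k n) / INR n) (1 / 4))))
        (fun n =>
           Rpower (INR n) (2 / 3) * gamma2_alpha0 lambda (INR (k n) / INR n)))
   /\
   is_lim
     (fun a => gamma2_alpha0 lambda a
               / ((alpha0 lambda - a) * (1 + lambda)
                    / Rpower (lambda * (1 - lambda)) (1 / 3)))
     (alpha0 lambda) 1)
  /\
  (* (2) *)
  (forall k : nat -> nat,
     eventually (fun n =>
       alpha0 lambda * INR n + omega n <= INR (k n)
         <= / alpha0 lambda * INR n - omega n) ->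
     equiv_osc
       (fun n => fourier_coef lambda n (k n))
       (fun n =>
          sqrt (2 / (INR n * PI))
          * (1 / (sqrt (INR (k n) / INR n)
                  * Rpower ((/ alpha0 lambda - INR (k n) / INR n)
                            * (INR (k n) / INR n - alpha0 lambda)) (1 / 4))))
       (fun n =>
          cos (INR n * h lambda (INR (k n) / INR n)
                         (phi_plus lambda (INR (k n) / INR n)) - PI / 4)))
  /\
  (* (3) *)
  ((forall k : nat -> nat,
      eventually (fun n =>
        / alpha0 lambda * INR n - omega n <= INR (k n)
          <= / alpha0 lambda * INR n + omega n) ->
      equiv_Ai
        (fun n => fourier_coef lambda n (k n))
        (fun n =>
           sqrt 2 / Rpower (INR n) (1 / 3)
           * (Rpower (1 - lambda) (1 / 4)
                / Rpower (lambda * (1 + lambda)) (1 / 12))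
           * (1 / (sqrt (INR (k n) / INR n)
                   * Rpower (INR (k n) / INR n - alpha0 lambda) (1 / 4))))
        (fun n =>
           Rpower (INR n) (2 / 3) * gamma2_alpha0_inv lambda (INR (k n) / INR n)))
   /\
   is_lim
     (fun a => gamma2_alpha0_inv lambda a
               / ((a - / alpha0 lambda) * (1 - lambda)
                    / Rpower (lambda * (1 + lambda)) (1 / 3)))
     (/ alpha0 lambda) 1).
Proof.
  assert (Bl : branch (-1) Clog_pos_cut) by (right; auto).
  assert (Bu : branch 1 Clog) by (left; auto).
  assert (El : edge (-1 * lambda) = alpha0 lambda).
  { rewrite <- edge_alpha0. f_equal. ring. }
  assert (Eu : edge (1 * lambda) = / alpha0 lambda) by (rewrite Rmult_1_l; now apply edge_alpha0_inv).
  assert (El' : edge (- (-1 * lambda)) = / alpha0 lambda).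
  { rewrite <- edge_alpha0_inv by exact Hlambda. f_equal. ring. }
  assert (Eu' : edge (- (1 * lambda)) = alpha0 lambda) by (rewrite Rmult_1_l; apply edge_alpha0).
  assert (Pl := edge_curv_pos _ _ (branch_edge_sign _ _ _ Bl Hlambda)).
  assert (Pu := edge_curv_pos _ _ (branch_edge_sign _ _ _ Bu Hlambda)).
  assert (Cube : forall u v, 0 < u -> (v / Rpower u (1 / 3)) ^ 3 = v ^ 3 / u).
  { intros u v Hu. replace ((v / Rpower u (1 / 3)) ^ 3) with (v ^ 3 / Rpower u (1 / 3) ^ 3)
      by (field; apply Rgt_not_eq, exp_pos).
    rewrite (Rpower_nat_eq u (1 / 3) 3 1) by (try (simpl; field); lra). now rewrite pow_1. }
  split; [|split; [intros k Hk; now apply (middle_range lambda omega)|]].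
  - split.
    + intros k Hk. assert (Lk := is_lim_seq_window omega k _ Homega_o Hk).
      apply (edge_equiv_Ai (-1) lambda Clog_pos_cut _ k _
        (fun n => powerRZ (-1) (Z.of_nat n - Z.of_nat (k n))) Bl Hlambda).
      * intros n. rewrite fourier_coef_eq by lra. f_equal.
        rewrite (coef_opp lambda) by lra. do 2 f_equal. ring.
      * intros n. apply powerRZ_m1_sq.
      * rewrite El. exact Lk.
      * rewrite <- El in Lk.
        assert (T := amplitude_limit (-1) lambda _ ltac:(auto) Hlambda Lk).
        eapply is_lim_seq_ext_loc; [|exact T].
        generalize eventually_pos. apply filter_imp. intros n Hn. cbv beta.
        assert (HN : 0 < INR n) by (apply lt_0_INR; exact Hn).
        rewrite <- (Rpower_mult_distr (INR n)), El' by assumption.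
        replace (-1 * (INR (k n) / INR n - / alpha0 lambda)) with (/ alpha0 lambda - INR (k n) / INR n) by ring.
        replace (1 - -1 * lambda) with (1 + lambda) by ring.
        replace (lambda * (1 + -1 * lambda)) with (lambda * (1 - lambda)) by ring.
        apply amplitude_algebra; [apply powerRZ_m1_sq|apply Rgt_not_eq, exp_pos].
    + rewrite <- El.
      apply (is_lim_ext (fun a => gamma2 Clog_pos_cut lambda a
        / (-1 * (a - edge (-1 * lambda)) * ((1 + lambda) / Rpower (lambda * (1 - lambda)) (1 / 3))))).
      * intros a. unfold gamma2_alpha0. f_equal. unfold Rdiv. ring.
      * apply gamma2_linear; auto.
        -- apply Rdiv_lt_0_compat; [lra|apply exp_pos].
        -- rewrite Cube by (apply Rmult_lt_0_compat; lra). unfold edge_curv. field. repeat split; lra.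
  - split.
    + intros k Hk. assert (Lk := is_lim_seq_window omega k _ Homega_o Hk).
      apply (edge_equiv_Ai 1 lambda Clog _ k _ (fun _ => 1) Bu Hlambda).
      * intros n. rewrite fourier_coef_eq by lra. f_equal. now rewrite !Rmult_1_l.
      * intros n. ring.
      * rewrite Eu. exact Lk.
      * rewrite <- Eu in Lk.
        assert (T := amplitude_limit 1 lambda _ ltac:(auto) Hlambda Lk).
        eapply is_lim_seq_ext_loc; [|exact T].
        generalize eventually_pos. apply filter_imp. intros n Hn. cbv beta.
        assert (HN : 0 < INR n) by (apply lt_0_INR; exact Hn).
        rewrite <- (Rpower_mult_distr (INR n)), Eu' by assumption.
        replace (1 * (INR (k n) / INR n - alpha0 lambda)) with (INR (k n) / INR n - alpha0 lambda) by ring.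
        rewrite <- (Rmult_1_l (sqrt 2)) at 2. rewrite (Rmult_1_l lambda).
        apply amplitude_algebra; [ring|apply Rgt_not_eq, exp_pos].
    + rewrite <- Eu.
      apply (is_lim_ext (fun a => gamma2 Clog lambda a
        / (1 * (a - edge (1 * lambda)) * ((1 - lambda) / Rpower (lambda * (1 + lambda)) (1 / 3))))).
      * intros a. unfold gamma2_alpha0_inv. f_equal. unfold Rdiv. ring.
      * apply gamma2_linear; auto.
        -- apply Rdiv_lt_0_compat; [lra|apply exp_pos].
        -- rewrite Cube by (apply Rmult_lt_0_compat; lra). unfold edge_curv. field. repeat split; lra.
Qed.
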